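(* Let $q>0$, let $g$ be a function, and put $f(x)=g(x^2)$ for $x\ge 0$. Assume: (1) $g$ is a regular (holomorphic) function on a domain containing $[0,\infty)$, with Taylor series at $z=0$ written in the form $$g(z)=\sum_{m=0}^\infty \frac{\bar g^{(m)}(0)}{m!}\,(-z)^m ;$$ (2) $g(z)=\mathrm{O}(z^{-d})$ as $z\to\infty$ (along the positive real axis), for some $d>1/4$; (3) there is a regular (single-valued holomorphic) function $s\mapsto \bar g^{(s)}(0)$ defined on the half-plane $H(\delta)=\{s\in\mathbb{C}:\ \mathrm{Re}\,s\ge -\delta\}$, for some $1/4<\delta<1$, which takes at $s=m=0,1,2,\dots$ the values $\bar g^{(m)}(0)$ appearing in (1), and which satisfies the growth condition $$|\bar g^{(s)}(0)|<C\,e^{Pv+B|w|}\qquad\text{for all } s=v+iw\in H(\delta)\ (v,w\in\mathbb{R}),$$ for some real constants $C$, $P$ and $B$ with $B<\pi/2$. Then the zero-order Hankel transform $$A(q)=\int_0^\infty J_0(qx)\,f(x)\,x\,dx$$ may be expressed, for $-1<\alpha<0$, in the form $$A(q)=\frac{1}{\pi i\,q^2}\int_{\alpha-i\infty}^{\alpha+i\infty}\bar g^{(s)}(0)\,\Gamma(s+1)\left(\frac{q^2}{4}\right)^{-s}ds .$$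
   Context: $J_0$ is the Bessel function of the first kind of order zero and $\Gamma$ is the Gamma function. The integral over $(0,\infty)$ is an improper integral, $\lim_{R\to\infty}\int_0^R$. For an integer $m\ge0$ the notation $\bar g^{(m)}(0)$ means $(-1)^m g^{(m)}(0)$, where $g^{(m)}$ is the $m$-th derivative; for complex $s$, $\bar g^{(s)}(0)$ denotes the holomorphic interpolation of these values described in condition (3). The contour integral is along the vertical line $\mathrm{Re}\,s=\alpha$, oriented upwards.
   Formalization: The formula is proved for -1 < α < 0 with the added condition α ≥ -δ, since the interpolating function is only defined on Re s ≥ -δ and the contour integral is otherwise undefined. *)

(* Defs.v *)
From Stdlib Require Export Reals Factorial.
From Coquelicot Require Export Coquelicot.

Open Scope R_scope.

Definition open_C (U : C -> Prop) : Prop := open (T := C_UniformSpace) U.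

Definition is_domain (D : C -> Prop) : Prop :=
  open_C D /\ (exists z, D z) /\
  forall U V : C -> Prop, open_C U -> open_C V ->
    (forall z, D z -> U z \/ V z) ->
    (exists z, D z /\ U z) -> (exists z, D z /\ V z) ->
    exists z, D z /\ U z /\ V z.

(* The set [S] need not be open: a function is regular on [S] when it is
   complex differentiable on a neighbourhood of every point of [S], that is, on
   an open set containing [S].  The values of [h] off that open set are junk. *)
Definition regular_on (S : C -> Prop) (h : C -> C) : Prop :=
  forall z : C, S z ->
    locally (T := C_UniformSpace) z
      (fun w => ex_derive (K := C_AbsRing) (V := C_NormedModule) h w).

Definition half_plane (delta : R) (s : C) : Prop := - delta <= Re s.

Definition C_derive_n (n : nat) (h : C -> C) : C -> C :=
  Nat.iter n C_derive h.

(* The numbers (-1)^m g^(m)(0). *)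
Definition gbar0 (g : C -> C) (m : nat) : C :=
  (RtoC ((-1) ^ m) * C_derive_n m g (RtoC 0))%C.

Definition Cexp (z : C) : C := (exp (Re z) * cos (Im z), exp (Re z) * sin (Im z)).

(* a^s for a > 0, with the real logarithm of a. *)
Definition rcpow (a : R) (s : C) : C := Cexp (s * RtoC (ln a))%C.

(* Euler's integral.  It converges, and so defines the Gamma function, for
   Re s > 0, the only region in which it is evaluated below. *)
Definition CGamma (s : C) : C :=
  RInt_gen (V := C_R_CompleteNormedModule)
    (fun t : R => (rcpow t (s - RtoC 1) * RtoC (exp (- t)))%C)
    (at_right 0) (Rbar_locally p_infty).

Definition bessel_J0 (x : R) : R :=
  Series (fun k => (-1) ^ k / (INR (fact k)) ^ 2 * (x / 2) ^ (2 * k)).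

(* The improper integral of J_0(qx) f(x) x over (0, oo) converges to A. *)
Definition is_hankel0 (f : R -> C) (q : R) (A : C) : Prop :=
  is_RInt_gen (V := C_R_NormedModule)
    (fun x : R => (RtoC (bessel_J0 (q * x)) * f x * RtoC x)%C)
    (at_point 0) (Rbar_locally p_infty) A.

(* The integral of h along the upward line Re s = alpha converges to I; on
   s = alpha + i w one has ds = i dw, and the two limits w -> -oo, w -> +oo are
   taken independently, not as a principal value. *)
Definition is_vertical_int (alpha : R) (h : C -> C) (I : C) : Prop :=
  is_RInt_gen (V := C_R_NormedModule)
    (fun w : R => (h (RtoC alpha + Ci * RtoC w) * Ci)%C)
    (Rbar_locally m_infty) (Rbar_locally p_infty) I.

(* Main.v *)
Require Import Defs.
From Stdlib Require Import Reals.
From Coquelicot Require Import Coquelicot.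
From Stdlib Require Import Lra Lia FunctionalExtensionality Classical.

(* Write phi(s) for the interpolation of the Taylor coefficients.  On the line
   Re s = - delta the integral of phi(s) Gamma(- s) x^s converges absolutely,
   because Gamma decays like exp(- theta |Im s|) for every theta < pi/2.  Moving
   the line to the right picks up the Taylor series of g, so that
     g(x) = 1/(2 pi) int phi(s) Gamma(- s) x^s dw      (s = - delta + i w)
   for small x > 0, hence for all x > 0 by the identity theorem.  Integrating
   J0(q x) g(x^2) x by parts (a primitive of x J0(q x) is x J1(q x) / q, and
   J1(x) = O(x^(-1/2)), which is where delta > 1/4 is needed) leaves an absolutely
   convergent double integral; after Fubini the inner integral is Weber's integral
   of J1(q x) against a power of x, whose product with a Gamma factor is computed
   by a second use of Fubini from the Hankel transform of a Gaussian.  Finally the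
   line Re s = - delta is moved to Re s = alpha.

   All improper integrals become, through x = e^y, integrals over the whole line
   of continuous functions bounded by K exp(- eta |w|).  Cauchy's theorem is needed
   on rectangles only, where Goursat's bisection applies. *)

(** On Re s = - delta the function x J0(q x) x^(2 s) has size x^(1/2 - 2 delta) at infinity, which
    is not absolutely integrable for delta <= 3/4; Fubini's theorem therefore has to wait for the
    integration by parts, after which the size is x^(-1/2 - 2 delta).

    The margin between the growth exp(B |w|) and the decay of Gamma is spent in two halves. One
    keeps the integral over w convergent. The other pays for the growth of exp(s zeta) when zeta =
    log x leaves the real axis: the identity theorem needs holomorphy on a neighbourhood of the real
    axis, and in the variable zeta no branch of the logarithm occurs.

    Gamma is used only where Euler's integral converges. Before the contour crosses s = m the
    integrand is translated by - m and rewritten by the functional equation, so that the strip -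
    delta <= Re s <= 1 - delta with a simple pole at 0 serves for every m.

    Limits and integrals are exchanged by explicit exponential tail estimates, which is why the
    classes of integrands carry their constants along. *)

Local Notation CV := C_R_CompleteNormedModule.
Local Notation continuous_C := (continuous (U := C_UniformSpace)).
Local Notation continuous_RC := (continuous (T := R_UniformSpace) (U := C_UniformSpace)).
Local Notation is_derive_RC := (is_derive (K := R_AbsRing) (V := C_R_NormedModule)).
Local Notation is_RInt_C := (is_RInt (V := C_R_NormedModule)).
Local Notation ex_derive_continuous_R := (ex_derive_continuous (K := R_AbsRing) (V := R_NormedModule)).

(** * Elementary facts on complex numbers and the modulus *)

Lemma C_ext (z w : C) : Re z = Re w -> Im z = Im w -> z = w.
Proof. destruct z, w; simpl; intros; subst; reflexivity. Qed.

Lemma Cmod_RtoC_nonneg (x : R) : 0 <= x -> Cmod x = x.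
Proof. intros; rewrite Cmod_R; now apply Rabs_pos_eq. Qed.

Lemma Cmod_minus_sym (z w : C) : Cmod (z - w)%C = Cmod (w - z)%C.
Proof. rewrite <- Cmod_opp; f_equal; ring. Qed.

Lemma Cmod_le_plus (z w : C) : Cmod z <= Cmod w + Cmod (z - w)%C.
Proof.
replace z with (w + (z - w))%C at 1 by ring. apply Cmod_triangle.
Qed.

Lemma Cmod_le_abs (z : C) : Cmod z <= Rabs (Re z) + Rabs (Im z).
Proof.
replace z with ((Re z : C) + Ci * (Im z : C))%C at 1
  by (apply C_ext; simpl; ring).
eapply Rle_trans; [apply Cmod_triangle|].
rewrite Cmod_mult, Cmod_Ci, !Cmod_R; lra.
Qed.

Lemma Cminus_eq_0 (z w : C) : (z - w)%C = 0 -> z = w.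
Proof. intros H. replace z with ((z - w) + w)%C by ring. rewrite H. ring. Qed.

Lemma C_eq_of_dist_le (z w : C) : (forall e, 0 < e -> Cmod (z - w)%C <= e) -> z = w.
Proof.
intros H. apply Cminus_eq_0, Cmod_eq_0. pose proof (Cmod_ge_0 (z - w)%C) as H0.
destruct (Rle_lt_or_eq_dec _ _ H0) as [Hlt|]; [|congruence].
specialize (H (Cmod (z - w)%C / 2) ltac:(lra)). lra.
Qed.

Lemma Im_le_Cmod (z : C) : Rabs (Im z) <= Cmod z.
Proof.
eapply Rle_trans; [|apply Rmax_Cmod]. apply Rmax_r.
Qed.

Lemma Cmod_Re_Im_lt (z w : C) (e : R) :
  Cmod (z - w)%C < e -> Rabs (Re z - Re w) < e /\ Rabs (Im z - Im w) < e.
Proof.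
intros H.
pose proof (re_le_Cmod (z - w)%C); pose proof (Im_le_Cmod (z - w)%C).
unfold Re, Im in *; simpl in *. unfold Rminus. split; lra.
Qed.

Lemma RtoC_m1 : RtoC (-1) = (- (1))%C.
Proof. apply C_ext; simpl; ring. Qed.

Lemma Ci_mult_Ci : (Ci * Ci)%C = (-1 : C).
Proof. apply C_ext; simpl; ring. Qed.

Lemma Cmod_norm_CV (z : C) : norm (z : CV) = Cmod z.
Proof.
unfold norm; simpl. unfold prod_norm, Cmod, norm; simpl. unfold abs; simpl.
f_equal. rewrite !Rmult_1_r, <- !Rabs_mult, !Rabs_pos_eq by apply Rle_0_sqr. ring.
Qed.

(** * Continuity and complex differentiability in terms of the modulus *)

(** Balls of the product uniform structure are squares, and a square of half-side [e] lies in the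
    disc of radius [2 * e]. *)
Lemma C_ball_Cmod (l z : C) (e : R) :
  ball (M := C_UniformSpace) l e z -> Cmod (z - l)%C < 2 * e.
Proof.
intros [H1 H2]. unfold ball in H1, H2; simpl in H1, H2.
unfold AbsRing_ball, abs, minus, plus, opp in H1, H2; simpl in H1, H2.
eapply Rle_lt_trans; [apply Cmod_le_abs|]. simpl. lra.
Qed.

Lemma continuous_CmodP {T : UniformSpace} (f : T -> C) (x : T) :
  continuous_C f x <->
  forall e : R, 0 < e -> locally x (fun y => Cmod (f y - f x)%C < e).
Proof.
split.
- intros H e He.
  assert (He2 : 0 < e / 2) by lra.
  pose proof (proj1 (filterlim_locally (U := C_UniformSpace) f (f x)) H
    (mkposreal _ He2)) as H1.
  revert H1; apply filter_imp. intros y Hy.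
  apply C_ball_Cmod in Hy. simpl in Hy. lra.
- intros H. apply (filterlim_locally (U := C_UniformSpace) f (f x)).
  intros e. generalize (H e (cond_pos e)). apply filter_imp.
  intros y Hy. apply Cmod_Re_Im_lt in Hy. exact Hy.
Qed.

Lemma continuous_Rplus {T : UniformSpace} (u v : T -> R) (x : T) :
  continuous u x -> continuous v x -> continuous (fun t => u t + v t) x.
Proof. exact (continuous_plus (V := R_NormedModule) u v x). Qed.

Lemma continuous_Ropp {T : UniformSpace} (u : T -> R) (x : T) :
  continuous u x -> continuous (fun t => - u t) x.
Proof. exact (continuous_opp (V := R_NormedModule) u x). Qed.

Lemma continuous_Rminus {T : UniformSpace} (u v : T -> R) (x : T) :
  continuous u x -> continuous v x -> continuous (fun t => u t - v t) x.
Proof. exact (continuous_minus (V := R_NormedModule) u v x). Qed.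

Lemma continuous_Rmult {T : UniformSpace} (u v : T -> R) (x : T) :
  continuous u x -> continuous v x -> continuous (fun t => u t * v t) x.
Proof. exact (continuous_mult (K := R_AbsRing) u v x). Qed.

Lemma continuous_pair {T : UniformSpace} (u v : T -> R) (x : T) :
  continuous u x -> continuous v x ->
  continuous_C (fun t => ((u t, v t) : C)) x.
Proof.
intros Hu Hv.
apply (continuous_comp_2 u v (fun a b => (a, b) : C_UniformSpace) x Hu Hv).
apply (continuous_ext (fun p : R * R => p)); [intros [a b]; reflexivity|].
apply continuous_id.
Qed.

Lemma continuous_Re {T : UniformSpace} (f : T -> C) (x : T) :
  continuous_C f x -> continuous (fun t => Re (f t)) x.
Proof. intros H. apply (continuous_comp f (fun z : C => fst z)); [exact H|apply continuous_fst]. Qed.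

Lemma continuous_Im {T : UniformSpace} (f : T -> C) (x : T) :
  continuous_C f x -> continuous (fun t => Im (f t)) x.
Proof. intros H. apply (continuous_comp f (fun z : C => snd z)); [exact H|apply continuous_snd]. Qed.

Lemma continuous_RtoC {T : UniformSpace} (u : T -> R) (x : T) :
  continuous u x -> continuous_C (fun t => RtoC (u t)) x.
Proof. intros H; apply continuous_pair; [exact H|apply continuous_const]. Qed.

Lemma continuous_Cplus {T : UniformSpace} (f g : T -> C) (x : T) :
  continuous_C f x -> continuous_C g x ->
  continuous_C (fun t => (f t + g t)%C) x.
Proof. exact (continuous_plus (V := C_R_NormedModule) f g x). Qed.

Lemma continuous_Copp {T : UniformSpace} (f : T -> C) (x : T) :
  continuous_C f x ->
  continuous_C (fun t => (- f t)%C) x.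
Proof. exact (continuous_opp (V := C_R_NormedModule) f x). Qed.

Lemma continuous_Cminus {T : UniformSpace} (f g : T -> C) (x : T) :
  continuous_C f x -> continuous_C g x ->
  continuous_C (fun t => (f t - g t)%C) x.
Proof. intros; apply continuous_Cplus; [|apply continuous_Copp]; assumption. Qed.

Lemma continuous_Cmult {T : UniformSpace} (f g : T -> C) (x : T) :
  continuous_C f x -> continuous_C g x ->
  continuous_C (fun t => (f t * g t)%C) x.
Proof.
intros Hf Hg.
pose proof (continuous_Re f x Hf); pose proof (continuous_Im f x Hf).
pose proof (continuous_Re g x Hg); pose proof (continuous_Im g x Hg).
apply (continuous_ext (T := T) (U := C_UniformSpace)
  (fun t => (Re (f t) * Re (g t) - Im (f t) * Im (g t),
             Re (f t) * Im (g t) + Im (f t) * Re (g t)) : C)); [reflexivity|].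
apply continuous_pair.
- now apply continuous_Rminus; apply continuous_Rmult.
- now apply continuous_Rplus; apply continuous_Rmult.
Qed.

Lemma continuous_Rexp {T : UniformSpace} (u : T -> R) (x : T) :
  continuous u x -> continuous (fun t => exp (u t)) x.
Proof.
intros H; apply (continuous_comp u exp x H).
apply (ex_derive_continuous_R); auto_derive; exact I.
Qed.

Lemma continuous_Cexp {T : UniformSpace} (f : T -> C) (x : T) :
  continuous_C f x ->
  continuous_C (fun t => Cexp (f t)) x.
Proof.
intros Hf.
pose proof (continuous_Re f x Hf) as Hr; pose proof (continuous_Im f x Hf) as Hi.
apply (continuous_ext (T := T) (U := C_UniformSpace)
  (fun t => (exp (Re (f t)) * cos (Im (f t)), exp (Re (f t)) * sin (Im (f t))) : C));
  [reflexivity|].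
assert (He : continuous (fun t => exp (Re (f t))) x) by (now apply continuous_Rexp).
apply continuous_pair; apply continuous_Rmult; [exact He| |exact He|].
- apply (continuous_comp (fun t => Im (f t)) cos x Hi).
  apply (ex_derive_continuous_R); auto_derive; exact I.
- apply (continuous_comp (fun t => Im (f t)) sin x Hi).
  apply (ex_derive_continuous_R); auto_derive; exact I.
Qed.

(* Stated with the modulus so that it does not depend on which of the two
   uniform structures on [C] is used. *)
Definition Cder (h : C -> C) (z l : C) : Prop :=
  forall e : R, 0 < e -> exists r : R, 0 < r /\ forall w : C,
    Cmod (w - z)%C < r -> Cmod (h w - h z - l * (w - z))%C <= e * Cmod (w - z)%C.

Definition Cdiff (h : C -> C) (z : C) : Prop := exists l, Cder h z l.

(** Through this equivalence the rules for sums, products and compositions carry over to [Cder]. *)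
Lemma Cder_is_derive (h : C -> C) (z l : C) :
  Cder h z l <-> is_derive (K := C_AbsRing) (V := AbsRing_NormedModule C_AbsRing) h z l.
Proof.
assert (E : forall w, Cmod (h w - h z - (w - z) * l)%C = Cmod (h w - h z - l * (w - z))%C)
  by (intros; f_equal; ring).
split.
- intros H. split; [apply is_linear_scal_l|]. intros y Hy e.
  assert (Ey : z = y)
    by (apply (is_filter_lim_locally_unique (V := AbsRing_NormedModule C_AbsRing)); exact Hy). subst y.
  destruct (H e (cond_pos e)) as [r [Hr Hr']]. exists (mkposreal r Hr). intros w Hw.
  specialize (Hr' w Hw). rewrite <- E in Hr'. exact Hr'.
- intros [_ H] e He. destruct (H z (fun P HP => HP) (mkposreal e He)) as [r Hr].
  exists r; split; [apply cond_pos|]. intros w Hw. rewrite <- E. exact (Hr w Hw).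
Qed.

Lemma ex_derive_Cdiff (h : C -> C) (z : C) :
  ex_derive (K := C_AbsRing) (V := C_NormedModule) h z -> Cdiff h z.
Proof.
intros [l [_ H]]. exists l. intros e He.
destruct (H z (fun P HP => HP) (mkposreal e He)) as [r Hr].
exists r; split; [apply cond_pos|]. intros w Hw.
replace (h w - h z - l * (w - z))%C with (h w - h z - (w - z) * l)%C by ring.
exact (Hr w Hw).
Qed.

Lemma Cder_continuous (h : C -> C) (z l : C) : Cder h z l ->
  forall e : R, 0 < e -> exists r : R, 0 < r /\
    forall w, Cmod (w - z)%C < r -> Cmod (h w - h z)%C < e.
Proof.
intros H e He. destruct (H 1 Rlt_0_1) as [r [Hr H1]].
set (L := Cmod l + 1). assert (HL : 0 < L) by (unfold L; pose proof (Cmod_ge_0 l); lra).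
exists (Rmin r (e / L)). split.
- apply Rmin_pos; [assumption|]. apply Rdiv_lt_0_compat; assumption.
- intros w Hw.
  pose proof (Rmin_l r (e / L)); pose proof (Rmin_r r (e / L)).
  specialize (H1 w ltac:(lra)).
  replace (h w - h z)%C with ((h w - h z - l * (w - z)) + l * (w - z))%C by ring.
  eapply Rle_lt_trans; [apply Cmod_triangle|]. rewrite Cmod_mult.
  assert (Cmod (w - z)%C < e / L) by lra.
  apply Rle_lt_trans with (L * Cmod (w - z)%C); [unfold L; lra|].
  apply Rlt_le_trans with (L * (e / L)); [now apply Rmult_lt_compat_l|].
  right; field; lra.
Qed.

Lemma Cdiff_comp_continuous {T : UniformSpace} (h : C -> C) (f : T -> C) (x : T) :
  continuous_C f x -> Cdiff h (f x) ->
  continuous_C (fun t => h (f t)) x.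
Proof.
intros Hf [l Hl]. apply continuous_CmodP. intros e He.
destruct (Cder_continuous h (f x) l Hl e He) as [r [Hr H]].
generalize (proj1 (continuous_CmodP f x) Hf r Hr). apply filter_imp.
intros y; apply H.
Qed.

Lemma Cder_const (c z : C) : Cder (fun _ => c) z 0.
Proof. apply Cder_is_derive, (is_derive_const (K := C_AbsRing) (V := AbsRing_NormedModule C_AbsRing)). Qed.

Lemma Cder_id (z : C) : Cder (fun w => w) z 1.
Proof. apply Cder_is_derive, (is_derive_id (K := C_AbsRing)). Qed.

Lemma Cder_plus (h k : C -> C) (z l m : C) :
  Cder h z l -> Cder k z m -> Cder (fun w => h w + k w)%C z (l + m)%C.
Proof.
rewrite !Cder_is_derive.
apply (is_derive_plus (K := C_AbsRing) (V := AbsRing_NormedModule C_AbsRing) h k).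
Qed.

Lemma Cder_mult (h k : C -> C) (z l m : C) :
  Cder h z l -> Cder k z m ->
  Cder (fun w => h w * k w)%C z (l * k z + h z * m)%C.
Proof.
rewrite !Cder_is_derive. intros H K.
exact (is_derive_mult (K := C_AbsRing) h k z l m H K Cmult_comm).
Qed.

Lemma Cder_comp (h k : C -> C) (z l m : C) :
  Cder h z l -> Cder k (h z) m -> Cder (fun w => k (h w)) z (m * l)%C.
Proof.
rewrite !Cder_is_derive, Cmult_comm. intros H K.
exact (is_derive_comp (K := C_AbsRing) (V := AbsRing_NormedModule C_AbsRing) k h z m l K H).
Qed.

Lemma Cder_ext_loc (h k : C -> C) (z l : C) (r : R) : 0 < r ->
  (forall w, Cmod (w - z)%C < r -> h w = k w) -> Cder h z l -> Cder k z l.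
Proof.
intros Hr E H e He. destruct (H e He) as [s [Hs H1]].
exists (Rmin r s); split; [now apply Rmin_pos|].
intros w Hw. pose proof (Rmin_l r s); pose proof (Rmin_r r s).
rewrite <- (E w) by lra. rewrite <- (E z).
- apply H1; lra.
- replace (z - z)%C with (0 : C) by ring. rewrite Cmod_0; assumption.
Qed.

(** The remainder is exactly (w - z)^2 / (w z^2); the first entry of the radius keeps |w| above |z|
    / 2, the second makes the remaining factor at most [e]. *)
Lemma Cder_inv_id (z : C) : z <> 0 -> Cder Cinv z (- (/ z * / z))%C.
Proof.
intros Hz e He.
set (A := Cmod z). assert (HA : 0 < A) by now apply Cmod_gt_0.
exists (Rmin (A / 2) (e * (A * A * A / 2))). split.
- apply Rmin_pos; [lra|].
  apply Rmult_lt_0_compat; [assumption|].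
  apply Rdiv_lt_0_compat; [|lra]. repeat apply Rmult_lt_0_compat; assumption.
- intros w Hw.
  pose proof (Rmin_l (A / 2) (e * (A * A * A / 2))).
  pose proof (Rmin_r (A / 2) (e * (A * A * A / 2))).
  assert (Hw1 : A / 2 < Cmod w).
  { pose proof (Cmod_le_plus z w) as H1. rewrite Cmod_minus_sym in H1.
    fold A in H1; lra. }
  assert (w <> 0) by (apply Cmod_gt_0; lra).
  replace (/ w - / z - - (/ z * / z) * (w - z))%C
    with ((w - z) * (w - z) * (/ w * / z * / z))%C by (field; split; assumption).
  rewrite !Cmod_mult, !Cmod_inv by assumption. fold A.
  set (d := Cmod (w - z)%C) in *.
  assert (Hd : 0 <= d) by apply Cmod_ge_0.
  assert (Hinv : / Cmod w * / A * / A <= 2 / (A * A * A)).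
  { replace (2 / (A * A * A)) with (/ (A / 2) * / A * / A) by (field; lra).
    assert (0 < / A) by now apply Rinv_0_lt_compat.
    apply Rmult_le_compat_r; [lra|]. apply Rmult_le_compat_r; [lra|].
    apply Rinv_le_contravar; lra. }
  assert (Hpos : 0 < A * A * A) by (repeat apply Rmult_lt_0_compat; assumption).
  apply Rle_trans with (d * d * (2 / (A * A * A))).
  + apply Rmult_le_compat_l; [now apply Rmult_le_pos|assumption].
  + replace (d * d * (2 / (A * A * A))) with (d * (2 / (A * A * A)) * d) by ring.
    apply Rmult_le_compat_r; [assumption|].
    replace e with (e * (A * A * A / 2) * (2 / (A * A * A))) by (field; lra).
    apply Rmult_le_compat_r; [|lra].
    left; apply Rdiv_lt_0_compat; lra.
Qed.

Lemma Cdiff_const (c z : C) : Cdiff (fun _ => c) z.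
Proof. eexists; apply Cder_const. Qed.

Lemma Cdiff_id (z : C) : Cdiff (fun w => w) z.
Proof. eexists; apply Cder_id. Qed.

Lemma Cdiff_plus (h k : C -> C) (z : C) :
  Cdiff h z -> Cdiff k z -> Cdiff (fun w => h w + k w)%C z.
Proof. intros [l H] [m K]; eexists; apply Cder_plus; eassumption. Qed.

Lemma Cdiff_mult (h k : C -> C) (z : C) :
  Cdiff h z -> Cdiff k z -> Cdiff (fun w => h w * k w)%C z.
Proof. intros [l H] [m K]; eexists; apply Cder_mult; eassumption. Qed.

Lemma Cdiff_comp (h k : C -> C) (z : C) :
  Cdiff h z -> Cdiff k (h z) -> Cdiff (fun w => k (h w)) z.
Proof. intros [l H] [m K]; eexists; eapply Cder_comp; eassumption. Qed.

Lemma Cdiff_ext (h k : C -> C) (z : C) :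
  (forall w, h w = k w) -> Cdiff h z -> Cdiff k z.
Proof.
intros E [l H]; exists l. apply (Cder_ext_loc h k z l 1); auto with real.
Qed.

Lemma Cdiff_opp (h : C -> C) (z : C) : Cdiff h z -> Cdiff (fun w => - h w)%C z.
Proof.
intros H. apply (Cdiff_ext (fun w => (-1 : C) * h w)%C).
- intros w; ring.
- apply Cdiff_mult; [apply Cdiff_const|assumption].
Qed.

Lemma Cdiff_minus (h k : C -> C) (z : C) :
  Cdiff h z -> Cdiff k z -> Cdiff (fun w => h w - k w)%C z.
Proof. intros H K; apply Cdiff_plus; [|apply Cdiff_opp]; assumption. Qed.

Lemma Cdiff_inv (h : C -> C) (z : C) :
  Cdiff h z -> h z <> 0 -> Cdiff (fun w => / h w)%C z.
Proof.
intros H Hz. apply (Cdiff_comp h Cinv); [assumption|].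
eexists; apply Cder_inv_id; assumption.
Qed.

Lemma Cdiff_div (h k : C -> C) (z : C) :
  Cdiff h z -> Cdiff k z -> k z <> 0 -> Cdiff (fun w => h w / k w)%C z.
Proof. intros H K Hz; apply Cdiff_mult; [|apply Cdiff_inv]; assumption. Qed.

(** * Integrals of complex-valued functions over segments *)

Definition CIntegrable (f : R -> C) (a b : R) : Prop := ex_RInt (V := CV) f a b.

Definition CInt (f : R -> C) (a b : R) : C := RInt (V := CV) f a b.

Definition ccont (f : R -> C) : Prop :=
  forall x : R, continuous_RC f x.

Lemma CIntegrable_segment (f : R -> C) (a b : R) : a <= b ->
  (forall x, a <= x <= b -> continuous_RC f x) ->
  CIntegrable f a b.
Proof.
intros Hab H. apply (ex_RInt_continuous (V := CV)).
rewrite Rmin_left, Rmax_right by assumption. exact H.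
Qed.

Lemma ccont_integrable (f : R -> C) (a b : R) : ccont f -> CIntegrable f a b.
Proof. intros H. apply (ex_RInt_continuous (V := CV)). intros; apply H. Qed.

Lemma CInt_correct (f : R -> C) (a b : R) :
  CIntegrable f a b -> is_RInt_C f a b (CInt f a b).
Proof. apply (RInt_correct (V := CV)). Qed.

Lemma CInt_unique (f : R -> C) (a b : R) (l : C) :
  is_RInt_C f a b l -> CInt f a b = l.
Proof. apply (is_RInt_unique (V := CV)). Qed.

Lemma CInt_components (f : R -> C) (a b : R) : CIntegrable f a b ->
  CInt f a b = (RInt (fun x => Re (f x)) a b, RInt (fun x => Im (f x)) a b).
Proof.
intros H. apply CInt_correct in H.
pose proof (is_RInt_fct_extend_fst (U := R_NormedModule) (V := R_NormedModule) f a b _ H) as H1.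
pose proof (is_RInt_fct_extend_snd (U := R_NormedModule) (V := R_NormedModule) f a b _ H) as H2.
apply (is_RInt_unique (V := R_CompleteNormedModule)) in H1.
apply (is_RInt_unique (V := R_CompleteNormedModule)) in H2.
apply C_ext; simpl; symmetry; assumption.
Qed.

Lemma is_RInt_pair (f : R -> C) (a b : R) (l : C) :
  is_RInt (fun x => Re (f x)) a b (Re l) -> is_RInt (fun x => Im (f x)) a b (Im l) ->
  is_RInt_C f a b l.
Proof.
intros H1 H2. destruct l as [l1 l2].
apply (is_RInt_fct_extend_pair (U := R_NormedModule) (V := R_NormedModule)); assumption.
Qed.

Lemma is_RInt_Re (f : R -> C) (a b : R) (l : C) :
  is_RInt_C f a b l -> is_RInt (fun x => Re (f x)) a b (Re l).
Proof. apply (is_RInt_fct_extend_fst (U := R_NormedModule) (V := R_NormedModule) f a b l). Qed.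

Lemma is_RInt_Im (f : R -> C) (a b : R) (l : C) :
  is_RInt_C f a b l -> is_RInt (fun x => Im (f x)) a b (Im l).
Proof. apply (is_RInt_fct_extend_snd (U := R_NormedModule) (V := R_NormedModule) f a b l). Qed.

Lemma is_RInt_Cmult (f : R -> C) (a b : R) (l c : C) :
  is_RInt_C f a b l ->
  is_RInt_C (fun x => c * f x)%C a b (c * l)%C.
Proof.
intros H. pose proof (is_RInt_Re _ _ _ _ H) as H1. pose proof (is_RInt_Im _ _ _ _ H) as H2.
apply is_RInt_pair; simpl.
- apply (is_RInt_minus (V := R_NormedModule) (fun x => Re c * Re (f x)) (fun x => Im c * Im (f x)));
  apply (is_RInt_scal (V := R_NormedModule)); assumption.
- apply (is_RInt_plus (V := R_NormedModule) (fun x => Re c * Im (f x)) (fun x => Im c * Re (f x)));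
  apply (is_RInt_scal (V := R_NormedModule)); assumption.
Qed.

Lemma CInt_mult (f : R -> C) (a b : R) (c : C) : CIntegrable f a b ->
  CInt (fun x => c * f x)%C a b = (c * CInt f a b)%C.
Proof. intros H. apply CInt_unique, is_RInt_Cmult, CInt_correct, H. Qed.

Lemma CInt_plus (f g : R -> C) (a b : R) : CIntegrable f a b -> CIntegrable g a b ->
  CInt (fun x => f x + g x)%C a b = (CInt f a b + CInt g a b)%C.
Proof.
intros H K. apply CInt_unique.
apply (is_RInt_plus (V := C_R_NormedModule)); apply CInt_correct; assumption.
Qed.

Lemma CInt_minus (f g : R -> C) (a b : R) : CIntegrable f a b -> CIntegrable g a b ->
  CInt (fun x => f x - g x)%C a b = (CInt f a b - CInt g a b)%C.
Proof.
intros H K. apply CInt_unique.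
apply (is_RInt_minus (V := C_R_NormedModule)); apply CInt_correct; assumption.
Qed.

Lemma CInt_Chasles (f : R -> C) (a b c : R) : CIntegrable f a b -> CIntegrable f b c ->
  (CInt f a b + CInt f b c)%C = CInt f a c.
Proof. intros H K. apply (RInt_Chasles (V := CV)); assumption. Qed.

Lemma CInt_Cmod_le (f : R -> C) (g : R -> R) (a b : R) : a <= b ->
  CIntegrable f a b -> ex_RInt g a b -> (forall x, a <= x <= b -> Cmod (f x) <= g x) ->
  Cmod (CInt f a b) <= RInt g a b.
Proof.
intros Hab Hf Hg H. rewrite <- Cmod_norm_CV.
apply (norm_RInt_le (V := CV) f g a b); try assumption.
- intros x Hx; rewrite Cmod_norm_CV; now apply H.
- now apply CInt_correct.
- now apply (RInt_correct (V := R_CompleteNormedModule)).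
Qed.

Lemma CInt_Cmod_le_const (f : R -> C) (M a b : R) : a <= b ->
  CIntegrable f a b -> (forall x, a <= x <= b -> Cmod (f x) <= M) ->
  Cmod (CInt f a b) <= (b - a) * M.
Proof.
intros Hab Hf H. rewrite <- Cmod_norm_CV.
apply (norm_RInt_le_const (V := CV) f a b); try assumption.
- intros x Hx; rewrite Cmod_norm_CV; now apply H.
- now apply CInt_correct.
Qed.

(** * Derivatives of curves in the plane and the mean value inequality *)

Lemma is_derive_pair (f : R -> C) (x : R) (l : C) :
  is_derive (fun t => Re (f t)) x (Re l) -> is_derive (fun t => Im (f t)) x (Im l) ->
  is_derive_RC f x l.
Proof.
intros H1 H2. split; [apply is_linear_scal_l|].
intros y Hy e.
assert (Ey : x = y) by (apply (is_filter_lim_locally_unique (V := R_NormedModule)); exact Hy). subst y.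
assert (He : 0 < e / 2) by (pose proof (cond_pos e); lra).
pose proof (proj2 H1 x (fun P HP => HP) (mkposreal _ He)) as K1.
pose proof (proj2 H2 x (fun P HP => HP) (mkposreal _ He)) as K2.
generalize (filter_and _ _ K1 K2). apply filter_imp. intros t [B1 B2].
rewrite Cmod_norm_CV. eapply Rle_trans; [apply Cmod_le_abs|].
simpl in B1, B2.
unfold norm, minus, plus, opp, scal in *; simpl in *. unfold abs, mult in *; simpl in *.
apply Rle_trans with (e / 2 * Rabs (t + - x) + e / 2 * Rabs (t + - x)); [|right; field].
exact (Rplus_le_compat _ _ _ _ B1 B2).
Qed.

Lemma Cder_real_curve (h : C -> C) (z l v : C) (x : R) : Cder h (z + x * v)%C l ->
  is_derive_RC (fun t : R => h (z + t * v)%C) x (l * v)%C.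
Proof.
intros H. split; [apply is_linear_scal_l|].
intros y Hy e.
assert (Ey : x = y) by (apply (is_filter_lim_locally_unique (V := R_NormedModule)); exact Hy). subst y.
(* The added 1 allows division by [A] even when the direction [v] is zero. *)
set (A := Cmod v + 1). assert (HA : 0 < A) by (unfold A; pose proof (Cmod_ge_0 v); lra).
destruct (H (e / A)) as [r [Hr H1]]; [apply Rdiv_lt_0_compat; [apply cond_pos|assumption]|].
assert (Hr' : 0 < r / A) by now apply Rdiv_lt_0_compat.
exists (mkposreal _ Hr'). intros t Ht.
unfold ball in Ht; simpl in Ht. unfold AbsRing_ball, abs, minus, plus, opp in Ht; simpl in Ht.
assert (E : (z + t * v - (z + x * v))%C = ((t - x : R) * v)%C) by (rewrite RtoC_minus; ring).
assert (E1 : Cmod (z + t * v - (z + x * v))%C <= Rabs (t - x) * A).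
{ rewrite E, Cmod_mult, Cmod_R. apply Rmult_le_compat_l; [apply Rabs_pos|unfold A; lra]. }
specialize (H1 (z + t * v)%C).
rewrite Cmod_norm_CV.
apply Rle_trans with (e / A * (Rabs (t - x) * A)).
- eapply Rle_trans; [|apply Rmult_le_compat_l; [|exact E1]].
  + match goal with |- Cmod ?u <= _ =>
      replace u with (h (z + t * v) - h (z + x * v) - l * (z + t * v - (z + x * v)))%C
    end.
    * apply H1. eapply Rle_lt_trans; [exact E1|].
      apply Rlt_le_trans with (r / A * A); [|right; field; lra].
      apply Rmult_lt_compat_r; assumption.
    * rewrite E. apply C_ext; simpl; unfold minus, plus, opp, scal; simpl; unfold mult; simpl; ring.
  + left; apply Rdiv_lt_0_compat; [apply cond_pos|assumption].
- right. unfold norm; simpl; unfold abs, minus, plus, opp; simpl. unfold Rminus. field. lra.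
Qed.

Lemma CInt_derive (f df : R -> C) (a b : R) : a <= b ->
  (forall x, a <= x <= b -> is_derive_RC f x (df x)) ->
  (forall x, a <= x <= b -> continuous_RC df x) ->
  CInt df a b = (f b - f a)%C.
Proof.
intros Hab H K. apply CInt_unique.
apply (is_RInt_derive (V := CV)); rewrite Rmin_left, Rmax_right by assumption; assumption.
Qed.

(** A curve in the plane has no intermediate point realising its mean slope, so the inequality comes
    from integrating the derivative. *)
Lemma mean_value_C (f df : R -> C) (a b M : R) : a <= b ->
  (forall x, a <= x <= b -> is_derive_RC f x (df x)) ->
  (forall x, a <= x <= b -> continuous_RC df x) ->
  (forall x, a <= x <= b -> Cmod (df x) <= M) -> Cmod (f b - f a)%C <= (b - a) * M.
Proof.
intros Hab H K B. rewrite <- (CInt_derive f df) by assumption.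
apply CInt_Cmod_le_const; try assumption. now apply CIntegrable_segment.
Qed.

(** * The complex exponential *)

Lemma Cexp_plus (z w : C) : Cexp (z + w)%C = (Cexp z * Cexp w)%C.
Proof.
apply C_ext; simpl; rewrite exp_plus, ?cos_plus, ?sin_plus; unfold Re, Im; ring.
Qed.

Lemma Cexp_0 : Cexp 0 = 1.
Proof. apply C_ext; simpl; rewrite exp_0, ?cos_0, ?sin_0; ring. Qed.

Lemma Cexp_RtoC (x : R) : Cexp x = exp x.
Proof. apply C_ext; simpl; rewrite ?cos_0, ?sin_0; ring. Qed.

Lemma Cmod_Cexp (z : C) : Cmod (Cexp z) = exp (Re z).
Proof.
unfold Cmod; simpl.
replace (_ + _) with (exp (Re z) * exp (Re z) * (Rsqr (sin (Im z)) + Rsqr (cos (Im z))))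
  by (unfold Rsqr; ring).
rewrite sin2_cos2, Rmult_1_r. apply sqrt_square. left; apply exp_pos.
Qed.

Lemma Cexp_neq_0 (z : C) : Cexp z <> 0.
Proof. apply Cmod_gt_0. rewrite Cmod_Cexp. apply exp_pos. Qed.

Lemma Cexp_opp (z : C) : Cexp (- z)%C = (/ Cexp z)%C.
Proof.
pose proof (Cexp_neq_0 z).
assert (E : (Cexp (- z) * Cexp z)%C = 1).
{ rewrite <- Cexp_plus. replace (- z + z)%C with (0 : C) by ring. apply Cexp_0. }
replace (Cexp (- z)) with (Cexp (- z) * Cexp z * / Cexp z)%C by (field; assumption).
rewrite E. ring.
Qed.

Lemma Cexp_minus (z w : C) : Cexp (z - w)%C = (Cexp z / Cexp w)%C.
Proof. unfold Cminus. now rewrite Cexp_plus, Cexp_opp. Qed.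

Lemma is_derive_Cexp_ray (h : C) (x : R) :
  is_derive_RC (fun t : R => Cexp (t * h)%C) x (h * Cexp (x * h))%C.
Proof.
destruct h as [a b].
apply is_derive_pair; unfold Cexp, Re, Im; simpl; auto_derive; try exact I; unfold Re, Im; simpl.
all: unfold Rminus; ring.
Qed.

Lemma ccont_Cexp_ray (h c : C) : ccont (fun t : R => c * Cexp (t * h))%C.
Proof.
intros x. apply continuous_Cmult; [apply continuous_const|].
apply continuous_Cexp, continuous_Cmult; [|apply continuous_const].
apply continuous_RtoC, continuous_id.
Qed.

Lemma Cexp_ray_le (h : C) (x : R) : 0 <= x <= 1 -> Cmod (Cexp (x * h)%C) <= exp (Cmod h).
Proof.
intros Hx. rewrite Cmod_Cexp.
assert (Re (x * h)%C <= Cmod h).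
{ pose proof (re_le_Cmod h). pose proof (Rle_abs (Re h)).
  replace (Re (x * h)%C) with (x * Re h) by (unfold Re; simpl; ring).
  apply Rle_trans with (x * Rabs (Re h)); [apply Rmult_le_compat_l; [lra|apply Rle_abs]|].
  apply Rle_trans with (1 * Rabs (Re h)); [apply Rmult_le_compat_r; [apply Rabs_pos|lra]|]. unfold Re in *; lra. }
destruct H; [left; now apply exp_increasing|right; now f_equal].
Qed.

Lemma Cexp_minus_1_le (h : C) : Cmod (Cexp h - 1)%C <= Cmod h * exp (Cmod h).
Proof.
pose proof (mean_value_C (fun t : R => Cexp (t * h)%C) (fun t : R => h * Cexp (t * h))%C 0 1
  (Cmod h * exp (Cmod h)) Rle_0_1) as H. cbv beta in H.
replace (1 * h)%C with h in H by ring. replace (0 * h)%C with (0 : C) in H by ring.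
rewrite Cexp_0 in H. replace ((1 - 0) * (Cmod h * exp (Cmod h))) with (Cmod h * exp (Cmod h)) in H by ring.
apply H; intros x Hx.
- apply is_derive_Cexp_ray.
- apply ccont_Cexp_ray.
- rewrite Cmod_mult. apply Rmult_le_compat_l; [apply Cmod_ge_0|]. now apply Cexp_ray_le.
Qed.

(** The derivative of e^(t h) - t h in t is h (e^(t h) - 1), to which the first-order estimate
    applies; the mean value inequality on [0, 1] then gains one power of |h|. *)
Lemma Cexp_order2_le (h : C) : Cmod (Cexp h - 1 - h)%C <= Cmod h ^ 2 * exp (Cmod h).
Proof.
pose proof (mean_value_C (fun t : R => Cexp (t * h) - t * h)%C (fun t : R => h * Cexp (t * h) - h)%C 0 1
  (Cmod h ^ 2 * exp (Cmod h)) Rle_0_1) as H. cbv beta in H.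
replace (Cexp (1 * h) - 1 * h - (Cexp (0 * h) - 0 * h))%C with (Cexp h - 1 - h)%C in H.
- replace ((1 - 0) * (Cmod h ^ 2 * exp (Cmod h))) with (Cmod h ^ 2 * exp (Cmod h)) in H by ring.
  apply H; intros x Hx.
  + apply (is_derive_minus (K := R_AbsRing) (V := C_R_NormedModule)); [apply is_derive_Cexp_ray|].
    apply is_derive_pair; unfold Re, Im; simpl; auto_derive; try exact I; unfold Re, Im; simpl; ring.
  + apply continuous_Cminus; [apply ccont_Cexp_ray|apply continuous_const].
  + replace (h * Cexp (x * h) - h)%C with (h * (Cexp (x * h) - 1))%C by ring.
    rewrite Cmod_mult. replace (Cmod h ^ 2 * exp (Cmod h)) with (Cmod h * (Cmod h * exp (Cmod h))) by ring.
    apply Rmult_le_compat_l; [apply Cmod_ge_0|].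
    eapply Rle_trans; [apply Cexp_minus_1_le|].
    assert (Hx1 : Cmod (x * h)%C <= Cmod h).
    { rewrite Cmod_mult, Cmod_R, Rabs_pos_eq by lra.
      replace (Cmod h) with (1 * Cmod h) at 2 by ring.
      apply Rmult_le_compat_r; [apply Cmod_ge_0|lra]. }
    apply Rmult_le_compat; try apply Cmod_ge_0; try assumption.
    * left; apply exp_pos.
    * destruct Hx1 as [Hx1|Hx1]; [left; now apply exp_increasing|right; now f_equal].
- replace (1 * h)%C with h by ring. replace (0 * h)%C with (0 : C) by ring. rewrite Cexp_0. ring.
Qed.

(** By the addition formula the remainder at [z] is [Cexp z] times the quadratic remainder at 0; the
    cap 1 on the radius bounds exp |h| by e. *)
Lemma Cder_Cexp (z : C) : Cder Cexp z (Cexp z).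
Proof.
intros e He.
set (A := Cmod (Cexp z) * exp 1 + 1).
assert (HA : 0 < A) by (unfold A; pose proof (Rmult_le_pos _ _ (Cmod_ge_0 (Cexp z)) (Rlt_le _ _ (exp_pos 1))); lra).
exists (Rmin 1 (e / A)). split; [apply Rmin_pos; [lra|now apply Rdiv_lt_0_compat]|].
intros w Hw. pose proof (Rmin_l 1 (e / A)); pose proof (Rmin_r 1 (e / A)).
replace (Cexp w) with (Cexp z * Cexp (w - z))%C by (rewrite <- Cexp_plus; f_equal; ring).
set (h := (w - z)%C) in *.
replace (Cexp z * Cexp h - Cexp z - Cexp z * h)%C with (Cexp z * (Cexp h - 1 - h))%C by ring.
rewrite Cmod_mult.
pose proof (Cmod_ge_0 h) as Hh.
apply Rle_trans with (Cmod (Cexp z) * (Cmod h ^ 2 * exp 1)).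
- apply Rmult_le_compat_l; [apply Cmod_ge_0|].
  eapply Rle_trans; [apply Cexp_order2_le|].
  apply Rmult_le_compat_l; [apply pow2_ge_0|]. left; apply exp_increasing; lra.
- replace (Cmod (Cexp z) * (Cmod h ^ 2 * exp 1)) with (Cmod (Cexp z) * exp 1 * Cmod h * Cmod h) by ring.
  apply Rmult_le_compat_r; [assumption|].
  apply Rle_trans with (A * (e / A)); [|right; field; lra].
  apply Rmult_le_compat; try lra.
  + apply Rmult_le_pos; [apply Cmod_ge_0|left; apply exp_pos].
  + unfold A; lra.
Qed.

Lemma Cdiff_Cexp (h : C -> C) (z : C) : Cdiff h z -> Cdiff (fun w => Cexp (h w)) z.
Proof. intros H; apply (Cdiff_comp h Cexp); [assumption|eexists; apply Cder_Cexp]. Qed.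

(** * Integrals over the whole line of exponentially decaying functions *)

(** The class of integrands for which [LI] is meaningful. The explicit [K] and [eta] make every tail
    estimate uniform in further parameters. *)
Definition expdec (f : R -> C) (K eta : R) : Prop :=
  ccont f /\ 0 < eta /\ forall w : R, Cmod (f w) <= K * exp (- eta * Rabs w).

Definition LI (f : R -> C) : C :=
  RInt_gen (V := CV) f (Rbar_locally m_infty) (Rbar_locally p_infty).

Lemma LI_ext (f g : R -> C) : (forall x, f x = g x) -> LI f = LI g.
Proof. intros H; f_equal; apply functional_extensionality, H. Qed.

Lemma exp_le (x y : R) : x <= y -> exp x <= exp y.
Proof. intros [H|H]; [left; now apply exp_increasing|right; now f_equal]. Qed.

Lemma exp_small (K eta e : R) : 0 < eta -> 0 < e ->
  exists W0 : R, 0 <= W0 /\ forall W, W0 <= W -> K * exp (- eta * W) <= e.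
Proof.
intros Heta He.
(* From exp x >= x one gets K exp(- eta W) <= |K| / (eta W), which is at most [e] from this value of
   W on. *)
exists (Rmax 0 (Rabs K / (eta * e))); split; [apply Rmax_l|].
intros W HW.
assert (HW0 : 0 <= W) by (eapply Rle_trans; [apply Rmax_l|exact HW]).
assert (HW1 : Rabs K / (eta * e) <= W) by (eapply Rle_trans; [apply Rmax_r|exact HW]).
assert (H1 : Rabs K <= W * (eta * e)).
{ apply Rle_trans with (Rabs K / (eta * e) * (eta * e)).
  - right; field; split; lra.
  - apply Rmult_le_compat_r; [left; now apply Rmult_lt_0_compat|exact HW1]. }
replace (- eta * W) with (- (eta * W)) by ring. rewrite exp_Ropp.
pose proof (exp_ineq1_le (eta * W)) as H2.
assert (H3 : 0 <= eta * W) by (apply Rmult_le_pos; lra).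
pose proof (exp_pos (eta * W)) as H4.
apply Rmult_le_reg_r with (exp (eta * W)); [exact H4|].
replace (K * / exp (eta * W) * exp (eta * W)) with K by (field; lra).
pose proof (Rle_abs K).
apply Rle_trans with (e * (eta * W)); [lra|].
apply Rmult_le_compat_l; lra.
Qed.

Lemma ex_RInt_cont (f : R -> R) (a b : R) : (forall x, continuous f x) -> ex_RInt f a b.
Proof. intros H. apply (ex_RInt_continuous (V := R_CompleteNormedModule)). intros; apply H. Qed.

Lemma RInt_exp (K m a b : R) : m <> 0 ->
  RInt (fun x => K * exp (m * x)) a b = K / m * (exp (m * b) - exp (m * a)).
Proof.
intros Hm. apply is_RInt_unique.
replace (K / m * (exp (m * b) - exp (m * a)))
  with (minus (K / m * exp (m * b)) (K / m * exp (m * a)))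
  by (unfold minus, plus, opp; simpl; ring).
apply (is_RInt_derive (V := R_CompleteNormedModule) (fun x => K / m * exp (m * x))).
- intros x _. auto_derive; [exact I|]. field; assumption.
- intros x _. apply continuous_Rmult; [apply continuous_const|].
  apply continuous_Rexp, continuous_Rmult; [apply continuous_const|apply continuous_id].
Qed.

Lemma ex_RInt_exp (K m a b : R) : ex_RInt (fun x => K * exp (m * x)) a b.
Proof.
apply ex_RInt_cont. intros x.
apply continuous_Rmult; [apply continuous_const|].
apply continuous_Rexp, continuous_Rmult; [apply continuous_const|apply continuous_id].
Qed.

Lemma expdec_K_pos (f : R -> C) (K eta : R) : expdec f K eta -> 0 <= K.
Proof.
intros (_ & _ & H). specialize (H 0). rewrite Rabs_R0, Rmult_0_r, exp_0, Rmult_1_r in H.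
eapply Rle_trans; [apply Cmod_ge_0|exact H].
Qed.

Lemma expdec_tail_r (f : R -> C) (K eta b b' : R) : expdec f K eta -> 0 <= b <= b' ->
  Cmod (CInt f b b') <= K / eta * exp (- eta * b).
Proof.
intros Hf Hb. pose proof (expdec_K_pos _ _ _ Hf) as HK. destruct Hf as (Hc & Heta & Hf).
eapply Rle_trans.
- apply (CInt_Cmod_le f (fun x => K * exp (- eta * x)) b b'); [lra|now apply ccont_integrable|apply ex_RInt_exp|].
  intros x Hx. specialize (Hf x). now rewrite Rabs_pos_eq in Hf by lra.
- rewrite RInt_exp by lra.
  replace (K / - eta * (exp (- eta * b') - exp (- eta * b)))
    with (K / eta * exp (- eta * b) - K / eta * exp (- eta * b')) by (field; lra).
  assert (0 <= K / eta * exp (- eta * b')); [|lra].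
  apply Rmult_le_pos; [apply Rdiv_le_0_compat; lra|left; apply exp_pos].
Qed.

Lemma expdec_tail_l (f : R -> C) (K eta a a' : R) : expdec f K eta -> a' <= a <= 0 ->
  Cmod (CInt f a' a) <= K / eta * exp (eta * a).
Proof.
intros Hf Ha. pose proof (expdec_K_pos _ _ _ Hf) as HK. destruct Hf as (Hc & Heta & Hf).
eapply Rle_trans.
- apply (CInt_Cmod_le f (fun x => K * exp (eta * x)) a' a); [lra|now apply ccont_integrable|apply ex_RInt_exp|].
  intros x Hx. specialize (Hf x). rewrite Rabs_left1 in Hf by lra.
  replace (- eta * - x) with (eta * x) in Hf by ring. exact Hf.
- rewrite RInt_exp by lra.
  assert (0 <= K / eta * exp (eta * a')); [|lra].
  apply Rmult_le_pos; [apply Rdiv_le_0_compat; lra|left; apply exp_pos].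
Qed.

Lemma expdec_segments (f : R -> C) (K eta a b a' b' : R) : expdec f K eta ->
  a' <= a <= 0 -> 0 <= b <= b' ->
  Cmod (CInt f a b - CInt f a' b')%C <= K / eta * (exp (eta * a) + exp (- eta * b)).
Proof.
intros Hf Ha Hb.
assert (Hc : ccont f) by apply Hf.
rewrite <- (CInt_Chasles f a' a b') by now apply ccont_integrable.
rewrite <- (CInt_Chasles f a b b') by now apply ccont_integrable.
replace (CInt f a b - (CInt f a' a + (CInt f a b + CInt f b b')))%C
  with (- (CInt f a' a + CInt f b b'))%C by ring.
rewrite Cmod_opp. eapply Rle_trans; [apply Cmod_triangle|].
pose proof (expdec_tail_l f K eta a a' Hf Ha). pose proof (expdec_tail_r f K eta b b' Hf Hb). lra.
Qed.

Lemma Rle_plus_epsilon (x y : R) : (forall e, 0 < e -> x <= y + e) -> x <= y.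
Proof.
intros H. destruct (Rle_or_lt x y) as [|Hlt]; [assumption|].
specialize (H ((x - y) / 2) ltac:(lra)). lra.
Qed.

(** Cauchy's criterion is applied to the symmetric segments [- W, W] only; the distance of any other
    segment to a large symmetric one is controlled by the tails, so both ends may move
    independently. *)
Lemma LI_exists (f : R -> C) (K eta : R) : expdec f K eta ->
  exists l : C, forall a b, a <= 0 -> 0 <= b ->
    Cmod (CInt f a b - l)%C <= K / eta * (exp (eta * a) + exp (- eta * b)).
Proof.
intros Hf. pose proof (expdec_K_pos _ _ _ Hf) as HK.
assert (Heta : 0 < eta) by apply Hf.
assert (Hq : 0 <= K / eta) by (apply Rdiv_le_0_compat; lra).
destruct (proj1 (filterlim_locally_cauchy (U := CV) (F := Rbar_locally p_infty)
  (fun W : R => CInt f (- W) W))) as [l Hl].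
{ intros e.
  destruct (exp_small (2 * (K / eta)) eta (e / 2) Heta) as [W0 [HW0 HW]].
  { pose proof (cond_pos e); lra. }
  exists (fun W => W0 < W); split; [exists W0; tauto|].
  assert (Hwlog : forall u v, W0 < u -> u <= v ->
    Cmod (CInt f (- u) u - CInt f (- v) v)%C <= e / 2).
  { intros u v Hu Hv.
    eapply Rle_trans; [apply (expdec_segments f K eta); [assumption|lra|lra]|].
    specialize (HW u ltac:(lra)).
    replace (eta * - u) with (- eta * u) by ring. lra. }
  intros u v Hu Hv.
  assert (Hb : Cmod (CInt f (- v) v - CInt f (- u) u)%C < e).
  { pose proof (cond_pos e).
    destruct (Rle_or_lt u v) as [Huv|Huv].
    - rewrite Cmod_minus_sym. specialize (Hwlog u v Hu Huv). lra.
    - specialize (Hwlog v u Hv ltac:(lra)). lra. }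
  apply Cmod_Re_Im_lt in Hb. exact Hb. }
exists l. intros a b Ha Hb. apply Rle_plus_epsilon. intros e He.
assert (He2 : 0 < e / 2) by lra.
pose proof (proj1 (filterlim_locally (U := C_UniformSpace) (fun W : R => CInt f (- W) W) l) Hl (mkposreal _ He2)) as [M HM].
(* Large enough for [- W, W] to contain [a, b] and for its integral to be close to the limit. *)
set (W := Rmax (M + 1) (Rmax (- a) b)).
pose proof (Rmax_l (M + 1) (Rmax (- a) b)); pose proof (Rmax_r (M + 1) (Rmax (- a) b)).
pose proof (Rmax_l (- a) b); pose proof (Rmax_r (- a) b). fold W in H, H0.
pose proof (C_ball_Cmod _ _ _ (HM W ltac:(lra))) as HB. simpl pos in HB.
replace (CInt f a b - l)%C with ((CInt f a b - CInt f (- W) W) + (CInt f (- W) W - l))%C by ring.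
eapply Rle_trans; [apply Cmod_triangle|].
apply Rplus_le_compat.
- apply expdec_segments; [assumption|lra|lra].
- lra.
Qed.

Lemma is_RInt_gen_expdec (f : R -> C) (K eta : R) (l : C) : expdec f K eta ->
  (forall a b, a <= 0 -> 0 <= b ->
    Cmod (CInt f a b - l)%C <= K / eta * (exp (eta * a) + exp (- eta * b))) ->
  is_RInt_gen (V := C_R_NormedModule) f (Rbar_locally m_infty) (Rbar_locally p_infty) l.
Proof.
intros Hf Hl. assert (Heta : 0 < eta) by apply Hf.
intros P [e HP].
destruct (exp_small (2 * (K / eta)) eta (e / 2) Heta) as [W0 [HW0 HW]].
{ pose proof (cond_pos e); lra. }
apply (Filter_prod _ _ _ (fun a => a < - W0) (fun b => W0 < b)).
- exists (- W0); tauto.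
- exists W0; tauto.
- intros a b Ha Hb. exists (CInt f a b); split.
  + simpl. apply CInt_correct, ccont_integrable, Hf.
  + apply HP. apply Cmod_Re_Im_lt. eapply Rle_lt_trans; [apply Hl; lra|].
    pose proof (HW (- a) ltac:(lra)). pose proof (HW b ltac:(lra)).
    replace (- eta * - a) with (eta * a) in * by ring.
    pose proof (cond_pos e). lra.
Qed.

Lemma LI_is_RInt_gen (f : R -> C) (K eta : R) : expdec f K eta ->
  is_RInt_gen (V := C_R_NormedModule) f (Rbar_locally m_infty) (Rbar_locally p_infty) (LI f).
Proof.
intros Hf. apply (RInt_gen_correct (V := CV)).
destruct (LI_exists f K eta Hf) as [l Hl]. exists l. now apply (is_RInt_gen_expdec f K eta).
Qed.

Lemma LI_spec (f : R -> C) (K eta a b : R) : expdec f K eta -> a <= 0 -> 0 <= b ->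
  Cmod (CInt f a b - LI f)%C <= K / eta * (exp (eta * a) + exp (- eta * b)).
Proof.
intros Hf Ha Hb. destruct (LI_exists f K eta Hf) as [l Hl].
replace (LI f) with l; [now apply Hl|].
symmetry. unfold LI. apply (is_RInt_gen_unique (V := CV) f l).
now apply (is_RInt_gen_expdec f K eta).
Qed.

(** This is the rate of convergence read off at the degenerate segment [0, 0], whose integral
    vanishes. *)
Lemma LI_Cmod_le (f : R -> C) (K eta : R) : expdec f K eta -> Cmod (LI f) <= 2 * K / eta.
Proof.
intros Hf. pose proof (LI_spec f K eta 0 0 Hf (Rle_refl _) (Rle_refl _)) as H.
replace (CInt f 0 0) with (0 : C) in H
  by (symmetry; apply (RInt_point (V := CV))).
replace (0 - LI f)%C with (- LI f)%C in H by ring.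
rewrite Cmod_opp, !Rmult_0_r, exp_0 in H. unfold Rdiv in *. lra.
Qed.

(** Convergence is already known, so symmetric segments are enough to identify the limit. *)
Lemma LI_unique (f : R -> C) (K eta : R) (l : C) : expdec f K eta ->
  (forall e, 0 < e -> exists W0, forall W, W0 <= W -> Cmod (CInt f (- W) W - l)%C <= e) ->
  LI f = l.
Proof.
intros Hf H. assert (Heta : 0 < eta) by apply Hf.
apply C_eq_of_dist_le. intros e He.
destruct (H (e / 2) ltac:(lra)) as [W1 HW1].
destruct (exp_small (2 * (K / eta)) eta (e / 2) Heta ltac:(lra)) as [W0 [HW0 HW]].
set (W := Rmax W0 W1). pose proof (Rmax_l W0 W1); pose proof (Rmax_r W0 W1). fold W in H0, H1.
specialize (HW W ltac:(lra)). specialize (HW1 W ltac:(lra)).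
pose proof (LI_spec f K eta (- W) W Hf ltac:(lra) ltac:(lra)) as HS.
replace (eta * - W) with (- eta * W) in HS by ring.
replace (LI f - l)%C with ((CInt f (- W) W - l) - (CInt f (- W) W - LI f))%C by ring.
unfold Cminus at 1. eapply Rle_trans; [apply Cmod_triangle|]. rewrite Cmod_opp. lra.
Qed.

Lemma LI_limit (f : R -> C) (K eta e : R) : expdec f K eta -> 0 < e ->
  exists W0, forall W, W0 <= W -> Cmod (CInt f (- W) W - LI f)%C <= e.
Proof.
intros Hf He. assert (Heta : 0 < eta) by apply Hf.
destruct (exp_small (2 * (K / eta)) eta e Heta He) as [W0 [HW0 HW]].
exists W0. intros W HW'. specialize (HW W HW').
pose proof (LI_spec f K eta (- W) W Hf ltac:(lra) ltac:(lra)) as HS.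
replace (eta * - W) with (- eta * W) in HS by ring. lra.
Qed.

Lemma expdec_weaken (f : R -> C) (K K' eta eta' : R) :
  expdec f K eta -> K <= K' -> 0 < eta' <= eta -> expdec f K' eta'.
Proof.
intros Hf HK Heta. pose proof (expdec_K_pos _ _ _ Hf). destruct Hf as (Hc & He & Hf).
repeat split; [assumption|lra|]. intros w. eapply Rle_trans; [apply Hf|].
apply Rmult_le_compat; try lra; [left; apply exp_pos|].
apply exp_le. pose proof (Rabs_pos w).
rewrite !Ropp_mult_distr_l_reverse. apply Ropp_le_contravar.
apply Rmult_le_compat_r; lra.
Qed.

Lemma expdec_mult_const (f : R -> C) (K eta : R) (c : C) :
  expdec f K eta -> expdec (fun w => c * f w)%C (Cmod c * K) eta.
Proof.
intros (Hc & He & Hf). repeat split; [|assumption|].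
- intros x. apply continuous_Cmult; [apply continuous_const|apply Hc].
- intros w. rewrite Cmod_mult, Rmult_assoc. apply Rmult_le_compat_l; [apply Cmod_ge_0|apply Hf].
Qed.

Lemma expdec_plus (f g : R -> C) (K L eta : R) :
  expdec f K eta -> expdec g L eta -> expdec (fun w => f w + g w)%C (K + L) eta.
Proof.
intros (Hc & He & Hf) (Gc & _ & Hg). repeat split; [|assumption|].
- intros x. now apply continuous_Cplus.
- intros w. eapply Rle_trans; [apply Cmod_triangle|]. specialize (Hf w); specialize (Hg w). lra.
Qed.

Lemma LI_mult (f : R -> C) (K eta : R) (c : C) : expdec f K eta ->
  LI (fun w => c * f w)%C = (c * LI f)%C.
Proof.
intros Hf. apply (LI_unique _ (Cmod c * K) eta); [now apply expdec_mult_const|].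
intros e He. pose proof (Cmod_ge_0 c) as Hc0.
destruct (LI_limit f K eta (e / (Cmod c + 1)) Hf) as [W0 HW0]; [apply Rdiv_lt_0_compat; lra|].
exists W0. intros W HW. specialize (HW0 W HW).
rewrite CInt_mult by (apply ccont_integrable, Hf).
replace (c * CInt f (- W) W - c * LI f)%C with (c * (CInt f (- W) W - LI f))%C by ring.
rewrite Cmod_mult. apply Rle_trans with ((Cmod c + 1) * (e / (Cmod c + 1))); [|right; field; lra].
apply Rmult_le_compat; try apply Cmod_ge_0; lra.
Qed.

Lemma LI_plus (f g : R -> C) (K L eta mu : R) : expdec f K eta -> expdec g L mu ->
  LI (fun w => f w + g w)%C = (LI f + LI g)%C.
Proof.
intros Hf Hg.
assert (Heta : 0 < eta) by apply Hf. assert (Hmu : 0 < mu) by apply Hg.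
assert (Hm : 0 < Rmin eta mu) by now apply Rmin_pos.
apply (LI_unique _ (K + L) (Rmin eta mu)).
{ apply expdec_plus.
  - apply (expdec_weaken f K K eta); [assumption|lra|split; [assumption|apply Rmin_l]].
  - apply (expdec_weaken g L L mu); [assumption|lra|split; [assumption|apply Rmin_r]]. }
intros e He.
destruct (LI_limit f K eta (e / 2) Hf) as [W0 HW0]; [lra|].
destruct (LI_limit g L mu (e / 2) Hg) as [W1 HW1]; [lra|].
exists (Rmax W0 W1). intros W HW.
pose proof (Rmax_l W0 W1); pose proof (Rmax_r W0 W1).
specialize (HW0 W ltac:(lra)). specialize (HW1 W ltac:(lra)).
rewrite CInt_plus by (apply ccont_integrable; first [apply Hf|apply Hg]).
replace (CInt f (- W) W + CInt g (- W) W - (LI f + LI g))%C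
  with ((CInt f (- W) W - LI f) + (CInt g (- W) W - LI g))%C by ring.
eapply Rle_trans; [apply Cmod_triangle|]. lra.
Qed.

Lemma LI_minus (f g : R -> C) (K L eta mu : R) : expdec f K eta -> expdec g L mu ->
  LI (fun w => f w - g w)%C = (LI f - LI g)%C.
Proof.
intros Hf Hg.
rewrite (LI_ext _ (fun w => f w + (-1 : C) * g w)%C) by (intros; ring).
rewrite (LI_plus f (fun w => (-1 : C) * g w)%C K (Cmod (-1) * L) eta mu Hf)
  by now apply expdec_mult_const.
rewrite (LI_mult g L mu _ Hg). ring.
Qed.

Lemma CInt_comp_lin (f : R -> C) (u v a b : R) : ccont f ->
  CInt f (u * a + v) (u * b + v) = (u * CInt (fun y => f (u * y + v)%R) a b)%C.
Proof.
intros Hf.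
pose proof (is_RInt_comp_lin (V := C_R_NormedModule) f u v a b _
  (CInt_correct f _ _ (ccont_integrable f (u * a + v) (u * b + v) Hf))) as H.
symmetry. rewrite <- CInt_mult.
- apply CInt_unique. revert H. apply is_RInt_ext. intros x _.
  apply C_ext; simpl; unfold scal; simpl; unfold mult; simpl; unfold Re, Im; ring.
- apply ccont_integrable. intros x.
  apply (continuous_comp (fun y => u * y + v) f); [|apply Hf].
  apply continuous_Rplus; [|apply continuous_const].
  apply continuous_Rmult; [apply continuous_const|apply continuous_id].
Qed.

Lemma expdec_translate (f : R -> C) (K eta v : R) : expdec f K eta ->
  expdec (fun w => f (w + v)) (K * exp (eta * Rabs v)) eta.
Proof.
intros Hf. assert (Heta : 0 < eta) by apply Hf. assert (Hc : ccont f) by apply Hf.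
pose proof (expdec_K_pos _ _ _ Hf) as HK.
repeat split; [|assumption|].
- intros x. apply (continuous_comp (fun w => w + v) f); [|apply Hc].
  apply continuous_Rplus; [apply continuous_id|apply continuous_const].
- intros w. eapply Rle_trans; [apply Hf|]. rewrite Rmult_assoc.
  apply Rmult_le_compat_l; [assumption|]. rewrite <- exp_plus. apply exp_le.
  replace w with ((w + v) + - v) at 2 by ring.
  pose proof (Rabs_triang (w + v) (- v)) as H. rewrite Rabs_Ropp in H.
  replace (eta * Rabs v + - eta * Rabs (w + v + - v)) with (eta * (Rabs v - Rabs (w + v + - v))) by ring.
  replace (- eta * Rabs (w + v)) with (eta * (- Rabs (w + v))) by ring.
  apply Rmult_le_compat_l; lra.
Qed.

Lemma LI_translate (f : R -> C) (K eta v : R) : expdec f K eta ->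
  LI (fun w => f (w + v)) = LI f.
Proof.
intros Hf. assert (Heta : 0 < eta) by apply Hf. assert (Hc : ccont f) by apply Hf.
pose proof (expdec_translate f K eta v Hf) as Hg.
apply (LI_unique _ _ _ _ Hg). intros e He.
destruct (exp_small (2 * (K / eta)) eta e Heta He) as [W0 [HW0 HW]].
exists (W0 + Rabs v). intros W HW'.
pose proof (CInt_comp_lin f 1 v (- W) W Hc) as E.
replace (1 * CInt (fun y => f (1 * y + v)%R) (- W) W)%C
  with (CInt (fun y => f (y + v)) (- W) W) in E.
2:{ replace (fun y => f (1 * y + v)) with (fun y => f (y + v)); [ring|].
    apply functional_extensionality; intros; f_equal; ring. }
rewrite <- E. pose proof (Rle_abs v); pose proof (Rle_abs (- v)) as Hv; rewrite Rabs_Ropp in Hv.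
eapply Rle_trans; [apply (LI_spec f K eta); [assumption|lra|lra]|].
pose proof (HW (- (1 * - W + v)) ltac:(lra)). pose proof (HW (1 * W + v) ltac:(lra)).
replace (- eta * - (1 * - W + v)) with (eta * (1 * - W + v)) in * by ring. lra.
Qed.

Lemma expdec_reflect (f : R -> C) (K eta : R) : expdec f K eta ->
  expdec (fun w => f (- w)) K eta.
Proof.
intros (Hc & He & Hf). repeat split; [|assumption|].
- intros x. apply (continuous_comp (fun w => - w) f); [|apply Hc].
  apply continuous_Ropp, continuous_id.
- intros w. specialize (Hf (- w)). now rewrite Rabs_Ropp in Hf.
Qed.

Lemma LI_reflect (f : R -> C) (K eta : R) : expdec f K eta ->
  LI (fun w => f (- w)) = LI f.
Proof.
intros Hf. assert (Hc : ccont f) by apply Hf.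
apply (LI_unique _ _ _ _ (expdec_reflect _ _ _ Hf)). intros e He.
destruct (LI_limit f K eta e Hf He) as [W0 HW0].
exists W0. intros W HW. specialize (HW0 W HW).
replace (CInt (fun w => f (- w)) (- W) W) with (CInt f (- W) W); [assumption|].
pose proof (CInt_comp_lin f (-1) 0 (- W) W Hc) as E.
replace (-1 * - W + 0) with W in E by ring. replace (-1 * W + 0) with (- W) in E by ring.
replace (fun y => f (-1 * y + 0)) with (fun y => f (- y)) in E.
2:{ apply functional_extensionality; intros; f_equal; ring. }
(* Reversing the segment changes the sign, which cancels the factor -1 of the substitution. *)
assert (S : (CInt f W (- W) + CInt f (- W) W)%C = 0).
{ rewrite CInt_Chasles by now apply ccont_integrable. apply (RInt_point (V := CV)). }
rewrite E in S.
replace (CInt f (- W) W) with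
  ((-1 : C) * CInt (fun y => f (- y)%R) (- W) W + CInt f (- W) W + CInt (fun y => f (- y)%R) (- W) W)%C.
- rewrite S; ring.
- rewrite RtoC_m1. ring.
Qed.

(** * Fubini's theorem *)

Definition ccont2 (u : R -> R -> C) : Prop := forall x y : R,
  continuous (T := prod_UniformSpace R_UniformSpace R_UniformSpace) (U := C_UniformSpace)
    (fun p => u (fst p) (snd p)) (x, y).

Lemma ccont2_slice_l (u : R -> R -> C) (x : R) : ccont2 u -> ccont (u x).
Proof.
intros H y. apply (continuous_comp_2 (V := R_UniformSpace) (W := R_UniformSpace) (fun _ : R => x) (fun t : R => t) u).
- apply continuous_const.
- apply continuous_id.
- apply H.
Qed.

Lemma ccont2_slice_r (u : R -> R -> C) (y : R) : ccont2 u -> ccont (fun x => u x y).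
Proof.
intros H x. apply (continuous_comp_2 (V := R_UniformSpace) (W := R_UniformSpace) (fun t : R => t) (fun _ : R => y) u).
- apply continuous_id.
- apply continuous_const.
- apply H.
Qed.

Lemma ccont2_swap (u : R -> R -> C) : ccont2 u -> ccont2 (fun x y => u y x).
Proof.
intros H x y.
apply (continuous_comp_2 (V := R_UniformSpace) (W := R_UniformSpace)
  (fun p : R * R => snd p) (fun p : R * R => fst p) u).
- apply continuous_snd.
- apply continuous_fst.
- apply H.
Qed.

Lemma ccont2_Re (u : R -> R -> C) (x y : R) : ccont2 u ->
  continuity_2d_pt (fun a b => Re (u a b)) x y.
Proof.
intros H. apply continuity_2d_pt_filterlim.
apply (continuous_Re (fun p : R * R => u (fst p) (snd p)) (x, y)), H.
Qed.

Lemma ccont2_Im (u : R -> R -> C) (x y : R) : ccont2 u ->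
  continuity_2d_pt (fun a b => Im (u a b)) x y.
Proof.
intros H. apply continuity_2d_pt_filterlim.
apply (continuous_Im (fun p : R * R => u (fst p) (snd p)) (x, y)), H.
Qed.

Lemma CInt_param_ccont (u : R -> R -> C) (c d : R) : c <= d -> ccont2 u ->
  ccont (fun x => CInt (u x) c d).
Proof.
intros Hcd Hu x0. apply continuous_CmodP. intros e He.
(* Real and imaginary parts contribute [e1] each over a length at most [d - c + 1], which leaves e /
   2; the added 1 covers [c = d]. *)
set (e1 := e / (4 * (d - c + 1))).
assert (He1 : 0 < e1) by (apply Rdiv_lt_0_compat; lra).
destruct (uniform_continuity_2d_1d' (fun a b => Re (u a b)) c d x0
  (fun x _ => ccont2_Re u x0 x Hu) (mkposreal _ He1)) as [r1 H1].
destruct (uniform_continuity_2d_1d' (fun a b => Im (u a b)) c d x0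
  (fun x _ => ccont2_Im u x0 x Hu) (mkposreal _ He1)) as [r2 H2].
assert (Hr : 0 < Rmin r1 r2) by (apply Rmin_pos; apply cond_pos).
exists (mkposreal _ Hr). intros x Hx.
unfold ball in Hx; simpl in Hx. unfold AbsRing_ball, abs, minus, plus, opp in Hx; simpl in Hx.
apply Rabs_def2 in Hx. pose proof (Rmin_l r1 r2); pose proof (Rmin_r r1 r2).
pose proof (cond_pos r1); pose proof (cond_pos r2).
rewrite <- CInt_minus by (apply ccont_integrable, ccont2_slice_l, Hu).
apply Rle_lt_trans with ((d - c) * (2 * e1)).
- apply CInt_Cmod_le_const; [assumption| |].
  + apply ccont_integrable. intros y. apply continuous_Cminus; apply ccont2_slice_l, Hu.
  + intros y Hy. eapply Rle_trans; [apply Cmod_le_abs|].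
    assert (Hyy : Rabs (y - y) < r1 /\ Rabs (y - y) < r2) by (rewrite Rminus_diag, Rabs_R0; lra).
    specialize (H1 y x0 y x Hy ltac:(lra) Hy ltac:(lra) ltac:(lra)).
    specialize (H2 y x0 y x Hy ltac:(lra) Hy ltac:(lra) ltac:(lra)).
    simpl in H1, H2. simpl. unfold Re, Im, Rminus in *. lra.
- apply Rle_lt_trans with ((d - c + 1) * (2 * e1)); [apply Rmult_le_compat_r; lra|].
  unfold e1. replace ((d - c + 1) * (2 * (e / (4 * (d - c + 1))))) with (e / 2) by (field; lra). lra.
Qed.

Lemma RInt_param_continuous (u : R -> R -> R) (c d : R) : c <= d ->
  (forall x y, continuity_2d_pt u x y) -> forall x, continuous (fun t => RInt (u t) c d) x.
Proof.
intros Hcd Hu x.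
assert (H : ccont2 (fun a b => RtoC (u a b))).
{ intros a b. apply (continuous_RtoC (fun p : R * R => u (fst p) (snd p))).
  apply continuity_2d_pt_filterlim, Hu. }
pose proof (continuous_Re _ x (CInt_param_ccont _ c d Hcd H x)) as K.
revert K. apply continuous_ext. intros t. rewrite CInt_components; [reflexivity|].
apply ccont_integrable. exact (ccont2_slice_l (fun a b => RtoC (u a b)) t H).
Qed.

Lemma continuity_2d_slice_r (u : R -> R -> R) (y : R) :
  (forall x y, continuity_2d_pt u x y) -> forall x, continuous (fun x => u x y) x.
Proof.
intros H x. apply (continuous_comp_2 (fun t : R => t) (fun _ : R => y) u).
- apply continuous_id.
- apply continuous_const.
- apply continuity_2d_pt_filterlim, H.
Qed.

Lemma is_derive_RInt_upper (f : R -> R) (a x : R) : (forall t, continuous f t) ->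
  is_derive (fun X => RInt f a X) x (f x).
Proof.
intros Hf. apply (is_derive_RInt (V := R_CompleteNormedModule) f (fun X => RInt f a X) a x); [|apply Hf].
apply filter_forall. intros X.
apply (RInt_correct (V := R_CompleteNormedModule)), ex_RInt_cont, Hf.
Qed.

(* Both sides vanish at [b = a] and have the same derivative in [b]. *)
Lemma RInt_Fubini (u : R -> R -> R) (a b c d : R) : a <= b -> c <= d ->
  (forall x y, continuity_2d_pt u x y) ->
  RInt (fun x => RInt (u x) c d) a b = RInt (fun y => RInt (fun x => u x y) a b) c d.
Proof.
intros Hab Hcd Hu.
assert (HD : forall X, is_derive
  (fun X => RInt (fun x => RInt (u x) c d) a X - RInt (fun y => RInt (fun x => u x y) a X) c d) X 0).
{ intros X. replace 0 with (minus (RInt (u X) c d) (RInt (u X) c d))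
    by (unfold minus, plus, opp; simpl; ring).
  apply (is_derive_minus (K := R_AbsRing) (V := R_NormedModule)).
  - apply (is_derive_RInt_upper (fun x => RInt (u x) c d)).
    now apply RInt_param_continuous.
  - assert (E : forall y z, Derive (fun X => RInt (fun x => u x y) a X) z = u z y).
    { intros y z. apply is_derive_unique.
      apply (is_derive_RInt_upper (fun x => u x y)). now apply continuity_2d_slice_r. }
    replace (RInt (u X) c d) with
      (RInt (fun t => Derive (fun X => RInt (fun x => u x t) a X) X) c d)
      by (f_equal; apply functional_extensionality; intros; apply E).
    apply (is_derive_RInt_param (fun X y => RInt (fun x => u x y) a X)).
    + apply filter_forall. intros z y _. exists (u z y).
      apply (is_derive_RInt_upper (fun x => u x y)). now apply continuity_2d_slice_r.
    + intros y _. apply (continuity_2d_pt_ext u); [intros; symmetry; apply E|apply Hu].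
    + apply filter_forall. intros z. apply ex_RInt_cont. intros y.
      (* The upper end ranges over a full neighbourhood, so the segment from [a] to [z] may be
         traversed backwards. *)
      destruct (Rle_or_lt a z) as [Haz|Haz].
      * apply (RInt_param_continuous (fun y x => u x y) a z Haz).
        intros p r. apply continuity_2d_pt_filterlim.
        apply (continuous_comp_2 (U := prod_UniformSpace R_UniformSpace R_UniformSpace)
          (fun p : R * R => snd p) (fun p : R * R => fst p) u (p, r)).
        -- apply continuous_snd.
        -- apply continuous_fst.
        -- apply continuity_2d_pt_filterlim, Hu.
      * apply (continuous_ext (fun y => - RInt (fun x => u x y) z a)).
        { intros t. apply (opp_RInt_swap (V := R_CompleteNormedModule)).
          apply ex_RInt_cont. now apply continuity_2d_slice_r. }
        apply continuous_Ropp.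
        apply (RInt_param_continuous (fun y x => u x y) z a); [lra|].
        intros p r. apply continuity_2d_pt_filterlim.
        apply (continuous_comp_2 (U := prod_UniformSpace R_UniformSpace R_UniformSpace)
          (fun p : R * R => snd p) (fun p : R * R => fst p) u (p, r)).
        -- apply continuous_snd.
        -- apply continuous_fst.
        -- apply continuity_2d_pt_filterlim, Hu. }
destruct (MVT_gen (fun X => RInt (fun x => RInt (u x) c d) a X
  - RInt (fun y => RInt (fun x => u x y) a X) c d) a b (fun _ => 0)) as [z [_ Hz]].
{ intros; apply HD. }
{ intros x _. apply continuity_pt_filterlim.
  exact (ex_derive_continuous_R _ x (ex_intro _ 0 (HD x))). }
rewrite Rmult_0_l in Hz.
rewrite (RInt_point (V := R_CompleteNormedModule) a) in Hz.
replace (RInt (fun y => RInt (fun x => u x y) a a) c d) with 0 in Hz.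
- unfold zero in Hz; simpl in Hz. lra.
- rewrite (RInt_ext _ (fun _ => 0)) by (intros; apply (RInt_point (V := R_CompleteNormedModule))).
  rewrite RInt_const. unfold scal; simpl; unfold mult; simpl. ring.
Qed.

Lemma CInt_Fubini (u : R -> R -> C) (a b c d : R) : a <= b -> c <= d -> ccont2 u ->
  CInt (fun x => CInt (u x) c d) a b = CInt (fun y => CInt (fun x => u x y) a b) c d.
Proof.
intros Hab Hcd Hu. pose proof (ccont2_swap u Hu) as Hu'.
rewrite (CInt_components (fun x => CInt (u x) c d))
  by (apply ccont_integrable, CInt_param_ccont; assumption).
rewrite (CInt_components (fun y => CInt (fun x => u x y) a b))
  by (apply ccont_integrable, (CInt_param_ccont (fun y x => u x y)); assumption).
f_equal.
- replace (fun x => Re (CInt (u x) c d)) with (fun x => RInt (fun y => Re (u x y)) c d).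
  2:{ apply functional_extensionality; intros x. rewrite CInt_components; [reflexivity|].
      apply ccont_integrable. exact (ccont2_slice_l u x Hu). }
  replace (fun y => Re (CInt (fun x => u x y) a b)) with (fun y => RInt (fun x => Re (u x y)) a b).
  2:{ apply functional_extensionality; intros y. rewrite CInt_components; [reflexivity|].
      apply ccont_integrable. exact (ccont2_slice_r u y Hu). }
  apply (RInt_Fubini (fun x y => Re (u x y))); try assumption.
  intros; now apply ccont2_Re.
- replace (fun x => Im (CInt (u x) c d)) with (fun x => RInt (fun y => Im (u x y)) c d).
  2:{ apply functional_extensionality; intros x. rewrite CInt_components; [reflexivity|].
      apply ccont_integrable. exact (ccont2_slice_l u x Hu). }
  replace (fun y => Im (CInt (fun x => u x y) a b)) with (fun y => RInt (fun x => Im (u x y)) a b).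
  2:{ apply functional_extensionality; intros y. rewrite CInt_components; [reflexivity|].
      apply ccont_integrable. exact (ccont2_slice_r u y Hu). }
  apply (RInt_Fubini (fun x y => Im (u x y))); try assumption.
  intros; now apply ccont2_Im.
Qed.

(** Decay as a product makes each slice, and the integral over each slice, an [expdec] function of
    the other variable. *)
Definition expdec2 (u : R -> R -> C) (K eta : R) : Prop :=
  ccont2 u /\ 0 < eta /\
  forall x y : R, Cmod (u x y) <= K * exp (- eta * Rabs x) * exp (- eta * Rabs y).

Lemma expdec2_slice (u : R -> R -> C) (K eta x : R) : expdec2 u K eta ->
  expdec (u x) (K * exp (- eta * Rabs x)) eta.
Proof.
intros (Hc & He & Hu). repeat split; [now apply ccont2_slice_l|assumption|apply Hu].
Qed.

Lemma expdec2_swap (u : R -> R -> C) (K eta : R) : expdec2 u K eta ->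
  expdec2 (fun x y => u y x) K eta.
Proof.
intros (Hc & He & Hu). repeat split; [now apply ccont2_swap|assumption|].
intros x y. eapply Rle_trans; [apply Hu|]. right; ring.
Qed.

Lemma expdec2_K_pos (u : R -> R -> C) (K eta : R) : expdec2 u K eta -> 0 <= K.
Proof.
intros Hu. pose proof (expdec_K_pos _ _ _ (expdec2_slice u K eta 0 Hu)) as H.
now rewrite Rabs_R0, Rmult_0_r, exp_0, Rmult_1_r in H.
Qed.

(** Continuity holds because the integrals over [- W, W] are continuous in [x] and their tails are
    small uniformly in [x]. *)
Lemma expdec2_LI (u : R -> R -> C) (K eta : R) : expdec2 u K eta ->
  expdec (fun x => LI (u x)) (2 * K / eta) eta.
Proof.
intros Hu. pose proof (expdec2_K_pos _ _ _ Hu) as HK. assert (He : 0 < eta) by apply Hu.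
repeat split; [|assumption|].
- intros x0. apply continuous_CmodP. intros e He'.
  destruct (exp_small (2 * (K / eta)) eta (e / 4) He ltac:(lra)) as [W [HW0 HW]].
  specialize (HW W (Rle_refl _)).
  assert (HT : forall x, Cmod (CInt (u x) (- W) W - LI (u x))%C <= e / 4).
  { intros x. pose proof (LI_spec _ _ _ (- W) W (expdec2_slice u K eta x Hu) ltac:(lra) ltac:(lra)) as H.
    eapply Rle_trans; [exact H|]. eapply Rle_trans; [|exact HW].
    replace (eta * - W) with (- eta * W) by ring.
    replace (2 * (K / eta) * exp (- eta * W)) with (K * 1 / eta * (exp (- eta * W) + exp (- eta * W))) by (field; lra).
    apply Rmult_le_compat_r; [pose proof (exp_pos (- eta * W)); lra|].
    apply Rmult_le_compat_r; [left; now apply Rinv_0_lt_compat|].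
    apply Rmult_le_compat_l; [assumption|].
    rewrite <- exp_0. apply exp_le. pose proof (Rmult_le_pos _ _ (Rlt_le _ _ He) (Rabs_pos x)). lra. }
  assert (HWW : - W <= W) by lra.
  pose proof (proj1 (continuous_CmodP _ x0) (CInt_param_ccont u (- W) W HWW (proj1 Hu) x0) (e / 4) ltac:(lra)) as H.
  revert H. apply filter_imp. intros x Hx.
  replace (LI (u x) - LI (u x0))%C with
    (- (CInt (u x) (- W) W - LI (u x)) + ((CInt (u x) (- W) W - CInt (u x0) (- W) W)
     + (CInt (u x0) (- W) W - LI (u x0))))%C by ring.
  eapply Rle_lt_trans; [apply Cmod_triangle|].
  eapply Rle_lt_trans; [apply Rplus_le_compat_l, Cmod_triangle|].
  rewrite Cmod_opp. pose proof (HT x); pose proof (HT x0). lra.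
- intros x. eapply Rle_trans; [apply (LI_Cmod_le _ _ _ (expdec2_slice u K eta x Hu))|].
  right; field; lra.
Qed.

(** Both iterated integrals are limits of the integral over the square [- W, W]^2, where the order
    is immaterial; [Main] is applied to [u] and to its transpose. *)
Lemma LI_Fubini (u : R -> R -> C) (K eta : R) : expdec2 u K eta ->
  LI (fun x => LI (u x)) = LI (fun y => LI (fun x => u x y)).
Proof.
intros Hu. pose proof (expdec2_K_pos _ _ _ Hu) as HK. assert (He : 0 < eta) by apply Hu.
assert (Main : forall v, expdec2 v K eta -> forall e, 0 < e ->
  exists W0, 0 <= W0 /\ forall W, W0 <= W ->
    Cmod (CInt (fun x => CInt (v x) (- W) W) (- W) W - LI (fun x => LI (v x)))%C <= e).
{ intros v Hv e He'.
  destruct (LI_limit _ _ _ (e / 2) (expdec2_LI v K eta Hv) ltac:(lra)) as [W1 HW1].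
  destruct (exp_small (2 * (K / eta) * (2 / eta)) eta (e / 2) He ltac:(lra)) as [W2 [HW2 HW2']].
  exists (Rmax W1 W2). split; [eapply Rle_trans; [exact HW2|apply Rmax_r]|].
  intros W HW. pose proof (Rmax_l W1 W2); pose proof (Rmax_r W1 W2).
  specialize (HW1 W ltac:(lra)). specialize (HW2' W ltac:(lra)).
  assert (HWW : - W <= W) by lra.
  pose proof (CInt_param_ccont v (- W) W HWW (proj1 Hv)) as C1.
  assert (C2 : ccont (fun x => LI (v x))) by apply (expdec2_LI v K eta Hv).
  replace (CInt (fun x => CInt (v x) (- W) W) (- W) W - LI (fun x => LI (v x)))%C
    with ((CInt (fun x => CInt (v x) (- W) W) (- W) W - CInt (fun x => LI (v x)) (- W) W)
      + (CInt (fun x => LI (v x)) (- W) W - LI (fun x => LI (v x))))%C by ring.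
  eapply Rle_trans; [apply Cmod_triangle|].
  rewrite <- CInt_minus by (apply ccont_integrable; assumption).
  assert (Hd : expdec (fun x => CInt (v x) (- W) W - LI (v x))%C (2 * (K / eta) * exp (- eta * W)) eta).
  { repeat split; [|assumption|].
    - intros x. apply continuous_Cminus; [apply C1|apply C2].
    - intros x. eapply Rle_trans; [apply (LI_spec _ _ _ (- W) W (expdec2_slice v K eta x Hv)); lra|].
      replace (eta * - W) with (- eta * W) by ring. right; field; lra. }
  pose proof (expdec_K_pos _ _ _ Hd) as HKd.
  assert (B : Cmod (CInt (fun x => CInt (v x) (- W) W - LI (v x))%C (- W) W) <= e / 2).
  { rewrite <- (CInt_Chasles _ (- W) 0 W) by (apply ccont_integrable, Hd).
    eapply Rle_trans; [apply Cmod_triangle|].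
    pose proof (expdec_tail_l _ _ _ 0 (- W) Hd ltac:(lra)) as T1.
    pose proof (expdec_tail_r _ _ _ 0 W Hd ltac:(lra)) as T2.
    rewrite Rmult_0_r, exp_0, Rmult_1_r in T1, T2.
    replace (2 * (K / eta) * (2 / eta) * exp (- eta * W)) with
      (2 * (K / eta) * exp (- eta * W) / eta + 2 * (K / eta) * exp (- eta * W) / eta) in HW2' by (field; lra).
    lra. }
  lra. }
apply C_eq_of_dist_le. intros e He'.
destruct (Main u Hu (e / 2) ltac:(lra)) as [W1 [HW1 H1]].
destruct (Main (fun y x => u x y) (expdec2_swap u K eta Hu) (e / 2) ltac:(lra)) as [W2 [HW2 H2]].
set (W := Rmax W1 W2). pose proof (Rmax_l W1 W2) as B1; pose proof (Rmax_r W1 W2) as B2.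
fold W in B1, B2. specialize (H1 W B1). specialize (H2 W B2).
rewrite (CInt_Fubini u) in H1 by (try lra; apply Hu).
set (M := CInt (fun y => CInt (fun x => u x y) (- W) W) (- W) W) in *.
replace (LI (fun x => LI (u x)) - LI (fun y => LI (fun x => u x y)))%C with
  (- (M - LI (fun x => LI (u x))) + (M - LI (fun y => LI (fun x => u x y))))%C by ring.
eapply Rle_trans; [apply Cmod_triangle|]. rewrite Cmod_opp. lra.
Qed.

(** * Differentiation of exponential integrals *)

(** Absorbs a factor of linear growth at the cost of an arbitrarily small part of the decay rate. *)
Lemma one_plus_le_exp (mu : R) : 0 < mu ->
  exists M, 0 < M /\ forall t, 0 <= t -> 1 + t <= M * exp (mu * t).
Proof.
intros Hmu. exists (1 + / mu). assert (0 < / mu) by now apply Rinv_0_lt_compat.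
split; [lra|]. intros t Ht.
assert (0 <= mu * t) by (apply Rmult_le_pos; lra).
pose proof (exp_ineq1_le (mu * t)).
replace (1 + t) with (1 + / mu * (mu * t)) by (field; lra).
assert (/ mu * (mu * t) <= / mu * exp (mu * t)) by (apply Rmult_le_compat_l; lra).
lra.
Qed.

(** Differentiation under the integral sign. The remainder has the integrand a e^(l z) (e^(l h) - 1
    - l h), where the last factor is at most |l h|^2 e^(|l h|). Linear growth of [l] costs three
    eighths of the rate [eta], so that rate [eta / 2] survives. *)
Lemma Cder_LI_exp (a l : R -> C) (L K eta : R) (z : C) :
  ccont a -> ccont l -> 0 < L -> (forall w, Cmod (l w) <= L * (1 + Rabs w)) ->
  expdec (fun w => a w * Cexp (l w * z))%C K eta ->
  Cder (fun z => LI (fun w => a w * Cexp (l w * z))%C) z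
    (LI (fun w => l w * (a w * Cexp (l w * z)))%C) /\
  exists K', expdec (fun w => l w * (a w * Cexp (l w * z)))%C K' (eta / 2).
Proof.
intros Ha Hl HL Hlb Hf. pose proof (expdec_K_pos _ _ _ Hf) as HK.
assert (He : 0 < eta) by apply Hf. pose proof (proj2 (proj2 Hf)) as Hfb.
destruct (one_plus_le_exp (eta / 8) ltac:(lra)) as [M [HM HMb]].
assert (Hd : expdec (fun w => l w * (a w * Cexp (l w * z)))%C (L * M * K) (eta / 2)).
{ repeat split; [|lra|].
  - intros w. apply continuous_Cmult; [apply Hl|apply Hf].
  - intros w. rewrite Cmod_mult. pose proof (Rabs_pos w) as Hw.
    apply Rle_trans with ((L * (M * exp (eta / 8 * Rabs w))) * (K * exp (- eta * Rabs w))).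
    + apply Rmult_le_compat; try apply Cmod_ge_0; [|apply Hfb].
      eapply Rle_trans; [apply Hlb|]. apply Rmult_le_compat_l; [lra|]. apply HMb, Hw.
    + replace (L * (M * exp (eta / 8 * Rabs w)) * (K * exp (- eta * Rabs w))) with
        (L * M * K * exp (eta / 8 * Rabs w + - eta * Rabs w)) by (rewrite exp_plus; ring).
      apply Rmult_le_compat_l; [repeat apply Rmult_le_pos; lra|]. apply exp_le.
      assert (0 <= eta * Rabs w) by (apply Rmult_le_pos; lra). lra. }
split; [|eexists; exact Hd].
intros e He'.
set (K2 := K * (L * M) ^ 2 * exp (eta / 8)).
assert (HK2 : 0 <= K2) by (unfold K2; apply Rmult_le_pos;
  [apply Rmult_le_pos; [lra|apply pow2_ge_0]|left; apply exp_pos]).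
(* The first entry gives |l(w) h| <= eta / 8 (1 + |w|); the second turns the quadratic bound (4 K2 /
   eta) |h|^2 into e |h|. *)
set (r := Rmin (eta / (8 * L)) (e / (4 * K2 / eta + 1))).
assert (Hq : 0 < 4 * K2 / eta + 1).
{ assert (0 <= 4 * K2 / eta) by (apply Rdiv_le_0_compat; lra). lra. }
exists r. split.
{ apply Rmin_pos; apply Rdiv_lt_0_compat; try assumption; try lra. }
intros z' Hz'. set (h := (z' - z)%C) in *.
pose proof (Rmin_l (eta / (8 * L)) (e / (4 * K2 / eta + 1))) as R1.
pose proof (Rmin_r (eta / (8 * L)) (e / (4 * K2 / eta + 1))) as R2. fold r in R1, R2.
pose proof (Cmod_ge_0 h) as Hh0.
assert (HlhL : forall w, Cmod (l w * h)%C <= eta / 8 + eta / 8 * Rabs w).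
{ intros w. rewrite Cmod_mult. pose proof (Rabs_pos w).
  apply Rle_trans with (L * (1 + Rabs w) * (eta / (8 * L))).
  - apply Rmult_le_compat; try apply Cmod_ge_0; [apply Hlb|lra].
  - right; field; lra. }
assert (Eq : forall w, (a w * Cexp (l w * z'))%C = (a w * Cexp (l w * z) * Cexp (l w * h))%C).
{ intros w. rewrite <- Cmult_assoc, <- Cexp_plus. unfold h. f_equal. f_equal. ring. }
assert (Hf' : expdec (fun w => a w * Cexp (l w * z'))%C (K * exp (eta / 8)) (eta / 2)).
{ repeat split; [|lra|].
  - intros w. apply continuous_Cmult; [apply Ha|]. apply continuous_Cexp, continuous_Cmult; [apply Hl|apply continuous_const].
  - intros w. rewrite Eq, Cmod_mult, Cmod_Cexp. pose proof (Rabs_pos w) as Hw.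
    apply Rle_trans with (K * exp (- eta * Rabs w) * exp (eta / 8 + eta / 8 * Rabs w)).
    + apply Rmult_le_compat; [apply Cmod_ge_0|left; apply exp_pos|apply Hfb|].
      apply exp_le. eapply Rle_trans; [apply Rle_abs|].
      eapply Rle_trans; [apply re_le_Cmod|apply HlhL].
    + rewrite exp_plus.
      replace (K * exp (- eta * Rabs w) * (exp (eta / 8) * exp (eta / 8 * Rabs w))) with
        (K * exp (eta / 8) * (exp (- eta * Rabs w) * exp (eta / 8 * Rabs w))) by ring.
      rewrite <- exp_plus.
      apply Rmult_le_compat_l; [apply Rmult_le_pos; [lra|left; apply exp_pos]|].
      apply exp_le. assert (0 <= eta * Rabs w) by (apply Rmult_le_pos; lra). lra. }
assert (Hrem : expdec (fun w => (a w * Cexp (l w * z)) * (Cexp (l w * h) - 1 - l w * h))%C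
  (K2 * Cmod h ^ 2) (eta / 2)).
{ repeat split; [|lra|].
  - intros w. apply continuous_Cmult; [apply Hf|].
    assert (continuous_RC (fun w => l w * h)%C w)
      by (apply continuous_Cmult; [apply Hl|apply continuous_const]).
    apply continuous_Cminus; [|assumption].
    apply continuous_Cminus; [now apply continuous_Cexp|apply continuous_const].
  - intros w. rewrite Cmod_mult. pose proof (Rabs_pos w) as Hw.
    assert (B1 : Cmod (l w * h)%C <= L * (M * exp (eta / 8 * Rabs w)) * Cmod h).
    { rewrite Cmod_mult. apply Rmult_le_compat_r; [assumption|].
      eapply Rle_trans; [apply Hlb|]. apply Rmult_le_compat_l; [lra|]. apply HMb, Hw. }
    apply Rle_trans with (K * exp (- eta * Rabs w) *
      ((L * (M * exp (eta / 8 * Rabs w)) * Cmod h) ^ 2 * exp (eta / 8 + eta / 8 * Rabs w))).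
    + apply Rmult_le_compat; try apply Cmod_ge_0; [apply Hfb|].
      eapply Rle_trans; [apply Cexp_order2_le|].
      apply Rmult_le_compat; [apply pow2_ge_0|left; apply exp_pos| |apply exp_le, HlhL].
      apply pow_incr. split; [apply Cmod_ge_0|assumption].
    + rewrite exp_plus.
      replace (K * exp (- eta * Rabs w) * ((L * (M * exp (eta / 8 * Rabs w)) * Cmod h) ^ 2
        * (exp (eta / 8) * exp (eta / 8 * Rabs w)))) with
        (K2 * Cmod h ^ 2 * (exp (- eta * Rabs w) * exp (eta / 8 * Rabs w) * exp (eta / 8 * Rabs w)
          * exp (eta / 8 * Rabs w))) by (unfold K2; ring).
      rewrite <- !exp_plus.
      apply Rmult_le_compat_l; [apply Rmult_le_pos; [assumption|apply pow2_ge_0]|].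
      apply exp_le. assert (0 <= eta * Rabs w) by (apply Rmult_le_pos; lra). lra. }
replace (LI (fun w => a w * Cexp (l w * z'))%C - LI (fun w => a w * Cexp (l w * z))%C
  - LI (fun w => l w * (a w * Cexp (l w * z)))%C * h)%C with
  (LI (fun w => (a w * Cexp (l w * z)) * (Cexp (l w * h) - 1 - l w * h))%C).
- eapply Rle_trans; [apply (LI_Cmod_le _ _ _ Hrem)|].
  replace (2 * (K2 * Cmod h ^ 2) / (eta / 2)) with ((4 * K2 / eta * Cmod h) * Cmod h) by (field; lra).
  apply Rmult_le_compat_r; [assumption|].
  apply Rle_trans with ((4 * K2 / eta + 1) * (e / (4 * K2 / eta + 1))).
  + apply Rmult_le_compat; try lra. apply Rdiv_le_0_compat; lra.
  + right. field. split; lra.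
- rewrite (Cmult_comm (LI (fun w => l w * (a w * Cexp (l w * z)))%C) h).
  rewrite <- (LI_mult _ _ _ h Hd).
  rewrite <- (LI_minus _ _ _ _ _ _ Hf' Hf).
  rewrite <- (LI_minus _ _ (K * exp (eta / 8) + Cmod (-1) * K) (Cmod h * (L * M * K)) (eta / 2) (eta / 2)).
  + apply LI_ext. intros w. rewrite Eq. ring.
  + assert (E2 : (fun w => a w * Cexp (l w * z') - a w * Cexp (l w * z))%C =
      (fun w => a w * Cexp (l w * z') + (-1 : C) * (a w * Cexp (l w * z)))%C).
    { apply functional_extensionality; intros w. rewrite RtoC_m1. ring. }
    rewrite E2. apply expdec_plus; [assumption|]. apply expdec_mult_const.
    apply (expdec_weaken _ K K eta); [assumption|lra|lra].
  + apply expdec_mult_const, Hd.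
Qed.

(** * Cauchy's theorem for rectangles *)

(** Written as a sum rather than a pair so that it is literally the point used in
    [is_vertical_int]. *)
Definition pt (x y : R) : C := (RtoC x + Ci * RtoC y)%C.

Definition Ccts (f : C -> C) (z : C) : Prop :=
  forall e : R, 0 < e -> exists r : R, 0 < r /\
    forall w, Cmod (w - z)%C < r -> Cmod (f w - f z)%C < e.

Lemma Cdiff_Ccts (f : C -> C) (z : C) : Cdiff f z -> Ccts f z.
Proof. intros [l H]. exact (Cder_continuous f z l H). Qed.

Lemma Ccts_comp_continuous {T : UniformSpace} (h : C -> C) (f : T -> C) (x : T) :
  continuous_C f x -> Ccts h (f x) ->
  continuous_C (fun t => h (f t)) x.
Proof.
intros Hf Hl. apply continuous_CmodP. intros e He.
destruct (Hl e He) as [r [Hr H]].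
generalize (proj1 (continuous_CmodP f x) Hf r Hr). apply filter_imp.
intros y; apply H.
Qed.

Lemma Re_pt (x y : R) : Re (pt x y) = x.
Proof. unfold pt, Re, Im; simpl; ring. Qed.

Lemma Im_pt (x y : R) : Im (pt x y) = y.
Proof. unfold pt, Re, Im; simpl; ring. Qed.

Lemma pt_Re_Im (z : C) : pt (Re z) (Im z) = z.
Proof. apply C_ext; [apply Re_pt|apply Im_pt]. Qed.

Lemma continuous_pt {T : UniformSpace} (u v : T -> R) (t : T) :
  continuous u t -> continuous v t ->
  continuous_C (fun s => pt (u s) (v s)) t.
Proof.
intros Hu Hv. apply continuous_Cplus; [now apply continuous_RtoC|].
apply continuous_Cmult; [apply continuous_const|now apply continuous_RtoC].
Qed.

Lemma Ccts_pt_h (f : C -> C) (x y : R) : Ccts f (pt x y) ->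
  continuous_RC (fun x => f (pt x y)) x.
Proof.
intros H. apply (Ccts_comp_continuous f (fun x => pt x y)); [|exact H].
apply continuous_pt; [apply continuous_id|apply continuous_const].
Qed.

Lemma Ccts_pt_v (f : C -> C) (x y : R) : Ccts f (pt x y) ->
  continuous_RC (fun y => f (pt x y)) y.
Proof.
intros H. apply (Ccts_comp_continuous f (fun y => pt x y)); [|exact H].
apply continuous_pt; [apply continuous_const|apply continuous_id].
Qed.

(* The integral of [f] along the boundary of the rectangle [a, b] x [c, d],
   counterclockwise. *)
Definition RC (f : C -> C) (a b c d : R) : C :=
  (CInt (fun x => f (pt x c)) a b - CInt (fun x => f (pt x d)) a b
   + Ci * (CInt (fun y => f (pt b y)) c d - CInt (fun y => f (pt a y)) c d))%C.

(** Boundary integrals need continuity on the sides only, since the integrand may have a pole inside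
    the rectangle. *)
Definition hcts (f : C -> C) (a b y : R) : Prop :=
  forall x, a <= x <= b -> Ccts f (pt x y).

Definition vcts (f : C -> C) (x c d : R) : Prop :=
  forall y, c <= y <= d -> Ccts f (pt x y).

Definition bcts (f : C -> C) (a b c d : R) : Prop :=
  hcts f a b c /\ hcts f a b d /\ vcts f a c d /\ vcts f b c d.

Lemma hcts_int (f : C -> C) (a b y : R) : a <= b -> hcts f a b y ->
  CIntegrable (fun x => f (pt x y)) a b.
Proof. intros Hab H. apply CIntegrable_segment; [assumption|]. intros x Hx. now apply Ccts_pt_h, H. Qed.

Lemma vcts_int (f : C -> C) (x c d : R) : c <= d -> vcts f x c d ->
  CIntegrable (fun y => f (pt x y)) c d.
Proof. intros Hab H. apply CIntegrable_segment; [assumption|]. intros y Hy. now apply Ccts_pt_v, H. Qed.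

Lemma RC_split_v (f : C -> C) (a m b c d : R) : a <= m <= b ->
  hcts f a b c -> hcts f a b d -> RC f a b c d = (RC f a m c d + RC f m b c d)%C.
Proof.
intros Hm Hc Hd. unfold RC.
assert (S : forall y, hcts f a b y ->
  CInt (fun x => f (pt x y)) a b = (CInt (fun x => f (pt x y)) a m + CInt (fun x => f (pt x y)) m b)%C).
{ intros y Hy. symmetry. apply CInt_Chasles; apply hcts_int; try lra; intros x Hx; apply Hy; lra. }
rewrite (S c Hc), (S d Hd). ring.
Qed.

Lemma RC_split_h (f : C -> C) (a b c m d : R) : c <= m <= d ->
  vcts f a c d -> vcts f b c d -> RC f a b c d = (RC f a b c m + RC f a b m d)%C.
Proof.
intros Hm Ha Hb. unfold RC.
assert (S : forall x, vcts f x c d ->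
  CInt (fun y => f (pt x y)) c d = (CInt (fun y => f (pt x y)) c m + CInt (fun y => f (pt x y)) m d)%C).
{ intros x Hx. symmetry. apply CInt_Chasles; apply vcts_int; try lra; intros y Hy; apply Hx; lra. }
rewrite (S a Ha), (S b Hb). ring.
Qed.

Lemma RC_plus (f g : C -> C) (a b c d : R) : a <= b -> c <= d ->
  bcts f a b c d -> bcts g a b c d ->
  RC (fun z => f z + g z)%C a b c d = (RC f a b c d + RC g a b c d)%C.
Proof.
intros Hab Hcd (F1 & F2 & F3 & F4) (G1 & G2 & G3 & G4). unfold RC.
rewrite (CInt_plus _ _ _ _ (hcts_int f a b c Hab F1) (hcts_int g a b c Hab G1)).
rewrite (CInt_plus _ _ _ _ (hcts_int f a b d Hab F2) (hcts_int g a b d Hab G2)).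
rewrite (CInt_plus _ _ _ _ (vcts_int f a c d Hcd F3) (vcts_int g a c d Hcd G3)).
rewrite (CInt_plus _ _ _ _ (vcts_int f b c d Hcd F4) (vcts_int g b c d Hcd G4)).
ring.
Qed.

Lemma RC_mult (f : C -> C) (k : C) (a b c d : R) : a <= b -> c <= d ->
  bcts f a b c d -> RC (fun z => k * f z)%C a b c d = (k * RC f a b c d)%C.
Proof.
intros Hab Hcd (F1 & F2 & F3 & F4). unfold RC.
rewrite (CInt_mult _ _ _ k (hcts_int f a b c Hab F1)).
rewrite (CInt_mult _ _ _ k (hcts_int f a b d Hab F2)).
rewrite (CInt_mult _ _ _ k (vcts_int f a c d Hcd F3)).
rewrite (CInt_mult _ _ _ k (vcts_int f b c d Hcd F4)).
ring.
Qed.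

Lemma RC_Cmod_le (f : C -> C) (M a b c d : R) : a <= b -> c <= d -> bcts f a b c d ->
  (forall x, a <= x <= b -> Cmod (f (pt x c)) <= M /\ Cmod (f (pt x d)) <= M) ->
  (forall y, c <= y <= d -> Cmod (f (pt a y)) <= M /\ Cmod (f (pt b y)) <= M) ->
  Cmod (RC f a b c d) <= 2 * ((b - a) + (d - c)) * M.
Proof.
intros Hab Hcd (F1 & F2 & F3 & F4) Hh Hv. unfold RC.
eapply Rle_trans; [apply Cmod_triangle|].
rewrite Cmod_mult, Cmod_Ci, Rmult_1_l. unfold Cminus.
eapply Rle_trans; [apply Rplus_le_compat; apply Cmod_triangle|]. rewrite !Cmod_opp.
pose proof (CInt_Cmod_le_const _ M a b Hab (hcts_int f a b c Hab F1) (fun x Hx => proj1 (Hh x Hx))).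
pose proof (CInt_Cmod_le_const _ M a b Hab (hcts_int f a b d Hab F2) (fun x Hx => proj2 (Hh x Hx))).
pose proof (CInt_Cmod_le_const _ M c d Hcd (vcts_int f a c d Hcd F3) (fun x Hx => proj1 (Hv x Hx))).
pose proof (CInt_Cmod_le_const _ M c d Hcd (vcts_int f b c d Hcd F4) (fun x Hx => proj2 (Hv x Hx))).
lra.
Qed.

Lemma RC_primitive (F f : C -> C) (a b c d : R) : a <= b -> c <= d -> bcts f a b c d ->
  (forall z, Cder F z (f z)) -> RC f a b c d = 0.
Proof.
intros Hab Hcd (F1 & F2 & F3 & F4) HF. unfold RC.
assert (H : forall y, hcts f a b y -> CInt (fun x => f (pt x y)) a b = (F (pt b y) - F (pt a y))%C).
{ intros y Hy. apply (CInt_derive (fun x => F (pt x y))); [assumption| |].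
  - intros x Hx.
    pose proof (Cder_real_curve F (Ci * y)%C (f (pt x y)) 1 x) as D.
    replace (f (pt x y) * 1)%C with (f (pt x y)) in D by ring.
    replace (fun t : R => F (Ci * y + t * 1)%C) with (fun t : R => F (pt t y)) in D.
    + apply D. replace (Ci * y + x * 1)%C with (pt x y) by (unfold pt; ring). apply HF.
    + apply functional_extensionality; intros t. f_equal. unfold pt; ring.
  - intros x Hx. apply Ccts_pt_h, Hy, Hx. }
assert (V : forall x, vcts f x c d -> (Ci * CInt (fun y => f (pt x y)) c d)%C = (F (pt x d) - F (pt x c))%C).
{ intros x Hx. rewrite <- CInt_mult by now apply vcts_int.
  apply (CInt_derive (fun y => F (pt x y))); [assumption| |].
  - intros y Hy.
    pose proof (Cder_real_curve F x (f (pt x y)) Ci y) as D.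
    replace (f (pt x y) * Ci)%C with (Ci * f (pt x y))%C in D by ring.
    replace (fun t : R => F (x + t * Ci)%C) with (fun t : R => F (pt x t)) in D.
    + apply D. replace (x + y * Ci)%C with (pt x y) by (unfold pt; ring). apply HF.
    + apply functional_extensionality; intros t. f_equal. unfold pt; ring.
  - intros y Hy. apply continuous_Cmult; [apply continuous_const|]. apply Ccts_pt_v, Hx, Hy. }
rewrite (H c F1), (H d F2).
replace (Ci * (CInt (fun y => f (pt b y)) c d - CInt (fun y => f (pt a y)) c d))%C
  with (Ci * CInt (fun y => f (pt b y)) c d - Ci * CInt (fun y => f (pt a y)) c d)%C by ring.
rewrite (V a F3), (V b F4). ring.
Qed.

Definition in_rect (a b c d : R) (z : C) : Prop := a <= Re z <= b /\ c <= Im z <= d.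

Lemma in_rect_pt (a b c d x y : R) : a <= x <= b -> c <= y <= d -> in_rect a b c d (pt x y).
Proof. intros; split; rewrite ?Re_pt, ?Im_pt; assumption. Qed.

Lemma rect_bcts (f : C -> C) (a b c d : R) : a <= b -> c <= d ->
  (forall z, in_rect a b c d z -> Ccts f z) -> bcts f a b c d.
Proof.
intros Hab Hcd H. repeat split; intros t Ht; apply H, in_rect_pt; lra.
Qed.

(* If a property of dyadic subrectangles passes from the four quarters to the
   whole and holds for all small subrectangles around any given point, then it
   holds for the whole rectangle: otherwise a nested sequence of bad
   subrectangles would shrink to a point. *)
Lemma rect_bisection (P : nat -> R -> R -> Prop) (x0 y0 w h : R) :
  0 <= w -> 0 <= h ->
  (forall n x y, {P n x y} + {~ P n x y}) ->
  (forall n x y, x0 <= x -> x + w / 2 ^ n <= x0 + w -> y0 <= y -> y + h / 2 ^ n <= y0 + h ->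
    P (S n) x y -> P (S n) (x + w / 2 ^ S n) y -> P (S n) x (y + h / 2 ^ S n) ->
    P (S n) (x + w / 2 ^ S n) (y + h / 2 ^ S n) -> P n x y) ->
  (forall X Y, x0 <= X <= x0 + w -> y0 <= Y <= y0 + h -> exists N, forall n x y, (N <= n)%nat ->
    x0 <= x -> x + w / 2 ^ n <= x0 + w -> y0 <= y -> y + h / 2 ^ n <= y0 + h ->
    x <= X <= x + w / 2 ^ n -> y <= Y <= y + h / 2 ^ n -> P n x y) ->
  P O x0 y0.
Proof.
intros Hw Hh Pdec Hstep Hloc.
destruct (Pdec O x0 y0) as [|Hbad]; [assumption|exfalso].
(* Chooses the first bad quarter; when three quarters are good the fourth is taken untested, and it
   must be bad because otherwise the whole would be good. *)
set (next := fun (n : nat) (p : R * R) => let x := fst p in let y := snd p in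
  if Pdec (S n) x y then
    if Pdec (S n) (x + w / 2 ^ S n) y then
      if Pdec (S n) x (y + h / 2 ^ S n) then (x + w / 2 ^ S n, y + h / 2 ^ S n)
      else (x, y + h / 2 ^ S n)
    else (x + w / 2 ^ S n, y)
  else (x, y)).
set (s := fix s (n : nat) : R * R := match n with O => (x0, y0) | S m => next m (s m) end).
assert (Hpos : forall n, 0 < 2 ^ n) by (intros; apply pow_lt; lra).
assert (Hhalf : forall v n, v / 2 ^ n = v / 2 ^ S n + v / 2 ^ S n).
{ intros v n. simpl. field. pose proof (Hpos n); lra. }
assert (Hnn : forall v n, 0 <= v -> 0 <= v / 2 ^ n).
{ intros v n Hv. apply Rdiv_le_0_compat; [assumption|apply Hpos]. }
assert (Hs : forall n, fst (s n) <= fst (s (S n)) /\ fst (s (S n)) + w / 2 ^ S n <= fst (s n) + w / 2 ^ n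
   /\ snd (s n) <= snd (s (S n)) /\ snd (s (S n)) + h / 2 ^ S n <= snd (s n) + h / 2 ^ n).
{ intros n. rewrite (Hhalf w n), (Hhalf h n).
  pose proof (Hnn w (S n) Hw); pose proof (Hnn h (S n) Hh).
  change (s (S n)) with (next n (s n)). unfold next.
  repeat match goal with |- context [if ?t then _ else _] => destruct t end;
  cbn [fst snd]; lra. }
assert (Hmono : forall m n, fst (s n) <= fst (s (n + m)%nat) /\
  fst (s (n + m)%nat) + w / 2 ^ (n + m) <= fst (s n) + w / 2 ^ n /\ snd (s n) <= snd (s (n + m)%nat) /\
  snd (s (n + m)%nat) + h / 2 ^ (n + m) <= snd (s n) + h / 2 ^ n).
{ induction m as [|m IH]; intros n.
  - rewrite Nat.add_0_r. lra.
  - rewrite Nat.add_succ_r. specialize (IH n). specialize (Hs (n + m)%nat). lra. }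
assert (Hin : forall n, x0 <= fst (s n) /\ fst (s n) + w / 2 ^ n <= x0 + w
   /\ y0 <= snd (s n) /\ snd (s n) + h / 2 ^ n <= y0 + h).
{ intros n. pose proof (Hmono n O) as H. cbn [Nat.add s fst snd pow] in H.
  unfold Rdiv in H at 2 4. rewrite Rinv_1, !Rmult_1_r in H. exact H. }
assert (Hnot : forall n, ~ P n (fst (s n)) (snd (s n))).
{ induction n as [|n IH]; [exact Hbad|].
  change (s (S n)) with (next n (s n)). unfold next.
  repeat match goal with |- context [if ?t then _ else _] => destruct t end;
  cbn [fst snd]; try assumption.
  intros H4. apply IH. destruct (Hin n) as (I1 & I2 & I3 & I4).
  apply Hstep; assumption. }
assert (Hlim : forall (u : nat -> R) (v : R), 0 <= v ->
  (forall m n, u n <= u (n + m)%nat /\ u (n + m)%nat + v / 2 ^ (n + m) <= u n + v / 2 ^ n) ->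
  exists L, forall n, u n <= L <= u n + v / 2 ^ n).
{ intros u v Hv Hu.
  destruct (ex_finite_lim_seq_incr u (u O + v)) as [L HL].
  - intros n. destruct (Hu 1%nat n) as [H _]. now rewrite Nat.add_1_r in H.
  - intros n. destruct (Hu n O) as [_ H]. simpl in H. pose proof (Hnn v n Hv).
    unfold Rdiv in H at 2. rewrite Rinv_1, Rmult_1_r in H. lra.
  - exists L. intros n. split.
    + apply (is_lim_seq_incr_compare u); [assumption|].
      intros m. destruct (Hu 1%nat m) as [H _]. now rewrite Nat.add_1_r in H.
    + apply (is_lim_seq_le (fun m => u (m + n)%nat) (fun _ => u n + v / 2 ^ n) L (u n + v / 2 ^ n)).
      * intros m. rewrite (Nat.add_comm m n). destruct (Hu m n) as [_ H].
        pose proof (Hnn v (n + m)%nat Hv). lra.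
      * now apply (is_lim_seq_incr_n u n L).
      * apply is_lim_seq_const. }
destruct (Hlim (fun n => fst (s n)) w Hw) as [X HX].
{ intros m n; specialize (Hmono m n); tauto. }
destruct (Hlim (fun n => snd (s n)) h Hh) as [Y HY].
{ intros m n; specialize (Hmono m n); tauto. }
destruct (Hloc X Y) as [N HN].
{ pose proof (HX O) as H. simpl in H. unfold Rdiv in H. now rewrite Rinv_1, Rmult_1_r in H. }
{ pose proof (HY O) as H. simpl in H. unfold Rdiv in H. now rewrite Rinv_1, Rmult_1_r in H. }
apply (Hnot N). destruct (Hin N) as (I1 & I2 & I3 & I4).
apply HN; auto.
Qed.

(** The integrals over four quarters add up to the integral over the whole, so the bound [e / 4 ^ n]
    passes upwards. Near a given point [f] is an affine function, which has a primitive, plus a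
    remainder small against the diameter; diameter times perimeter shrinks like 4^(- n). *)
Lemma Cauchy_Goursat (f : C -> C) (a b c d : R) : a <= b -> c <= d ->
  (forall z, in_rect a b c d z -> Cdiff f z) -> RC f a b c d = 0.
Proof.
intros Hab Hcd Hf.
set (w := b - a). set (h := d - c). assert (Hw : 0 <= w) by (unfold w; lra). assert (Hh : 0 <= h) by (unfold h; lra).
assert (Hpos : forall n, 0 < 2 ^ n) by (intros; apply pow_lt; lra).
assert (Hsub : forall x y u v, a <= x -> x + u <= b -> c <= y -> y + v <= d ->
  forall z, in_rect x (x + u) y (y + v) z -> Cdiff f z).
{ intros x y u v H1 H2 H3 H4 z [Z1 Z2]. apply Hf. split; lra. }
apply Cmod_eq_0. apply Rle_antisym; [|apply Cmod_ge_0].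
apply Rle_plus_epsilon. intros e He. rewrite Rplus_0_l.
pose proof (rect_bisection
  (fun n x y => Cmod (RC f x (x + w / 2 ^ n) y (y + h / 2 ^ n)) <= e / 4 ^ n) a c w h Hw Hh) as Hbis.
cbv beta in Hbis.
replace (a + w / 2 ^ 0) with b in Hbis by (unfold w; simpl; field).
replace (c + h / 2 ^ 0) with d in Hbis by (unfold h; simpl; field).
replace (e / 4 ^ 0) with e in Hbis by (simpl; field).
apply Hbis; clear Hbis.
- intros; apply Rle_dec.
- intros n x y X1 X2 Y1 Y2 P1 P2 P3 P4.
  set (u := w / 2 ^ S n) in *. set (v := h / 2 ^ S n) in *.
  assert (Eu : w / 2 ^ n = u + u) by (unfold u; simpl; field; pose proof (Hpos n); lra).
  assert (Ev : h / 2 ^ n = v + v) by (unfold v; simpl; field; pose proof (Hpos n); lra).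
  assert (Hu : 0 <= u) by (apply Rdiv_le_0_compat; [assumption|apply Hpos]).
  assert (Hv : 0 <= v) by (apply Rdiv_le_0_compat; [assumption|apply Hpos]).
  rewrite Eu, Ev in *.
  assert (Hc : forall z, in_rect x (x + (u + u)) y (y + (v + v)) z -> Ccts f z).
  { intros z Hz. apply Cdiff_Ccts. unfold w, h in X2, Y2.
    apply (Hsub x y (u + u) (v + v)); try assumption; lra. }
  assert (Hhc : forall t s1 s2, y <= t <= y + (v + v) -> x <= s1 -> s2 <= x + (u + u) -> hcts f s1 s2 t).
  { intros t s1 s2 Ht H1 H2 s Hs. apply Hc, in_rect_pt; lra. }
  assert (Hvc : forall t s1 s2, x <= t <= x + (u + u) -> y <= s1 -> s2 <= y + (v + v) -> vcts f t s1 s2).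
  { intros t s1 s2 Ht H1 H2 s Hs. apply Hc, in_rect_pt; lra. }
  rewrite (RC_split_v f x (x + u) (x + (u + u))) by (try apply Hhc; lra).
  rewrite !(RC_split_h f _ _ y (y + v) (y + (v + v))) by (try apply Hvc; lra).
  replace (x + (u + u)) with (x + u + u) by ring. replace (y + (v + v)) with (y + v + v) by ring.
  eapply Rle_trans; [apply Cmod_triangle|].
  eapply Rle_trans; [apply Rplus_le_compat; apply Cmod_triangle|].
  replace (e / 4 ^ n) with (e / 4 ^ S n + e / 4 ^ S n + (e / 4 ^ S n + e / 4 ^ S n)).
  + lra.
  + simpl. field. apply pow_nonzero; lra.
- intros X Y HX HY.
  destruct (Hf (pt X Y)) as [l Hl].
  { apply in_rect_pt; unfold w, h in *; lra. }
  (* [D] bounds diameter and half perimeter of the whole rectangle and stays positive for a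
     degenerate one. With q = 2^(- n), perimeter 2 D q times e / (2 D^2) times diameter D q is e /
     4^n. *)
  set (D := w + h + 1). assert (HD : 0 < D) by (unfold D; lra).
  destruct (Hl (e / (2 * (D * D)))) as [r [Hr Hr']].
  { apply Rdiv_lt_0_compat; [assumption|]. repeat apply Rmult_lt_0_compat; lra. }
  destruct (pow_lt_1_zero (/ 2) ltac:(rewrite Rabs_pos_eq; lra) (r / D)) as [N HN].
  { now apply Rdiv_lt_0_compat. }
  exists N. intros n x y Hn X1 X2 Y1 Y2 XX YY.
  specialize (HN n Hn). rewrite Rabs_pos_eq in HN by (apply pow_le; lra).
  rewrite pow_inv in HN.
  set (q := / 2 ^ n) in *.
  assert (Hq : 0 < q) by (apply Rinv_0_lt_compat, Hpos).
  change (w / 2 ^ n) with (w * q) in *. change (h / 2 ^ n) with (h * q) in *.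
  assert (HDq : D * q < r).
  { apply Rmult_lt_compat_l with (r := D) in HN; [|assumption].
    replace (D * (r / D)) with r in HN by (field; lra). exact HN. }
  assert (Hwq : 0 <= w * q) by (apply Rmult_le_pos; lra).
  assert (Hhq : 0 <= h * q) by (apply Rmult_le_pos; lra).
  set (z0 := pt X Y) in *.
  assert (Hdist : forall z, in_rect x (x + w * q) y (y + h * q) z -> Cmod (z - z0)%C <= D * q).
  { intros z [Z1 Z2]. eapply Rle_trans; [apply Cmod_le_abs|].
    replace (Re (z - z0)%C) with (Re z - X) by (unfold z0; unfold Re, Im; simpl; ring).
    replace (Im (z - z0)%C) with (Im z - Y) by (unfold z0; unfold Re, Im; simpl; ring).
    assert (Rabs (Re z - X) <= w * q) by (apply Rabs_le; lra).
    assert (Rabs (Im z - Y) <= h * q) by (apply Rabs_le; lra).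
    unfold D. lra. }
  set (g := fun z => (f z - f z0 - l * (z - z0))%C).
  set (L := fun z => (f z0 - l * z0 + l * z)%C).
  assert (HLd : forall z, Cdiff L z).
  { intros z. apply Cdiff_plus; [apply Cdiff_const|]. apply Cdiff_mult; [apply Cdiff_const|apply Cdiff_id]. }
  assert (HL : RC L x (x + w * q) y (y + h * q) = 0).
  { apply (RC_primitive (fun z => (f z0 - l * z0) * z + l * (/ 2 * (z * z)))%C); try lra.
    - apply rect_bcts; try lra. intros z _. apply Cdiff_Ccts, HLd.
    - intros z.
      pose proof (Cder_plus _ _ _ _ _
        (Cder_mult _ _ z _ _ (Cder_const (f z0 - l * z0)%C z) (Cder_id z))
        (Cder_mult _ _ z _ _ (Cder_const l z)
          (Cder_mult _ _ z _ _ (Cder_const (/ 2)%C z) (Cder_mult _ _ z _ _ (Cder_id z) (Cder_id z))))) as H.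
      replace (L z) with (0 * z + (f z0 - l * z0) * 1 + (0 * (/ 2 * (z * z))
         + l * (0 * (z * z) + / 2 * (1 * z + z * 1))))%C; [exact H|].
      unfold L. field. }
  assert (Hfd : forall z, in_rect x (x + w * q) y (y + h * q) z -> Cdiff f z).
  { unfold w, h in *. apply Hsub; lra. }
  assert (Hgd : forall z, in_rect x (x + w * q) y (y + h * q) z -> Cdiff g z).
  { intros z Hz. apply Cdiff_minus.
    - apply Cdiff_minus; [now apply Hfd|apply Cdiff_const].
    - apply Cdiff_mult; [apply Cdiff_const|]. apply Cdiff_minus; [apply Cdiff_id|apply Cdiff_const]. }
  assert (Hgb : bcts g x (x + w * q) y (y + h * q)).
  { apply rect_bcts; try lra. intros z Hz. now apply Cdiff_Ccts, Hgd. }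
  assert (E : RC f x (x + w * q) y (y + h * q) = RC g x (x + w * q) y (y + h * q)).
  { replace f with (fun z => g z + L z)%C at 1.
    - rewrite RC_plus; try lra; try assumption.
      + rewrite HL. ring.
      + apply rect_bcts; try lra. intros z _. apply Cdiff_Ccts, HLd.
    - apply functional_extensionality. intros z. unfold g, L. ring. }
  rewrite E.
  assert (Hg : forall z, in_rect x (x + w * q) y (y + h * q) z -> Cmod (g z) <= e / (2 * (D * D)) * (D * q)).
  { intros z Hz. unfold g. eapply Rle_trans; [apply Hr'|].
    - eapply Rle_lt_trans; [now apply Hdist|assumption].
    - apply Rmult_le_compat_l; [|now apply Hdist].
      left; apply Rdiv_lt_0_compat; [assumption|]. repeat apply Rmult_lt_0_compat; lra. }
  eapply Rle_trans; [apply (RC_Cmod_le g (e / (2 * (D * D)) * (D * q))); try lra; try assumption|].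
  + intros t Ht; split; apply Hg, in_rect_pt; lra.
  + intros t Ht; split; apply Hg, in_rect_pt; lra.
  + replace (x + w * q - x + (y + h * q - y)) with ((w + h) * q) by ring.
    assert (H4 : e / 4 ^ n = e * (q * q)).
    { unfold q. replace 4 with (2 * 2) by ring. rewrite Rpow_mult_distr. field. pose proof (Hpos n); lra. }
    rewrite H4.
    apply Rle_trans with (2 * (D * q) * (e / (2 * (D * D)) * (D * q))); [|right; field; lra].
    apply Rmult_le_compat_r.
    * apply Rmult_le_pos; [|apply Rmult_le_pos; lra].
      left; apply Rdiv_lt_0_compat; [assumption|]. repeat apply Rmult_lt_0_compat; lra.
    * apply Rmult_le_compat_l; [lra|]. apply Rmult_le_compat_r; [lra|unfold D; lra].
Qed.

(** * Isolated singularities and Cauchy's integral formula *)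

Lemma RC_puncture (f : C -> C) (p1 p2 r a b c d : R) : 0 < r ->
  a <= p1 - r -> p1 + r <= b -> c <= p2 - r -> p2 + r <= d ->
  (forall z, in_rect a b c d z -> z <> pt p1 p2 -> Cdiff f z) ->
  RC f a b c d = RC f (p1 - r) (p1 + r) (p2 - r) (p2 + r).
Proof.
intros Hr Ha Hb Hc Hd Hf.
assert (Hne1 : forall x y, x <> p1 -> pt x y <> pt p1 p2).
{ intros x y H E. apply H. apply (f_equal Re) in E. now rewrite !Re_pt in E. }
assert (Hne2 : forall x y, y <> p2 -> pt x y <> pt p1 p2).
{ intros x y H E. apply H. apply (f_equal Im) in E. now rewrite !Im_pt in E. }
assert (Hh : forall y s t, c <= y <= d -> y <> p2 -> a <= s -> t <= b -> hcts f s t y).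
{ intros y s t Hy Hy2 Hs Ht x Hx. apply Cdiff_Ccts, Hf; [apply in_rect_pt; lra|now apply Hne2]. }
assert (Hv : forall x s t, a <= x <= b -> x <> p1 -> c <= s -> t <= d -> vcts f x s t).
{ intros x s t Hx Hx1 Hs Ht y Hy. apply Cdiff_Ccts, Hf; [apply in_rect_pt; lra|now apply Hne1]. }
assert (Hz : forall a' b' c' d', a <= a' -> a' <= b' -> b' <= b -> c <= c' -> c' <= d' -> d' <= d ->
  (b' < p1 \/ p1 < a' \/ d' < p2 \/ p2 < c') -> RC f a' b' c' d' = 0).
{ intros a' b' c' d' A1 A2 A3 A4 A5 A6 A7. apply Cauchy_Goursat; try assumption.
  intros z [Z1 Z2]. apply Hf; [split; lra|].
  intros E. pose proof (f_equal Re E) as E1; pose proof (f_equal Im E) as E2.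
  rewrite Re_pt in E1; rewrite Im_pt in E2. lra. }
(* Two vertical cuts and two horizontal cuts of the middle column isolate the square around the
   puncture; Cauchy's theorem kills the four other pieces. *)
rewrite (RC_split_v f a (p1 - r) b) by (try apply Hh; lra).
rewrite (RC_split_v f (p1 - r) (p1 + r) b) by (try apply Hh; lra).
rewrite (Hz a (p1 - r)) by lra. rewrite (Hz (p1 + r) b) by lra.
rewrite (RC_split_h f (p1 - r) (p1 + r) c (p2 - r) d) by (try apply Hv; lra).
rewrite (RC_split_h f (p1 - r) (p1 + r) (p2 - r) (p2 + r) d) by (try apply Hv; lra).
rewrite (Hz (p1 - r) (p1 + r) c) by lra. rewrite (Hz (p1 - r) (p1 + r) (p2 + r)) by lra.
ring.
Qed.

Lemma is_RInt_atan (p r : R) : 0 < r ->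
  is_RInt (fun x => 2 * r / ((x - p) ^ 2 + r ^ 2)) (p - r) (p + r) PI.
Proof.
intros Hr.
replace PI with (minus (2 * atan ((p + r - p) / r)) (2 * atan ((p - r - p) / r))).
2:{ replace ((p + r - p) / r) with 1 by (field; lra).
    replace ((p - r - p) / r) with (- (1)) by (field; lra).
    rewrite atan_opp, atan_1. unfold minus, plus, opp; simpl. field. }
assert (Hden : forall x, 0 < (x - p) ^ 2 + r ^ 2).
{ intros x. pose proof (pow2_ge_0 (x - p)). pose proof (pow_lt r 2 Hr). lra. }
apply (is_RInt_derive (V := R_CompleteNormedModule) (fun x => 2 * atan ((x - p) / r))).
- intros x _. auto_derive; [exact I|]. field.
  split; [specialize (Hden x); intros E; simpl in *; nra|lra].
- intros x _. apply (ex_derive_continuous_R).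
  auto_derive. specialize (Hden x). simpl in *. lra.
Qed.

(** Opposite sides are paired under one integral: the two reciprocals are conjugate up to sign and
    combine to 2 r / (t^2 + r^2), up to a factor i. Each pair of sides thus contributes i pi, by the
    arctangent. *)
Lemma RC_inv_square (p1 p2 r : R) : 0 < r ->
  RC (fun z => / (z - pt p1 p2))%C (p1 - r) (p1 + r) (p2 - r) (p2 + r) = (2 * PI * Ci)%C.
Proof.
intros Hr. unfold RC.
assert (Hcd : forall z, z <> pt p1 p2 -> Ccts (fun z => / (z - pt p1 p2))%C z).
{ intros z Hz. apply Cdiff_Ccts, Cdiff_inv.
  - apply Cdiff_minus; [apply Cdiff_id|apply Cdiff_const].
  - intros E. apply Hz. replace z with ((z - pt p1 p2) + pt p1 p2)%C by ring. rewrite E. ring. }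
assert (Hne1 : forall x y, x <> p1 -> pt x y <> pt p1 p2).
{ intros x y H E. apply H. apply (f_equal Re) in E. now rewrite !Re_pt in E. }
assert (Hne2 : forall x y, y <> p2 -> pt x y <> pt p1 p2).
{ intros x y H E. apply H. apply (f_equal Im) in E. now rewrite !Im_pt in E. }
assert (Hh : forall y s t, y <> p2 -> hcts (fun z => / (z - pt p1 p2))%C s t y).
{ intros y s t Hy x Hx. now apply Hcd, Hne2. }
assert (Hv : forall x s t, x <> p1 -> vcts (fun z => / (z - pt p1 p2))%C x s t).
{ intros x s t Hx y Hy. now apply Hcd, Hne1. }
rewrite <- (CInt_minus (fun x => / (pt x (p2 - r) - pt p1 p2))%C (fun x => / (pt x (p2 + r) - pt p1 p2))%C).
2:{ apply (hcts_int (fun z => / (z - pt p1 p2))%C); [lra|apply Hh; lra]. }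
2:{ apply (hcts_int (fun z => / (z - pt p1 p2))%C); [lra|apply Hh; lra]. }
rewrite <- (CInt_minus (fun y => / (pt (p1 + r) y - pt p1 p2))%C (fun y => / (pt (p1 - r) y - pt p1 p2))%C).
2:{ apply (vcts_int (fun z => / (z - pt p1 p2))%C); [lra|apply Hv; lra]. }
2:{ apply (vcts_int (fun z => / (z - pt p1 p2))%C); [lra|apply Hv; lra]. }
assert (Hden : forall t, 0 < t ^ 2 + r ^ 2).
{ intros t. pose proof (pow2_ge_0 t). pose proof (pow_lt r 2 Hr). lra. }
rewrite (CInt_unique _ _ _ (Ci * PI)%C).
2:{ apply (is_RInt_ext (V := C_R_NormedModule) (fun x => (Ci * RtoC (2 * r / ((x - p1) ^ 2 + r ^ 2)))%C)).
    - intros x _.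
      assert (E1 : (pt x (p2 - r) - pt p1 p2)%C = ((x - p1, - r) : C)) by (apply C_ext; unfold pt, Re, Im; simpl; ring).
      assert (E2 : (pt x (p2 + r) - pt p1 p2)%C = ((x - p1, r) : C)) by (apply C_ext; unfold pt, Re, Im; simpl; ring).
      rewrite E1, E2. specialize (Hden (x - p1)). simpl in Hden.
      apply C_ext; unfold Re, Im; simpl; field; repeat split; nra.
    - apply is_RInt_Cmult. apply is_RInt_pair; unfold Re, Im; simpl.
      + apply is_RInt_atan, Hr.
      + pose proof (is_RInt_const (V := R_NormedModule) (p1 - r) (p1 + r) 0) as H.
        unfold scal in H; simpl in H; unfold mult in H; simpl in H. now rewrite Rmult_0_r in H. }
rewrite (CInt_unique _ _ _ PI).
2:{ apply (is_RInt_ext (V := C_R_NormedModule) (fun x => RtoC (2 * r / ((x - p2) ^ 2 + r ^ 2)))).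
    - intros x _.
      assert (E1 : (pt (p1 + r) x - pt p1 p2)%C = ((r, x - p2) : C)) by (apply C_ext; unfold pt, Re, Im; simpl; ring).
      assert (E2 : (pt (p1 - r) x - pt p1 p2)%C = ((- r, x - p2) : C)) by (apply C_ext; unfold pt, Re, Im; simpl; ring).
      rewrite E1, E2. specialize (Hden (x - p2)). simpl in Hden.
      apply C_ext; unfold Re, Im; simpl; field; repeat split; nra.
    - apply is_RInt_pair; unfold Re, Im; simpl.
      + apply is_RInt_atan, Hr.
      + pose proof (is_RInt_const (V := R_NormedModule) (p2 - r) (p2 + r) 0) as H.
        unfold scal in H; simpl in H; unfold mult in H; simpl in H. now rewrite Rmult_0_r in H. }
ring.
Qed.

(** After the contour is shrunk to a small square, f(z) / (z - p) splits into f(p) / (z - p),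
    integrated explicitly, and the difference quotient, which is bounded near [p] and so contributes
    a multiple of the side length. *)
Lemma Cauchy_formula (f : C -> C) (p1 p2 a b c d : R) : a < p1 < b -> c < p2 < d ->
  (forall z, in_rect a b c d z -> Cdiff f z) ->
  RC (fun z => f z / (z - pt p1 p2))%C a b c d = (2 * PI * Ci * f (pt p1 p2))%C.
Proof.
intros Hp1 Hp2 Hf.
set (p := pt p1 p2).
assert (Hpne : forall z, z <> p -> (z - p)%C <> 0).
{ intros z Hz E. apply Hz. replace z with ((z - p) + p)%C by ring. rewrite E. ring. }
assert (Hinvd : forall z, z <> p -> Cdiff (fun z => / (z - p))%C z).
{ intros z Hz. apply Cdiff_inv; [|now apply Hpne].
  apply Cdiff_minus; [apply Cdiff_id|apply Cdiff_const]. }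
assert (Hinp : in_rect a b c d p) by (apply in_rect_pt; lra).
destruct (Hf p Hinp) as [l Hl].
destruct (Hl 1 Rlt_0_1) as [r0 [Hr0 Hl1]].
set (k := fun z => ((f z - f p) / (z - p))%C).
assert (Hkd : forall z, in_rect a b c d z -> z <> p -> Cdiff k z).
{ intros z Hz Hzp. apply Cdiff_mult; [|now apply Hinvd].
  apply Cdiff_minus; [now apply Hf|apply Cdiff_const]. }
assert (Hkb : forall z, z <> p -> Cmod (z - p)%C < r0 -> Cmod (k z) <= Cmod l + 1).
{ intros z Hzp Hz. specialize (Hl1 z Hz). unfold k.
  rewrite Cmod_div by now apply Hpne.
  assert (Hpos : 0 < Cmod (z - p)%C) by now apply Cmod_gt_0, Hpne.
  apply Rmult_le_reg_r with (Cmod (z - p)%C); [assumption|].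
  replace (Cmod (f z - f p)%C / Cmod (z - p)%C * Cmod (z - p)%C) with (Cmod (f z - f p)%C) by (field; lra).
  replace (f z - f p)%C with ((f z - f p - l * (z - p)) + l * (z - p))%C by ring.
  eapply Rle_trans; [apply Cmod_triangle|]. rewrite Cmod_mult. lra. }
set (r1 := Rmin (Rmin (p1 - a) (b - p1)) (Rmin (p2 - c) (d - p2))).
assert (Hr1 : 0 < r1) by (repeat apply Rmin_pos; lra).
assert (Hr1' : r1 <= p1 - a /\ r1 <= b - p1 /\ r1 <= p2 - c /\ r1 <= d - p2).
{ pose proof (Rmin_l (Rmin (p1 - a) (b - p1)) (Rmin (p2 - c) (d - p2))).
  pose proof (Rmin_r (Rmin (p1 - a) (b - p1)) (Rmin (p2 - c) (d - p2))).
  pose proof (Rmin_l (p1 - a) (b - p1)); pose proof (Rmin_r (p1 - a) (b - p1)).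
  pose proof (Rmin_l (p2 - c) (d - p2)); pose proof (Rmin_r (p2 - c) (d - p2)).
  unfold r1. lra. }
set (I := RC (fun z => f z / (z - p))%C a b c d).
apply C_eq_of_dist_le. intros e He.
pose proof (Cmod_ge_0 l).
(* [r1] keeps the square inside the rectangle, [r0 / 4] inside the disc where the quotient is at
   most |l| + 1, and the last entry makes the perimeter 8 r times this bound at most [e]. *)
set (r := Rmin r1 (Rmin (r0 / 4) (e / (8 * (Cmod l + 1))))).
assert (Hr : 0 < r).
{ repeat apply Rmin_pos; try lra. apply Rdiv_lt_0_compat; lra. }
pose proof (Rmin_l r1 (Rmin (r0 / 4) (e / (8 * (Cmod l + 1))))) as R1.
pose proof (Rmin_r r1 (Rmin (r0 / 4) (e / (8 * (Cmod l + 1))))) as R2.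
pose proof (Rmin_l (r0 / 4) (e / (8 * (Cmod l + 1)))) as R3.
pose proof (Rmin_r (r0 / 4) (e / (8 * (Cmod l + 1)))) as R4. fold r in R1, R2.
assert (E : I = RC (fun z => f z / (z - p))%C (p1 - r) (p1 + r) (p2 - r) (p2 + r)).
{ apply RC_puncture; try lra. intros z Hz Hzp. apply Cdiff_mult; [now apply Hf|now apply Hinvd]. }
assert (Hside : forall x y, (x = p1 - r \/ x = p1 + r \/ y = p2 - r \/ y = p2 + r) -> pt x y <> p).
{ intros x y Hxy Ep. pose proof (f_equal Re Ep) as E1; pose proof (f_equal Im Ep) as E2.
  unfold p in E1, E2. rewrite !Re_pt in E1; rewrite !Im_pt in E2. lra. }
assert (B1 : bcts (fun w => / (w - p))%C (p1 - r) (p1 + r) (p2 - r) (p2 + r)).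
{ repeat split; intros t Ht; apply Cdiff_Ccts, Hinvd, Hside; tauto. }
assert (B2 : bcts k (p1 - r) (p1 + r) (p2 - r) (p2 + r)).
{ repeat split; intros t Ht; (apply Cdiff_Ccts, Hkd; [apply in_rect_pt; lra|apply Hside; tauto]). }
assert (B3 : bcts (fun w => f p * / (w - p))%C (p1 - r) (p1 + r) (p2 - r) (p2 + r)).
{ repeat split; intros t Ht; (apply Cdiff_Ccts, Cdiff_mult; [apply Cdiff_const|apply Hinvd, Hside; tauto]). }
rewrite E.
replace (fun z => f z / (z - p))%C with (fun z => k z + f p * / (z - p))%C.
2:{ apply functional_extensionality; intros z. unfold k, Cdiv. ring. }
rewrite RC_plus by (try assumption; lra).
rewrite (RC_mult (fun w => / (w - p))%C) by (try assumption; lra).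
unfold p at 2. rewrite RC_inv_square by assumption.
replace (RC k (p1 - r) (p1 + r) (p2 - r) (p2 + r) + f p * (2 * PI * Ci) - 2 * PI * Ci * f p)%C
  with (RC k (p1 - r) (p1 + r) (p2 - r) (p2 + r)) by ring.
assert (Hd : forall x y, p1 - r <= x <= p1 + r -> p2 - r <= y <= p2 + r -> Cmod (pt x y - p)%C < r0).
{ intros x y Hx Hy. eapply Rle_lt_trans; [apply Cmod_le_abs|].
  replace (Re (pt x y - p)%C) with (x - p1) by (unfold p, pt, Re, Im; simpl; ring).
  replace (Im (pt x y - p)%C) with (y - p2) by (unfold p, pt, Re, Im; simpl; ring).
  assert (Rabs (x - p1) <= r) by (apply Rabs_le; lra).
  assert (Rabs (y - p2) <= r) by (apply Rabs_le; lra). lra. }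
eapply Rle_trans; [apply (RC_Cmod_le k (Cmod l + 1)); try assumption; try lra|].
- intros x Hx; split; (apply Hkb; [apply Hside; tauto|apply Hd; lra]).
- intros y Hy; split; (apply Hkb; [apply Hside; tauto|apply Hd; lra]).
- replace (2 * (p1 + r - (p1 - r) + (p2 + r - (p2 - r))) * (Cmod l + 1)) with (r * (8 * (Cmod l + 1))) by ring.
  apply Rle_trans with (e / (8 * (Cmod l + 1)) * (8 * (Cmod l + 1))); [|right; field; lra].
  apply Rmult_le_compat_r; lra.
Qed.

(** * Shifting vertical contours *)

(** The horizontal sides at height W vanish in the limit. Between the two lines regularity is asked
    for |y| >= 1 only, so that one statement serves both the pole-free shift and the crossing of a
    pole at 0. *)
Lemma LI_vertical_difference (F : C -> C) (a b K eta : R) (Z : C) : a <= b ->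
  (forall y, Ccts F (pt a y)) -> (forall y, Ccts F (pt b y)) ->
  (forall x y, a <= x <= b -> 1 <= Rabs y -> Ccts F (pt x y)) ->
  (forall x y, a <= x <= b -> 1 <= Rabs y -> Cmod (F (pt x y)) <= K * exp (- eta * Rabs y)) ->
  expdec (fun y => F (pt a y)) K eta -> expdec (fun y => F (pt b y)) K eta ->
  (forall W, 1 <= W -> RC F a b (- W) W = Z) ->
  (Ci * (LI (fun y => F (pt b y)) - LI (fun y => F (pt a y))))%C = Z.
Proof.
intros Hab Ha Hb Hh HhB Da Db HZ.
set (A := LI (fun y => F (pt a y))) in *. set (B := LI (fun y => F (pt b y))) in *.
pose proof (expdec_K_pos _ _ _ Da) as HK. assert (Heta : 0 < eta) by apply Da.
apply C_eq_of_dist_le. intros e He.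
destruct (LI_limit _ _ _ (e / 4) Da ltac:(lra)) as [W1 H1].
destruct (LI_limit _ _ _ (e / 4) Db ltac:(lra)) as [W2 H2].
destruct (exp_small (2 * (b - a) * K) eta (e / 4) Heta ltac:(lra)) as [W3 [_ H3]].
set (W := Rmax 1 (Rmax W1 (Rmax W2 W3))).
pose proof (Rmax_l 1 (Rmax W1 (Rmax W2 W3))) as M1. pose proof (Rmax_r 1 (Rmax W1 (Rmax W2 W3))) as M2.
pose proof (Rmax_l W1 (Rmax W2 W3)) as M3. pose proof (Rmax_r W1 (Rmax W2 W3)) as M4.
pose proof (Rmax_l W2 W3) as M5. pose proof (Rmax_r W2 W3) as M6. fold W in M1, M2.
specialize (H1 W ltac:(lra)). specialize (H2 W ltac:(lra)). specialize (H3 W ltac:(lra)).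
fold A in H1. fold B in H2.
rewrite <- (HZ W M1). unfold RC.
assert (AW : Rabs W = W) by (apply Rabs_pos_eq; lra).
assert (AW' : Rabs (- W) = W) by (rewrite Rabs_Ropp; exact AW).
set (IA := CInt (fun y => F (pt a y)) (- W) W) in *.
set (IB := CInt (fun y => F (pt b y)) (- W) W) in *.
assert (S : forall y, Rabs y = W -> Cmod (CInt (fun x => F (pt x y)) a b) <= (b - a) * (K * exp (- eta * W))).
{ intros y Hy. apply CInt_Cmod_le_const; [assumption| |].
  - apply (hcts_int F); [assumption|]. intros x Hx. apply Hh; [assumption|lra].
  - intros x Hx. rewrite <- Hy. apply HhB; [assumption|lra]. }
pose proof (S (- W) AW') as S1. pose proof (S W AW) as S2.
set (J1 := CInt (fun x => F (pt x (- W))) a b) in *. set (J2 := CInt (fun x => F (pt x W)) a b) in *.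
replace (Ci * (B - A) - (J1 - J2 + Ci * (IB - IA)))%C with
  ((Ci * ((IA - A) + - (IB - B))) + (- J1 + J2))%C by ring.
eapply Rle_trans; [apply Cmod_triangle|].
rewrite Cmod_mult, Cmod_Ci, Rmult_1_l.
eapply Rle_trans; [apply Rplus_le_compat; apply Cmod_triangle|]. rewrite !Cmod_opp. lra.
Qed.

Lemma vert_expdec (F : C -> C) (x K eta : R) : 0 < eta -> (forall y, Ccts F (pt x y)) ->
  (forall y, Cmod (F (pt x y)) <= K * exp (- eta * Rabs y)) -> expdec (fun y => F (pt x y)) K eta.
Proof.
intros He Hc Hb. repeat split; try assumption. intros y. now apply Ccts_pt_v.
Qed.

Lemma LI_shift (F : C -> C) (a b K eta : R) : a <= b -> 0 < eta ->
  (forall z, a <= Re z <= b -> Cdiff F z) ->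
  (forall x y, a <= x <= b -> Cmod (F (pt x y)) <= K * exp (- eta * Rabs y)) ->
  LI (fun y => F (pt b y)) = LI (fun y => F (pt a y)).
Proof.
intros Hab He Hd Hb.
assert (Hd' : forall x y, a <= x <= b -> Ccts F (pt x y)).
{ intros x y Hx. apply Cdiff_Ccts, Hd. now rewrite Re_pt. }
assert (E : (Ci * (LI (fun y => F (pt b y)) - LI (fun y => F (pt a y))))%C = 0).
{ apply (LI_vertical_difference F a b K eta); try assumption.
  - intros y; apply Hd'; lra.
  - intros y; apply Hd'; lra.
  - intros x y Hx _; now apply Hd'.
  - intros x y Hx _; now apply Hb.
  - apply vert_expdec; try assumption; intros y; [apply Hd'|apply Hb]; lra.
  - apply vert_expdec; try assumption; intros y; [apply Hd'|apply Hb]; lra.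
  - intros W HW. apply Cauchy_Goursat; try lra. intros z [Hz _]. now apply Hd. }
set (A := LI (fun y => F (pt a y))) in *. set (B := LI (fun y => F (pt b y))) in *.
replace B with (A - Ci * (Ci * (B - A)))%C.
- rewrite E. ring.
- replace (A - Ci * (Ci * (B - A)))%C with (A - (Ci * Ci) * (B - A))%C by ring.
  rewrite Ci_mult_Ci, RtoC_m1. ring.
Qed.

Lemma LI_residue (h : C -> C) (a b K eta : R) : a < 0 < b -> 0 < eta ->
  (forall z, a <= Re z <= b -> Cdiff h z) ->
  (forall x y, a <= x <= b -> Cmod (h (pt x y)) <= K * exp (- eta * Rabs y)) ->
  (LI (fun y => h (pt b y) / pt b y) - LI (fun y => h (pt a y) / pt a y))%C = (2 * PI * h 0)%C.
Proof.
intros Hab He Hd Hb.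
set (F := fun z => (h z / z)%C).
assert (Hne : forall x y, x <> 0 \/ y <> 0 -> pt x y <> 0).
{ intros x y H E. pose proof (f_equal Re E) as E1; pose proof (f_equal Im E) as E2.
  rewrite Re_pt in E1; rewrite Im_pt in E2. simpl in *. tauto. }
assert (Hd' : forall x y, a <= x <= b -> x <> 0 \/ y <> 0 -> Ccts F (pt x y)).
{ intros x y Hx Hxy. apply Cdiff_Ccts. apply Cdiff_div; [apply Hd; now rewrite Re_pt|apply Cdiff_id|now apply Hne]. }
(* A lower bound for |z| on the two lines and on the part |y| >= 1 of the strip, where 1 / z has to
   be estimated. *)
set (k := Rmin 1 (Rmin (- a) b)). assert (Hk : 0 < k) by (repeat apply Rmin_pos; lra).
assert (Hk' : k <= 1 /\ k <= - a /\ k <= b).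
{ pose proof (Rmin_l 1 (Rmin (- a) b)); pose proof (Rmin_r 1 (Rmin (- a) b)).
  pose proof (Rmin_l (- a) b); pose proof (Rmin_r (- a) b). unfold k; lra. }
assert (Hb0 : forall x y, a <= x <= b -> (k <= Rabs x \/ k <= Rabs y) ->
  Cmod (F (pt x y)) <= K / k * exp (- eta * Rabs y)).
{ intros x y Hx Hxy.
  assert (Hm : k <= Cmod (pt x y)).
  { pose proof (re_le_Cmod (pt x y)) as E1. pose proof (Im_le_Cmod (pt x y)) as E2.
    rewrite Re_pt in E1; rewrite Im_pt in E2. lra. }
  unfold F. rewrite Cmod_div by (apply Cmod_gt_0; lra).
  replace (K / k * exp (- eta * Rabs y)) with (K * exp (- eta * Rabs y) / k) by (field; lra).
  apply Rmult_le_compat; [apply Cmod_ge_0| |now apply Hb|].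
  - left. apply Rinv_0_lt_compat. lra.
  - apply Rinv_le_contravar; lra. }
assert (E : (Ci * (LI (fun y => F (pt b y)) - LI (fun y => F (pt a y))))%C = (2 * PI * Ci * h 0)%C).
{ apply (LI_vertical_difference F a b (K / k) eta); try assumption; try lra.
  - intros y; apply Hd'; lra.
  - intros y; apply Hd'; lra.
  - intros x y Hx Hy; apply Hd'; [assumption|]. right. intros E; rewrite E, Rabs_R0 in Hy; lra.
  - intros x y Hx Hy; apply Hb0; lra.
  - apply vert_expdec; try assumption; intros y; [apply Hd'|apply Hb0]; try lra. left. rewrite Rabs_left1; lra.
  - apply vert_expdec; try assumption; intros y; [apply Hd'|apply Hb0]; try lra. left. rewrite Rabs_pos_eq; lra.
  - intros W HW.
    pose proof (Cauchy_formula h 0 0 a b (- W) W Hab ltac:(lra)) as CF.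
    replace (pt 0 0) with (0 : C) in CF by (unfold pt; ring).
    rewrite <- CF.
    + f_equal. apply functional_extensionality; intros z. unfold F. f_equal. ring.
    + intros z [Hz _]. now apply Hd. }
fold F. change (LI (fun y => F (pt b y)) - LI (fun y => F (pt a y)) = 2 * PI * h 0)%C.
set (A := LI (fun y => F (pt a y))) in *. set (B := LI (fun y => F (pt b y))) in *.
replace (B - A)%C with (- Ci * (Ci * (B - A)))%C.
- rewrite E. replace (- Ci * (2 * PI * Ci * h 0))%C with (- (Ci * Ci) * (2 * PI * h 0))%C by ring.
  rewrite Ci_mult_Ci, RtoC_m1. ring.
- replace (- Ci * (Ci * (B - A)))%C with (- (Ci * Ci) * (B - A))%C by ring.
  rewrite Ci_mult_Ci, RtoC_m1. ring.
Qed.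

(** * The identity theorem *)

Lemma continuous_bounded (f : R -> C) (a b : R) : a <= b ->
  (forall x, a <= x <= b -> continuous_RC f x) ->
  exists M, forall x, a <= x <= b -> Cmod (f x) <= M.
Proof.
intros Hab Hf.
destruct (continuity_ab_maj (fun x => Cmod (f x)) a b Hab) as [m [Hm _]].
- intros x Hx. apply continuity_pt_filterlim.
  apply (filterlim_locally (U := R_UniformSpace)). intros e.
  generalize (proj1 (continuous_CmodP f x) (Hf x Hx) e (cond_pos e)). apply filter_imp.
  intros y Hy. unfold ball; simpl. unfold AbsRing_ball, abs, minus, plus, opp; simpl.
  change (Rabs (Cmod (f y) - Cmod (f x)) < e).
  pose proof (Cmod_le_plus (f y) (f x)). pose proof (Cmod_le_plus (f x) (f y)) as H2.
  rewrite Cmod_minus_sym in H2. apply Rabs_def1; lra.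
- exists (Cmod (f m)). exact Hm.
Qed.

Lemma Cdiff_pow (h : C -> C) (n : nat) (z : C) : Cdiff h z -> Cdiff (fun w => h w ^ n)%C z.
Proof.
intros H. induction n as [|n IH]; simpl.
- apply Cdiff_const.
- now apply Cdiff_mult.
Qed.

Lemma rect_boundary_bounded (f : C -> C) (a b c d : R) : a <= b -> c <= d -> bcts f a b c d ->
  exists M, (forall x, a <= x <= b -> Cmod (f (pt x c)) <= M /\ Cmod (f (pt x d)) <= M) /\
    (forall y, c <= y <= d -> Cmod (f (pt a y)) <= M /\ Cmod (f (pt b y)) <= M).
Proof.
intros Hab Hcd (F1 & F2 & F3 & F4).
destruct (continuous_bounded (fun x => f (pt x c)) a b Hab) as [M1 H1]; [intros; now apply Ccts_pt_h, F1|].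
destruct (continuous_bounded (fun x => f (pt x d)) a b Hab) as [M2 H2]; [intros; now apply Ccts_pt_h, F2|].
destruct (continuous_bounded (fun y => f (pt a y)) c d Hcd) as [M3 H3]; [intros; now apply Ccts_pt_v, F3|].
destruct (continuous_bounded (fun y => f (pt b y)) c d Hcd) as [M4 H4]; [intros; now apply Ccts_pt_v, F4|].
exists (Rmax (Rmax M1 M2) (Rmax M3 M4)).
pose proof (Rmax_l (Rmax M1 M2) (Rmax M3 M4)); pose proof (Rmax_r (Rmax M1 M2) (Rmax M3 M4)).
pose proof (Rmax_l M1 M2); pose proof (Rmax_r M1 M2); pose proof (Rmax_l M3 M4); pose proof (Rmax_r M3 M4).
split; intros t Ht; specialize (H1 t); specialize (H2 t); specialize (H3 t); specialize (H4 t); split; lra.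
Qed.

(* Cauchy's formula for [k z / (z - p)^n], which is differentiable because [k]
   vanishes near [p], gives [|k z| <= const (|z - p| / r)^n] for every [n]. *)
Lemma identity_disc (k : C -> C) (p1 p2 r e : R) : 0 < r -> 0 < e ->
  (forall z, in_rect (p1 - r) (p1 + r) (p2 - r) (p2 + r) z -> Cdiff k z) ->
  (forall z, Cmod (z - pt p1 p2)%C < e -> k z = 0) ->
  forall z, Cmod (z - pt p1 p2)%C < r -> k z = 0.
Proof.
intros Hr He Hk Hz z Hzr. set (p := pt p1 p2) in *.
destruct (Rlt_or_le (Cmod (z - p)%C) e) as [|Hze]; [now apply Hz|].
set (t := Cmod (z - p)%C) in *.
assert (Hzp : (z - p)%C <> 0) by (apply Cmod_gt_0; fold t; lra).
pose proof (Cmod_Re_Im_lt z p r Hzr) as [Z1 Z2]. unfold p in Z1, Z2. rewrite Re_pt in Z1; rewrite Im_pt in Z2.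
apply Rabs_def2 in Z1; apply Rabs_def2 in Z2.
assert (Hside : forall x y, (x = p1 - r \/ x = p1 + r \/ y = p2 - r \/ y = p2 + r) -> r <= Cmod (pt x y - p)%C).
{ intros x y H.
  pose proof (re_le_Cmod (pt x y - p)%C) as E1. pose proof (Im_le_Cmod (pt x y - p)%C) as E2.
  replace (Re (pt x y - p)%C) with (x - p1) in E1 by (unfold p, pt, Re, Im; simpl; ring).
  replace (Im (pt x y - p)%C) with (y - p2) in E2 by (unfold p, pt, Re, Im; simpl; ring).
  destruct H as [H|[H|[H|H]]]; subst.
  - replace (p1 - r - p1) with (- r) in E1 by ring. rewrite Rabs_Ropp, Rabs_pos_eq in E1; lra.
  - replace (p1 + r - p1) with r in E1 by ring. rewrite Rabs_pos_eq in E1; lra.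
  - replace (p2 - r - p2) with (- r) in E2 by ring. rewrite Rabs_Ropp, Rabs_pos_eq in E2; lra.
  - replace (p2 + r - p2) with r in E2 by ring. rewrite Rabs_pos_eq in E2; lra. }
destruct (rect_boundary_bounded k (p1 - r) (p1 + r) (p2 - r) (p2 + r)) as [M [M1 M2]]; try lra.
{ apply rect_bcts; try lra. intros w Hw. now apply Cdiff_Ccts, Hk. }
assert (HM : 0 <= M).
{ destruct (M1 p1 ltac:(lra)) as [H _]. eapply Rle_trans; [apply Cmod_ge_0|exact H]. }
assert (Hbound : forall n, Cmod (k z) <= 8 * r * (M / (r - t)) * (t / r) ^ n).
{ intros n. set (kn := fun w => (k w / (w - p) ^ n)%C).
  assert (Hkn : forall w, in_rect (p1 - r) (p1 + r) (p2 - r) (p2 + r) w -> Cdiff kn w).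
  { intros w Hw. destruct (Rlt_or_le (Cmod (w - p)%C) e) as [Hwe|Hwe].
    (* Near [p] the quotient is identically zero because its numerator is, whatever value division
       by zero has at [p] itself. *)
    - exists 0. apply (Cder_ext_loc (fun _ => 0 : C) kn w 0 (e - Cmod (w - p)%C)); [lra| |apply Cder_const].
      intros v Hv. unfold kn. rewrite Hz; [unfold Cdiv; ring|].
      replace (v - p)%C with ((v - w) + (w - p))%C by ring.
      eapply Rle_lt_trans; [apply Cmod_triangle|lra].
    - apply Cdiff_div; [now apply Hk| |].
      + apply Cdiff_pow, Cdiff_minus; [apply Cdiff_id|apply Cdiff_const].
      + apply Cpow_nz, Cmod_gt_0. lra. }
  pose proof (Cauchy_formula kn (Re z) (Im z) (p1 - r) (p1 + r) (p2 - r) (p2 + r) ltac:(lra) ltac:(lra) Hkn) as CF.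
  rewrite pt_Re_Im in CF.
  assert (Hb : forall x y, (x = p1 - r \/ x = p1 + r \/ y = p2 - r \/ y = p2 + r) -> Cmod (k (pt x y)) <= M ->
    Cmod (kn (pt x y) / (pt x y - z))%C <= M / (r - t) * (/ r) ^ n).
  { intros x y Hxy HkM. specialize (Hside x y Hxy).
    assert (Hd : r - t <= Cmod (pt x y - z)%C).
    { pose proof (Cmod_triangle (pt x y - z)%C (z - p)%C) as T.
      replace (pt x y - z + (z - p))%C with (pt x y - p)%C in T by ring. unfold t. lra. }
    assert (D1 : (pt x y - p)%C <> 0) by (apply Cmod_gt_0; lra).
    assert (D2 : (pt x y - z)%C <> 0) by (apply Cmod_gt_0; lra).
    unfold kn. rewrite !Cmod_div by (try assumption; now apply Cpow_nz).
    rewrite Cmod_pow.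
    replace (M / (r - t) * (/ r) ^ n) with (M * (/ r) ^ n * / (r - t)) by (unfold Rdiv; ring).
    apply Rmult_le_compat.
    - apply Rdiv_le_0_compat; [apply Cmod_ge_0|apply pow_lt; lra].
    - left; apply Rinv_0_lt_compat; lra.
    - apply Rmult_le_compat; [apply Cmod_ge_0| |assumption|].
      + left; apply Rinv_0_lt_compat, pow_lt; lra.
      + rewrite <- pow_inv. apply pow_incr. split; [left; apply Rinv_0_lt_compat; lra|].
        apply Rinv_le_contravar; lra.
    - apply Rinv_le_contravar; lra. }
  assert (Hbc : bcts (fun w => kn w / (w - z))%C (p1 - r) (p1 + r) (p2 - r) (p2 + r)).
  { assert (Hg : forall x y, (x = p1 - r \/ x = p1 + r \/ y = p2 - r \/ y = p2 + r) ->
      in_rect (p1 - r) (p1 + r) (p2 - r) (p2 + r) (pt x y) -> Ccts (fun w => kn w / (w - z))%C (pt x y)).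
    { intros x y Hxy Hin. apply Cdiff_Ccts, Cdiff_div; [now apply Hkn| |].
      - apply Cdiff_minus; [apply Cdiff_id|apply Cdiff_const].
      - specialize (Hside x y Hxy). intros E.
        replace (pt x y - p)%C with ((pt x y - z) + (z - p))%C in Hside by ring.
        rewrite E, Cplus_0_l in Hside. fold t in Hside. lra. }
    repeat split; intros s Hs; (apply Hg; [tauto|apply in_rect_pt; lra]). }
  pose proof (RC_Cmod_le (fun w => kn w / (w - z))%C (M / (r - t) * (/ r) ^ n)
    (p1 - r) (p1 + r) (p2 - r) (p2 + r)
    ltac:(lra) ltac:(lra) Hbc
    (fun x Hx => conj (Hb _ _ (or_intror (or_intror (or_introl eq_refl))) (proj1 (M1 x Hx)))
                      (Hb _ _ (or_intror (or_intror (or_intror eq_refl))) (proj2 (M1 x Hx))))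
    (fun y Hy => conj (Hb _ _ (or_introl eq_refl) (proj1 (M2 y Hy)))
                      (Hb _ _ (or_intror (or_introl eq_refl)) (proj2 (M2 y Hy))))) as HRC.
  rewrite CF in HRC.
  rewrite !Cmod_mult, Cmod_Ci, !Cmod_RtoC_nonneg in HRC by (try lra; left; apply PI_RGT_0).
  replace (2 * (p1 + r - (p1 - r) + (p2 + r - (p2 - r)))) with (8 * r) in HRC by ring.
  assert (E : Cmod (k z) = Cmod (kn z) * t ^ n).
  { unfold kn. rewrite Cmod_div by (now apply Cpow_nz). rewrite Cmod_pow. fold t. field. apply pow_nonzero; lra. }
  rewrite E.
  assert (Hkz : Cmod (kn z) <= 8 * r * (M / (r - t) * (/ r) ^ n)).
  { pose proof PI2_1. pose proof (Cmod_ge_0 (kn z)).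
    assert (1 * Cmod (kn z) <= 2 * PI * 1 * Cmod (kn z)) by (apply Rmult_le_compat_r; lra). lra. }
  unfold Rdiv at 2. rewrite Rpow_mult_distr.
  apply Rle_trans with (8 * r * (M / (r - t) * (/ r) ^ n) * t ^ n); [|right; ring].
  apply Rmult_le_compat_r; [apply pow_le; lra|assumption]. }
apply Cmod_eq_0. apply Rle_antisym; [|apply Cmod_ge_0].
apply Rle_plus_epsilon. intros e' He'. rewrite Rplus_0_l.
set (Q := 8 * r * (M / (r - t))).
assert (HQ : 0 <= Q) by (apply Rmult_le_pos; [lra|apply Rdiv_le_0_compat; lra]).
assert (Htr : 0 <= t / r < 1).
{ split; [apply Rdiv_le_0_compat; lra|]. apply Rmult_lt_reg_r with r; [assumption|].
  replace (t / r * r) with t by (field; lra). lra. }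
destruct (pow_lt_1_zero (t / r) ltac:(rewrite Rabs_pos_eq; lra) (e' / (Q + 1))) as [N HN].
{ apply Rdiv_lt_0_compat; lra. }
specialize (HN N (Nat.le_refl N)). rewrite Rabs_pos_eq in HN by (apply pow_le; lra).
eapply Rle_trans; [apply (Hbound N)|]. fold Q.
apply Rle_trans with ((Q + 1) * (e' / (Q + 1))); [|right; field; lra].
apply Rmult_le_compat; try lra. apply pow_le; lra.
Qed.

Lemma identity_half_line (k : C -> C) (t0 r0 : R) : 0 < r0 ->
  (forall t, t0 <= t -> exists r, 0 < r /\ forall z, Cmod (z - t)%C < r -> Cdiff k z) ->
  (forall z, Cmod (z - t0)%C < r0 -> k z = 0) ->
  forall t, t0 <= t -> k t = 0.
Proof.
intros Hr0 Hreg Hz T HT.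
set (E := fun t => t0 <= t /\ forall y, t0 <= y <= t -> exists r, 0 < r /\ forall z, Cmod (z - y)%C < r -> k z = 0).
destruct (classic (E T)) as [[_ HE]|HnE].
{ destruct (HE T ltac:(lra)) as [r [Hr H]]. apply H. replace (T - T)%C with (0 : C) by ring. now rewrite Cmod_0. }
exfalso.
assert (E0 : E t0).
{ split; [lra|]. intros y Hy. replace y with t0 by lra. now exists r0. }
assert (Hbnd : is_upper_bound E T).
{ intros t [Ht1 Ht]. destruct (Rle_or_lt t T) as [|Hlt]; [assumption|exfalso].
  apply HnE. split; [assumption|]. intros y Hy. apply Ht. lra. }
destruct (completeness E) as [x0 [Hub Hlub]].
{ now exists T. }
{ now exists t0. }
assert (Hx0 : t0 <= x0) by now apply Hub.
destruct (Hreg x0 Hx0) as [r [Hr Hrd]].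
assert (Hex : exists z0, E z0 /\ x0 - r / 8 < z0).
{ apply NNPP. intros H.
  assert (x0 <= x0 - r / 8); [|lra]. apply Hlub. intros t Ht.
  destruct (Rle_or_lt t (x0 - r / 8)); [assumption|]. exfalso. apply H. now exists t. }
destruct Hex as [z0 [Hz0 Hz0x]].
assert (Hz0' : z0 <= x0) by now apply Hub.
destruct Hz0 as [Hz0t Hz0E]. destruct (Hz0E z0 ltac:(lra)) as [e [He Hke]].
assert (Ept : pt z0 0 = RtoC z0) by (unfold pt; ring).
(* Since [z0] is within r / 8 of the supremum, the square of half-side r / 4 around [z0] lies in the
   disc of regularity of radius [r], while the disc of radius r / 4 around [z0] reaches beyond
   [x0 + r / 8]. *)
assert (Hdisc : forall z, Cmod (z - z0)%C < r / 4 -> k z = 0).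
{ rewrite <- Ept in Hke |- *. apply (identity_disc k z0 0 (r / 4) e); try lra; [|exact Hke].
  intros z [Z1 Z2]. apply Hrd. eapply Rle_lt_trans; [apply Cmod_le_abs|].
  replace (Re (z - x0)%C) with (Re z - x0) by (unfold Re, Im; simpl; ring).
  replace (Im (z - x0)%C) with (Im z) by (unfold Re, Im; simpl; ring).
  assert (Rabs (Re z - x0) <= r / 4 + r / 8) by (apply Rabs_le; lra).
  assert (Rabs (Im z) <= r / 4) by (apply Rabs_le; lra). lra. }
assert (HE' : E (x0 + r / 16)).
{ split; [lra|]. intros y Hy. destruct (Rle_or_lt y z0) as [Hyz|Hyz].
  - apply Hz0E. lra.
  - exists (r / 4 - (y - z0)). split; [lra|]. intros z Hzy. apply Hdisc.
    replace (z - z0)%C with ((z - y) + ((y - z0 : R)))%C by (rewrite RtoC_minus; ring).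
    eapply Rle_lt_trans; [apply Cmod_triangle|].
    rewrite Cmod_RtoC_nonneg by lra. lra. }
specialize (Hub _ HE'). lra.
Qed.

(** * The Gamma function *)

Definition gker (s : C) (u : R) : C := Cexp (s * u - exp u)%C.

(* Euler's integral after the substitution t = e^u. *)
Definition GammaL (s : C) : C := LI (gker s).

(** To the left the factor e^(c u) decays at rate at least [c1]. To the right e^u >= u^2 / 4, and
    completing the square gives the constant. [kappa] will be 1, the cosine of a rotation angle, or
    the parameter of a Gaussian. *)
Lemma gker_bound (c1 c2 kappa : R) : 0 < c1 <= c2 -> 0 < kappa ->
  exists K, 0 < K /\ forall c u, c1 <= c <= c2 ->
    exp (c * u - kappa * exp u) <= K * exp (- c1 * Rabs u).
Proof.
intros Hc Hk. exists (exp ((c1 + c2) ^ 2 / kappa)). split; [apply exp_pos|].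
intros c u Hcu. rewrite <- exp_plus. apply exp_le.
assert (Hq : 0 <= (c1 + c2) ^ 2 / kappa) by (apply Rdiv_le_0_compat; [apply pow2_ge_0|assumption]).
destruct (Rle_or_lt u 0) as [Hu|Hu].
- rewrite Rabs_left1 by assumption.
  assert (0 <= kappa * exp u) by (apply Rmult_le_pos; [lra|left; apply exp_pos]).
  assert ((c - c1) * u <= 0).
  { rewrite <- (Rmult_0_r (c - c1)). apply Rmult_le_compat_l; lra. }
  lra.
- rewrite Rabs_pos_eq by lra.
  assert (Hexp : (1 + u / 2) ^ 2 <= exp u).
  { replace (exp u) with (exp (u / 2) ^ 2).
    - apply pow_incr. pose proof (exp_ineq1_le (u / 2)). lra.
    - simpl. rewrite Rmult_1_r, <- exp_plus. f_equal. field. }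
  assert (u ^ 2 / 4 <= exp u) by nra.
  assert (kappa * (u ^ 2 / 4) <= kappa * exp u) by (apply Rmult_le_compat_l; lra).
  assert ((c + c1) * u <= (c1 + c2) * u) by (apply Rmult_le_compat_r; lra).
  assert ((c1 + c2) * u <= kappa * (u ^ 2 / 4) + (c1 + c2) ^ 2 / kappa).
  { pose proof (pow2_ge_0 (kappa * u / 2 - (c1 + c2))) as Hsq.
    apply Rmult_le_reg_l with kappa; [assumption|].
    replace (kappa * (kappa * (u ^ 2 / 4) + (c1 + c2) ^ 2 / kappa)) with
      ((kappa * u / 2 - (c1 + c2)) ^ 2 + kappa * ((c1 + c2) * u)) by (field; lra).
    lra. }
  lra.
Qed.

Lemma gker_cont (s : C) : ccont (gker s).
Proof.
intros u. apply continuous_Cexp, continuous_Cminus.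
- apply continuous_Cmult; [apply continuous_const|apply continuous_RtoC, continuous_id].
- apply continuous_RtoC, continuous_Rexp, continuous_id.
Qed.

Lemma Cmod_gker (s : C) (u : R) : Cmod (gker s u) = exp (Re s * u - exp u).
Proof. unfold gker. rewrite Cmod_Cexp. f_equal. unfold Re, Im; simpl. ring. Qed.

Lemma gker_expdec (s : C) : 0 < Re s -> exists K, expdec (gker s) K (Re s).
Proof.
intros Hs. destruct (gker_bound (Re s) (Re s) 1 ltac:(lra) Rlt_0_1) as [K [_ HK]].
exists K. repeat split; [apply gker_cont|assumption|].
intros u. rewrite Cmod_gker. replace (exp u) with (1 * exp u) by ring. apply HK; lra.
Qed.

Lemma ln_lt_of_exp (x y : R) : 0 < x -> x < exp y -> ln x < y.
Proof. intros Hx H. apply exp_lt_inv. now rewrite exp_ln. Qed.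

Lemma lt_ln_of_exp (x y : R) : exp y < x -> y < ln x.
Proof.
intros H. apply exp_lt_inv. rewrite exp_ln; [assumption|].
eapply Rlt_trans; [apply exp_pos|exact H].
Qed.

Lemma is_derive_exp_real (x : R) : is_derive exp x (exp x) /\ continuous exp x.
Proof.
split; [auto_derive; [exact I|ring]|]. apply continuous_Rexp, continuous_id.
Qed.

Lemma CGamma_GammaL (s : C) : 0 < Re s -> CGamma s = GammaL s.
Proof.
intros Hs. destruct (gker_expdec s Hs) as [K HK].
set (f := fun t : R => (rcpow t (s - RtoC 1) * RtoC (exp (- t)))%C).
assert (Hf : forall x, 0 < x -> continuous_RC f x).
{ intros x Hx. apply continuous_Cmult.
  - apply continuous_Cexp, continuous_Cmult; [apply continuous_const|].
    apply continuous_RtoC.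
    apply (ex_derive_continuous_R ln). auto_derive; exact Hx.
  - apply continuous_RtoC, continuous_Rexp, continuous_Ropp, continuous_id. }
assert (Hsub : forall a b, 0 < a -> 0 < b ->
  is_RInt_C f a b (CInt (gker s) (ln a) (ln b))).
{ intros a b Ha Hb.
  assert (Hex : CIntegrable f a b).
  { apply (ex_RInt_continuous (V := CV)). intros x [Hx _]. apply Hf.
    eapply Rlt_le_trans; [|exact Hx]. now apply Rmin_glb_lt. }
  replace (CInt (gker s) (ln a) (ln b)) with (CInt f a b); [now apply CInt_correct|].
  pose proof (is_RInt_comp (V := CV) f exp exp (ln a) (ln b)
    (fun x _ => Hf (exp x) (exp_pos x)) (fun x _ => is_derive_exp_real x)) as H.
  rewrite !exp_ln in H by assumption.
  symmetry. apply CInt_unique. revert H. apply is_RInt_ext. intros u _.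
  unfold gker, f, rcpow. rewrite ln_exp.
  transitivity (Cexp u * (Cexp ((s - 1) * u) * Cexp (RtoC (- exp u))))%C.
  - rewrite !Cexp_RtoC. apply C_ext; simpl; unfold scal; simpl; unfold mult; simpl; unfold Re, Im; simpl; ring.
  - rewrite <- !Cexp_plus. f_equal. rewrite RtoC_opp. ring. }
unfold CGamma. apply (is_RInt_gen_unique (V := CV) f).
assert (Heta : 0 < Re s) by assumption.
intros P [e HP].
destruct (exp_small (2 * (K / Re s)) (Re s) (e / 2) Heta) as [W0 [HW0 HW]].
{ pose proof (cond_pos e); lra. }
(* Under t = e^u these neighbourhoods of 0 and infinity are ln a < - W0 and ln b > W0. *)
apply (Filter_prod _ _ _ (fun a => 0 < a < exp (- W0)) (fun b => exp W0 < b)).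
- exists (mkposreal _ (exp_pos (- W0))). intros x Hx Hx0.
  unfold ball in Hx; simpl in Hx. unfold AbsRing_ball, abs, minus, plus, opp in Hx; simpl in Hx.
  apply Rabs_def2 in Hx. lra.
- exists (exp W0); tauto.
- intros a b Ha Hb. pose proof (exp_pos W0).
  exists (CInt (gker s) (ln a) (ln b)); split.
  + apply Hsub; lra.
  + apply HP. apply Cmod_Re_Im_lt.
    pose proof (ln_lt_of_exp a (- W0) ltac:(lra) ltac:(lra)) as La. pose proof (lt_ln_of_exp b W0 Hb) as Lb.
    eapply Rle_lt_trans; [apply (LI_spec _ _ _ _ _ HK); lra|].
    pose proof (HW (- ln a) ltac:(lra)). pose proof (HW (ln b) ltac:(lra)).
    replace (- Re s * - ln a) with (Re s * ln a) in * by ring.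
    pose proof (cond_pos e). lra.
Qed.

Lemma Cder_gexp (s z : C) :
  Cder (fun z => Cexp (s * z - Cexp z))%C z (Cexp (s * z - Cexp z) * (s - Cexp z))%C.
Proof.
apply (Cder_comp (fun z => s * z - Cexp z)%C Cexp); [|apply Cder_Cexp].
pose proof (Cder_plus _ _ _ _ _ (Cder_mult _ _ z _ _ (Cder_const s z) (Cder_id z))
  (Cder_mult _ _ z _ _ (Cder_const (- (1))%C z) (Cder_Cexp z))) as H.
replace (s - Cexp z)%C with (0 * z + s * 1 + (0 * Cexp z + - (1) * Cexp z))%C by ring.
apply (Cder_ext_loc (fun w => s * w + - (1) * Cexp w)%C _ z _ 1); [lra| |exact H].
intros w _. ring.
Qed.

(** [s * gker s u - gker (s + 1) u] is the derivative of [gker s u], which vanishes at both ends. *)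
Lemma GammaL_succ (s : C) : 0 < Re s -> GammaL (s + 1)%C = (s * GammaL s)%C.
Proof.
intros Hs. destruct (gker_expdec s Hs) as [K HK].
assert (Hs1 : 0 < Re (s + 1)%C) by (unfold Re in *; simpl; lra).
destruct (gker_expdec (s + 1)%C Hs1) as [K' HK'].
pose proof (expdec_mult_const _ _ _ s HK) as HsK.
assert (E : LI (fun u => s * gker s u - gker (s + 1) u)%C = 0).
{ assert (Hm : 0 < Rmin (Re s) (Re (s + 1)%C)) by now apply Rmin_pos.
  assert (Hd : expdec (fun u => s * gker s u - gker (s + 1) u)%C
    (Cmod s * K + Cmod (-1) * K') (Rmin (Re s) (Re (s + 1)%C))).
  { replace (fun u => s * gker s u - gker (s + 1) u)%C with
      (fun u => s * gker s u + (-1 : C) * gker (s + 1) u)%C.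
    - apply expdec_plus.
      + apply (expdec_weaken _ _ _ _ _ HsK); [lra|split; [assumption|apply Rmin_l]].
      + apply (expdec_weaken _ _ _ _ _ (expdec_mult_const _ _ _ (-1) HK')); [lra|split; [assumption|apply Rmin_r]].
    - apply functional_extensionality; intros u. rewrite RtoC_m1. ring. }
  apply (LI_unique _ _ _ _ Hd). intros e He.
  destruct (exp_small (2 * K) (Re s) e Hs He) as [W0 [HW0 HW]].
  exists W0. intros W HWW. specialize (HW W HWW).
  rewrite (CInt_derive (gker s)).
  - replace (gker s W - gker s (- W) - 0)%C with (gker s W + - gker s (- W))%C by ring.
    eapply Rle_trans; [apply Cmod_triangle|]. rewrite Cmod_opp.
    destruct HK as (_ & _ & HK). pose proof (HK W) as B1. pose proof (HK (- W)) as B2.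
    rewrite Rabs_Ropp in B2. rewrite Rabs_pos_eq in B1, B2 by lra. lra.
  - lra.
  - intros u _.
    pose proof (Cder_real_curve (fun z => Cexp (s * z - Cexp z))%C 0 _ 1 u (Cder_gexp s _)) as D. cbv beta in D.
    replace (fun t : R => Cexp (s * (0 + t * 1) - Cexp (0 + t * 1))%C) with (gker s) in D.
    + replace (s * gker s u - gker (s + 1) u)%C with
        (Cexp (s * (0 + u * 1) - Cexp (0 + u * 1)) * (s - Cexp (0 + u * 1)) * 1)%C; [exact D|].
      replace (0 + u * 1)%C with (u : C) by ring. rewrite Cexp_RtoC.
      unfold gker. replace ((s + 1) * u - exp u)%C with (s * u - exp u + u)%C by ring.
      rewrite Cexp_plus, Cexp_RtoC. ring.
    + apply functional_extensionality; intros t. unfold gker.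
      replace (0 + t * 1)%C with (t : C) by ring. now rewrite Cexp_RtoC.
  - intros u _. apply Hd. }
rewrite (LI_minus _ _ _ _ _ _ HsK HK') in E.
rewrite (LI_mult _ _ _ s HK) in E. fold (GammaL s) in E. change (LI (gker (s + 1)%C)) with (GammaL (s + 1)%C) in E.
replace (GammaL (s + 1)%C) with (s * GammaL s - (s * GammaL s - GammaL (s + 1)))%C by ring.
rewrite E. ring.
Qed.

Lemma GammaL_1 : GammaL 1 = 1.
Proof.
assert (H1 : 0 < Re 1) by (unfold Re; simpl; lra).
destruct (gker_expdec 1 H1) as [K HK].
apply (LI_unique _ _ _ _ HK). intros e He.
destruct (exp_small 2 1 e Rlt_0_1 He) as [W0 [HW0 HW]].
exists W0. intros W HWW. specialize (HW W HWW).
replace (- (1) * W) with (- W) in HW by ring.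
set (F := fun u : R => RtoC (- exp (- exp u))).
rewrite (CInt_derive F).
- unfold F. rewrite <- !RtoC_minus, Cmod_R.
  assert (B1 : exp (- exp W) <= exp (- W)).
  { apply exp_le. pose proof (exp_ineq1_le W). lra. }
  assert (B2 : 1 - exp (- W) <= exp (- exp (- W))).
  { pose proof (exp_ineq1_le (- exp (- W))). lra. }
  assert (B3 : exp (- exp (- W)) <= 1).
  { rewrite <- exp_0. apply exp_le. pose proof (exp_pos (- W)). lra. }
  pose proof (exp_pos (- exp W)). apply Rabs_le. lra.
- lra.
- intros u _. replace (gker 1 u) with (RtoC (exp u * exp (- exp u))).
  + unfold F. apply is_derive_pair; unfold Re, Im; simpl.
    * auto_derive; [exact I|]. ring.
    * apply (is_derive_const (K := R_AbsRing) (V := R_NormedModule)).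
  + unfold gker. rewrite <- exp_plus, <- Cexp_RtoC. f_equal. rewrite RtoC_plus, RtoC_opp. ring.
- intros u _. apply gker_cont.
Qed.

(** Once exp(- e^u) is separated from e^(u s), this is differentiation under the integral sign. *)
Lemma GammaL_Cdiff (s : C) : 0 < Re s -> Cdiff GammaL s.
Proof.
intros Hs. destruct (gker_expdec s Hs) as [K HK].
assert (E : forall s u, gker s u = (RtoC (exp (- exp u)) * Cexp (u * s))%C).
{ intros s' u. rewrite <- Cexp_RtoC, <- Cexp_plus. unfold gker. f_equal. rewrite RtoC_opp. ring. }
apply (Cdiff_ext (fun s => LI (fun u => RtoC (exp (- exp u)) * Cexp (u * s))%C)).
{ intros w. apply LI_ext. intros u. symmetry. apply E. }
destruct (Cder_LI_exp (fun u => RtoC (exp (- exp u))) (fun u => RtoC u) 1 K (Re s) s) as [H _].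
- intros u. apply continuous_RtoC, continuous_Rexp, continuous_Ropp, continuous_Rexp, continuous_id.
- intros u. apply continuous_RtoC, continuous_id.
- lra.
- intros w. rewrite Cmod_R. lra.
- replace (fun u => (RtoC (exp (- exp u)) * Cexp (u * s))%C) with (gker s); [exact HK|].
  apply functional_extensionality; intros u; apply E.
- eexists; exact H.
Qed.

Lemma cos_ge_cos_of_le (v theta : R) : Rabs v <= theta -> theta < PI / 2 -> cos theta <= cos v.
Proof.
intros Hv Ht. pose proof (Rabs_pos v). pose proof PI_RGT_0.
replace (cos v) with (cos (Rabs v)).
- apply cos_decr_1; lra.
- unfold Rabs. destruct (Rcase_abs v); [apply cos_neg|reflexivity].
Qed.

(* The contour of Euler's integral is rotated by the angle [- theta] or [theta]
   according to the sign of [Im s]; with t = e^u a rotation is a translation of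
   the u-line. *)
Lemma GammaL_decay (c1 c2 theta : R) : 0 < c1 <= c2 -> 0 <= theta < PI / 2 ->
  exists K, 0 < K /\ forall s, c1 <= Re s <= c2 -> Cmod (GammaL s) <= K * exp (- theta * Rabs (Im s)).
Proof.
intros Hc Ht.
assert (Hcos : 0 < cos theta) by (apply cos_gt_0; lra).
destruct (gker_bound c1 c2 (cos theta) Hc Hcos) as [K [HKpos HK]].
exists (2 * K / c1). split; [apply Rdiv_lt_0_compat; lra|].
intros s Hs.
(* With z = v + i y the variable is u = - i z = y - i v, so moving the line Re z = 0 to Re z = v
   rotates t = e^u by the angle - v. There Re e^u = cos v e^y stays positive and e^(s u) gains the
   factor exp(v Im s), whence the choice of the sign of v. *)
set (F := fun z => Cexp (s * (- Ci * z) - Cexp (- Ci * z))%C).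
assert (HFd : forall z, Cdiff F z).
{ intros z. apply (Cdiff_comp (fun z => - Ci * z)%C (fun w => Cexp (s * w - Cexp w))%C).
  - apply Cdiff_mult; [apply Cdiff_const|apply Cdiff_id].
  - eexists; apply Cder_gexp. }
assert (Hmod : forall v y, Rabs v <= theta ->
  Cmod (F (pt v y)) <= exp (Im s * v) * (K * exp (- c1 * Rabs y))).
{ intros v y Hv. unfold F. rewrite Cmod_Cexp.
  replace (Re _) with (Im s * v + (Re s * y - cos v * exp y)).
  - rewrite exp_plus. apply Rmult_le_compat_l; [left; apply exp_pos|].
    eapply Rle_trans; [|apply (HK (Re s) y Hs)]. apply exp_le.
    pose proof (cos_ge_cos_of_le v theta Hv (proj2 Ht)).
    assert (cos theta * exp y <= cos v * exp y) by (apply Rmult_le_compat_r; [left; apply exp_pos|assumption]).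
    lra.
  - replace (- Ci * pt v y)%C with ((y, - v) : C) by (apply C_ext; unfold pt, Re, Im; simpl; ring).
    unfold Re, Im; simpl. rewrite cos_neg. ring. }
assert (H0 : GammaL s = LI (fun y => F (pt 0 y))).
{ apply LI_ext. intros u. unfold gker, F.
  replace (- Ci * pt 0 u)%C with (u : C) by (apply C_ext; unfold pt, Re, Im; simpl; ring).
  now rewrite Cexp_RtoC. }
assert (Hstrip : forall v y, Rabs v <= theta ->
  Cmod (F (pt v y)) <= exp (Rabs (Im s) * theta) * K * exp (- c1 * Rabs y)).
{ intros v y Hv. eapply Rle_trans; [now apply Hmod|]. rewrite Rmult_assoc.
  apply Rmult_le_compat_r; [apply Rmult_le_pos; [lra|left; apply exp_pos]|].
  apply exp_le. eapply Rle_trans; [apply Rle_abs|]. rewrite Rabs_mult.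
  apply Rmult_le_compat_l; [apply Rabs_pos|assumption]. }
assert (Hend : forall v, Rabs v <= theta -> Im s * v = - theta * Rabs (Im s) ->
  LI (fun y => F (pt 0 y)) = LI (fun y => F (pt v y)) ->
  Cmod (GammaL s) <= 2 * K / c1 * exp (- theta * Rabs (Im s))).
{ intros v Hv Hvs E. rewrite H0, E.
  eapply Rle_trans; [apply (LI_Cmod_le _ (exp (Im s * v) * K) c1)|].
  - apply vert_expdec; [lra| |].
    + intros y. apply Cdiff_Ccts, HFd.
    + intros y. rewrite Rmult_assoc. now apply Hmod.
  - rewrite Hvs. right; field; lra. }
destruct (Rle_or_lt 0 (Im s)) as [Hi|Hi].
- apply (Hend (- theta)).
  + rewrite Rabs_Ropp, Rabs_pos_eq; lra.
  + rewrite Rabs_pos_eq by assumption. ring.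
  + apply (LI_shift F (- theta) 0 (exp (Rabs (Im s) * theta) * K) c1); try lra; try (intros; apply HFd).
    intros x y Hx. apply Hstrip. rewrite Rabs_left1; lra.
- apply (Hend theta).
  + rewrite Rabs_pos_eq; lra.
  + rewrite Rabs_left by assumption. ring.
  + symmetry. apply (LI_shift F 0 theta (exp (Rabs (Im s) * theta) * K) c1); try lra; try (intros; apply HFd).
    intros x y Hx. apply Hstrip. rewrite Rabs_pos_eq; lra.
Qed.

(** * The Mellin-Barnes integral *)

Definition growth (phi : C -> C) (delta C0 P B : R) : Prop :=
  (forall s, - delta <= Re s -> Cdiff phi s) /\
  (forall s, - delta <= Re s -> Cmod (phi s) <= C0 * exp (P * Re s + B * Rabs (Im s))).

(* The rate [theta_of B] of decay used for Gamma lies strictly between [B] and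
   [PI / 2]; [eta_of B] is half of the margin it leaves over [B]. *)
Definition theta_of (B : R) : R := (Rmax 0 B + PI / 2) / 2.

Definition eta_of (B : R) : R := (theta_of B - B) / 2.

Lemma theta_of_range (B : R) : B < PI / 2 -> 0 <= theta_of B < PI / 2 /\ 0 < eta_of B.
Proof.
intros HB. pose proof PI_RGT_0. unfold eta_of, theta_of.
pose proof (Rmax_l 0 B); pose proof (Rmax_r 0 B).
assert (Rmax 0 B < PI / 2) by (apply Rmax_lub_lt; lra). lra.
Qed.

Lemma growth_C0_pos (phi : C -> C) (delta C0 P B : R) : 0 <= delta ->
  growth phi delta C0 P B -> 0 <= C0.
Proof.
intros Hd [_ H]. specialize (H 0). unfold Re, Im in H; simpl in H. specialize (H ltac:(lra)).
rewrite Rmult_0_r, Rabs_R0, Rmult_0_r, Rplus_0_l, exp_0, Rmult_1_r in H.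
eapply Rle_trans; [apply Cmod_ge_0|exact H].
Qed.

(** The product (s + 1) ... (s + m), which is the Pochhammer symbol at s + 1. *)
Fixpoint rise (m : nat) (s : C) : C :=
  match m with
  | O => 1
  | S k => (rise k s * (s + RtoC (INR (S k))))%C
  end.

Lemma rise_shift (m : nat) (s : C) : ((s + 1) * rise m (s + 1))%C = rise (S m) s.
Proof.
induction m as [|m IH].
- simpl. ring.
- change (rise (S m) (s + 1)%C) with (rise m (s + 1) * (s + 1 + RtoC (INR (S m))))%C.
  replace ((s + 1) * (rise m (s + 1) * (s + 1 + INR (S m))))%C
    with ((s + 1) * rise m (s + 1) * (s + 1 + INR (S m)))%C by ring.
  rewrite IH. change (rise (S (S m)) s) with (rise (S m) s * (s + RtoC (INR (S (S m)))))%C.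
  rewrite (S_INR (S m)), RtoC_plus. ring.
Qed.

Lemma rise_0 (m : nat) : rise m 0 = INR (fact m).
Proof.
induction m as [|m IH].
- reflexivity.
- change (rise (S m) 0) with (rise m 0 * (0 + RtoC (INR (S m))))%C. rewrite IH.
  change (fact (S m)) with (S m * fact m)%nat. rewrite mult_INR, RtoC_mult. ring.
Qed.

(** Each factor satisfies |s + k| >= k - delta >= (1 - delta) k. *)
Lemma Cmod_rise_ge (delta : R) (m : nat) (s : C) : 0 <= delta < 1 -> - delta <= Re s ->
  (1 - delta) ^ m * INR (fact m) <= Cmod (rise m s).
Proof.
intros Hd Hs. induction m as [|m IH].
- simpl. rewrite Cmod_1. lra.
- change (rise (S m) s) with (rise m s * (s + RtoC (INR (S m))))%C.
  rewrite Cmod_mult. change (fact (S m)) with (S m * fact m)%nat. rewrite mult_INR.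
  replace ((1 - delta) ^ S m * (INR (S m) * INR (fact m))) with
    ((1 - delta) ^ m * INR (fact m) * ((1 - delta) * INR (S m))) by (simpl pow; ring).
  apply Rmult_le_compat.
  + apply Rmult_le_pos; [apply pow_le; lra|apply pos_INR].
  + apply Rmult_le_pos; [lra|apply pos_INR].
  + exact IH.
  + eapply Rle_trans; [|apply re_le_Cmod].
    replace (Re (s + INR (S m))%C) with (Re s + INR (S m)) by (unfold Re; reflexivity).
    eapply Rle_trans; [|apply Rle_abs].
    rewrite S_INR. pose proof (pos_INR m).
    assert (0 <= delta * INR m) by (apply Rmult_le_pos; lra). lra.
Qed.

Lemma Cdiff_rise (m : nat) (z : C) : Cdiff (rise m) z.
Proof.
induction m as [|m IH].
- apply Cdiff_const.
- apply (Cdiff_mult (rise m)); [exact IH|]. apply Cdiff_plus; [apply Cdiff_id|apply Cdiff_const].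
Qed.

(** By the functional equation [hfun phi zeta m s / s] is, up to the sign (-1)^(m + 1), the
    integrand phi(s') Gamma(- s') e^(s' zeta) at s' = s + m. Its pole at s' = m is moved to 0 and
    divided out, and Gamma is evaluated at 1 - s, to the right of 0 on the strip. *)
Definition hfun (phi : C -> C) (zeta : C) (m : nat) (s : C) : C :=
  (phi (s + INR m) * GammaL (1 - s) * Cexp ((s + INR m) * zeta) / rise m s)%C.

Definition barnes_ker (phi : C -> C) (delta : R) (zeta : C) (y : R) : C :=
  (phi (pt (- delta) y) * GammaL (- pt (- delta) y) * Cexp (pt (- delta) y * zeta))%C.

Definition barnes (phi : C -> C) (delta : R) (zeta : C) : C :=
  (/ (2 * PI) * LI (barnes_ker phi delta zeta))%C.

Lemma Re_plus_INR (s : C) (m : nat) : Re (s + INR m)%C = Re s + INR m.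
Proof. reflexivity. Qed.

Lemma Im_plus_INR (s : C) (m : nat) : Im (s + INR m)%C = Im s.
Proof. unfold Im; simpl; ring. Qed.

Lemma Re_one_minus (s : C) : Re (1 - s)%C = 1 - Re s.
Proof. unfold Re; simpl; ring. Qed.

Lemma Re_Cmult (z w : C) : Re (z * w)%C = Re z * Re w - Im z * Im w.
Proof. reflexivity. Qed.

Lemma hfun_Cdiff (phi : C -> C) (delta C0 P B : R) (zeta : C) (m : nat) (s : C) :
  0 < delta < 1 -> growth phi delta C0 P B -> - delta <= Re s <= 1 - delta ->
  Cdiff (hfun phi zeta m) s.
Proof.
intros Hd [Hg _] Hs.
assert (Hsm : Cdiff (fun s => s + INR m)%C s) by (apply Cdiff_plus; [apply Cdiff_id|apply Cdiff_const]).
apply Cdiff_div.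
- apply Cdiff_mult; [apply Cdiff_mult|].
  + apply (Cdiff_comp (fun s => s + INR m)%C phi); [assumption|].
    apply Hg. rewrite Re_plus_INR. pose proof (pos_INR m). lra.
  + apply (Cdiff_comp (fun s => 1 - s)%C GammaL).
    * apply Cdiff_minus; [apply Cdiff_const|apply Cdiff_id].
    * apply GammaL_Cdiff. rewrite Re_one_minus. lra.
  + apply Cdiff_Cexp, Cdiff_mult; [assumption|apply Cdiff_const].
- apply Cdiff_rise.
- apply Cmod_gt_0. eapply Rlt_le_trans; [|apply (Cmod_rise_ge delta); lra].
  apply Rmult_lt_0_compat; [apply pow_lt; lra|apply INR_fact_lt_0].
Qed.

Lemma Rabs_neg_mult_le (x y b : R) : Rabs y <= b -> - (x * y) <= b * Rabs x.
Proof.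
intros H. eapply Rle_trans; [apply Rle_abs|]. rewrite Rabs_Ropp, Rabs_mult, Rmult_comm.
apply Rmult_le_compat_r; [apply Rabs_pos|assumption].
Qed.

Lemma Rabs_mult_le_1 (x y : R) : Rabs x <= 1 -> x * y <= Rabs y.
Proof.
intros H. eapply Rle_trans; [apply Rle_abs|]. rewrite Rabs_mult.
rewrite <- (Rmult_1_l (Rabs y)) at 2. apply Rmult_le_compat_r; [apply Rabs_pos|assumption].
Qed.

(** The factorial coming from [rise] beats the geometric growth of [phi (s + m)], which makes the
    remainders of the Taylor series tend to 0. Of the available rate [2 * eta_of B] one half is
    spent on Im zeta. *)
Lemma hfun_bound (phi : C -> C) (delta C0 P B : R) (zeta : C) :
  0 < delta < 1 -> B < PI / 2 -> growth phi delta C0 P B -> Rabs (Im zeta) <= eta_of B ->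
  exists A E, 0 <= A /\ 0 < E /\ forall m x y, - delta <= x <= 1 - delta ->
    Cmod (hfun phi zeta m (pt x y)) <= A * (E ^ m / INR (fact m)) * exp (- eta_of B * Rabs y).
Proof.
intros Hd HB Hg Hz. pose proof (growth_C0_pos phi delta C0 P B ltac:(lra) Hg) as HC0.
destruct (theta_of_range B HB) as [Ht Heta].
destruct (GammaL_decay delta (1 + delta) (theta_of B) ltac:(lra) Ht) as [K [HK HKb]].
(* The translation by [m] produces exp(m (P + Re zeta)); what depends on [x] is absorbed in the
   first constant because |x| <= 1. *)
exists (C0 * K * exp (Rabs P + Rabs (Re zeta))), (exp (P + Re zeta) / (1 - delta)).
split; [apply Rmult_le_pos; [apply Rmult_le_pos; lra|left; apply exp_pos]|].
split; [apply Rdiv_lt_0_compat; [apply exp_pos|lra]|].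
intros m x y Hx.
assert (Hx1 : Rabs x <= 1) by (apply Rabs_le; lra).
assert (HR : (1 - delta) ^ m * INR (fact m) <= Cmod (rise m (pt x y))).
{ apply Cmod_rise_ge; [lra|]. rewrite Re_pt; lra. }
assert (Hpow : 0 < (1 - delta) ^ m) by (apply pow_lt; lra).
pose proof (INR_fact_lt_0 m) as Hfact.
assert (HR0 : 0 < (1 - delta) ^ m * INR (fact m)) by now apply Rmult_lt_0_compat.
unfold hfun. rewrite Cmod_div by (apply Cmod_gt_0; lra). rewrite !Cmod_mult.
pose proof (proj2 Hg (pt x y + INR m)%C) as B1.
rewrite Re_plus_INR, Im_plus_INR, Re_pt, Im_pt in B1. pose proof (pos_INR m) as Hm. specialize (B1 ltac:(lra)).
pose proof (HKb (1 - pt x y)%C) as B2. rewrite Re_one_minus, Re_pt in B2. specialize (B2 ltac:(lra)).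
replace (Rabs (Im (1 - pt x y)%C)) with (Rabs y) in B2.
2:{ replace (Im (1 - pt x y)%C) with (- y) by (unfold pt, Im; simpl; ring). now rewrite Rabs_Ropp. }
rewrite Cmod_Cexp, Re_Cmult, Re_plus_INR, Im_plus_INR, Re_pt, Im_pt.
apply Rle_trans with (C0 * exp (P * (x + INR m) + B * Rabs y) * (K * exp (- theta_of B * Rabs y))
  * exp ((x + INR m) * Re zeta - y * Im zeta) / ((1 - delta) ^ m * INR (fact m))).
{ apply Rmult_le_compat.
  - apply Rmult_le_pos; [apply Rmult_le_pos; apply Cmod_ge_0|left; apply exp_pos].
  - left; apply Rinv_0_lt_compat; lra.
  - apply Rmult_le_compat_r; [left; apply exp_pos|].
    apply Rmult_le_compat; try apply Cmod_ge_0; assumption.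
  - apply Rinv_le_contravar; lra. }
replace (C0 * exp (P * (x + INR m) + B * Rabs y) * (K * exp (- theta_of B * Rabs y))
  * exp ((x + INR m) * Re zeta - y * Im zeta) / ((1 - delta) ^ m * INR (fact m))) with
  (C0 * K / ((1 - delta) ^ m * INR (fact m)) * (exp (P * (x + INR m) + B * Rabs y) * exp (- theta_of B * Rabs y)
  * exp ((x + INR m) * Re zeta - y * Im zeta))) by (field; lra).
assert (HE : (exp (P + Re zeta) / (1 - delta)) ^ m = exp (INR m * (P + Re zeta)) / (1 - delta) ^ m).
{ unfold Rdiv. rewrite Rpow_mult_distr, pow_inv, <- Rpower_pow by apply exp_pos.
  unfold Rpower. now rewrite ln_exp. }
rewrite HE.
replace (C0 * K * exp (Rabs P + Rabs (Re zeta)) * (exp (INR m * (P + Re zeta)) / (1 - delta) ^ m / INR (fact m))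
  * exp (- eta_of B * Rabs y)) with
  (C0 * K / ((1 - delta) ^ m * INR (fact m)) * (exp (Rabs P + Rabs (Re zeta)) * exp (INR m * (P + Re zeta))
   * exp (- eta_of B * Rabs y))) by (field; lra).
apply Rmult_le_compat_l; [apply Rdiv_le_0_compat; [apply Rmult_le_pos; lra|assumption]|].
rewrite <- !exp_plus. apply exp_le.
pose proof (Rabs_mult_le_1 x P Hx1). pose proof (Rabs_mult_le_1 x (Re zeta) Hx1).
pose proof (Rabs_neg_mult_le y (Im zeta) (eta_of B) Hz).
assert (Hth : theta_of B = B + 2 * eta_of B) by (unfold eta_of; field). rewrite Hth.
replace (P * (x + INR m) + B * Rabs y + - (B + 2 * eta_of B) * Rabs y + ((x + INR m) * Re zeta - y * Im zeta))
  with (x * P + x * Re zeta + INR m * (P + Re zeta) + (- (y * Im zeta)) - 2 * (eta_of B * Rabs y)) by ring.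
lra.
Qed.

Lemma pow_over_fact_small (E e : R) : 0 < E -> 0 < e ->
  exists N, forall n, (N <= n)%nat -> E ^ n / INR (fact n) <= e.
Proof.
intros HE He.
destruct (cv_speed_pow_fact E e He) as [N HN].
exists N. intros n Hn. specialize (HN n Hn). unfold Rdist in HN.
rewrite Rminus_0_r in HN. apply Rabs_def2 in HN. lra.
Qed.

Lemma pt_neg_shift (delta y : R) : (pt (1 - delta) y = pt (- delta) y + 1)%C.
Proof. unfold pt. rewrite RtoC_minus, RtoC_opp. ring. Qed.

Lemma pt_neg_nz (delta y : R) : 0 < delta -> pt (- delta) y <> 0.
Proof. intros Hd E. apply (f_equal Re) in E. rewrite Re_pt in E. unfold Re in E; simpl in E. lra. Qed.

(** The right edge of the strip for [m] is the left edge of the strip for [m + 1]; the sign comes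
    from one more use of the functional equation. *)
Lemma hfun_shift (phi : C -> C) (zeta : C) (m : nat) (s : C) :
  - 1 < Re s < 0 -> (hfun phi zeta m (s + 1) / (s + 1))%C = (- (hfun phi zeta (S m) s / s))%C.
Proof.
intros Hs.
assert (Hs0 : s <> 0) by (intros E; rewrite E in Hs; unfold Re in Hs; simpl in Hs; lra).
assert (Hs1 : (s + 1)%C <> 0).
{ intros E. apply (f_equal Re) in E. unfold Re in *; simpl in E. lra. }
assert (HR1 : rise m (s + 1)%C <> 0).
{ apply Cmod_gt_0. eapply Rlt_le_trans; [|apply (Cmod_rise_ge 0); [lra|unfold Re in *; simpl; lra]].
  rewrite Rminus_0_r, pow1, Rmult_1_l. apply INR_fact_lt_0. }
unfold hfun. rewrite <- rise_shift.
replace (s + 1 + INR m)%C with (s + INR (S m))%C by (rewrite S_INR, RtoC_plus; ring).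
replace (1 - (s + 1))%C with (- s)%C by ring.
replace (1 - s)%C with (- s + 1)%C by ring.
rewrite (GammaL_succ (- s)%C) by (unfold Re in *; simpl; lra).
field. repeat split; assumption.
Qed.

Lemma hfun_0 (phi : C -> C) (zeta : C) (m : nat) :
  hfun phi zeta m 0 = (phi (INR m) * Cexp (INR m * zeta) / INR (fact m))%C.
Proof.
unfold hfun. rewrite rise_0, Cplus_0_l. replace (1 - 0)%C with (1 : C) by ring. rewrite GammaL_1.
unfold Cdiv. ring.
Qed.

Lemma hfun_over_expdec (phi : C -> C) (delta C0 P B : R) (zeta : C) (m : nat) (M : R) :
  0 < delta < 1 -> B < PI / 2 -> growth phi delta C0 P B ->
  (forall y, Cmod (hfun phi zeta m (pt (- delta) y)) <= M * exp (- eta_of B * Rabs y)) ->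
  expdec (fun y => hfun phi zeta m (pt (- delta) y) / pt (- delta) y)%C (M / delta) (eta_of B).
Proof.
intros Hd HB Hg Hb. destruct (theta_of_range B HB) as [_ Heta].
repeat split; [|assumption|].
- intros y. apply (Ccts_pt_v (fun s => hfun phi zeta m s / s)%C).
  apply Cdiff_Ccts, Cdiff_div; [|apply Cdiff_id|apply pt_neg_nz; lra].
  apply (hfun_Cdiff phi delta C0 P B); try assumption. rewrite Re_pt; lra.
- intros y. rewrite Cmod_div by (apply pt_neg_nz; lra).
  replace (M / delta * exp (- eta_of B * Rabs y)) with (M * exp (- eta_of B * Rabs y) / delta) by (field; lra).
  assert (delta <= Cmod (pt (- delta) y)).
  { pose proof (re_le_Cmod (pt (- delta) y)) as H. rewrite Re_pt, Rabs_Ropp, Rabs_pos_eq in H; lra. }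
  apply Rmult_le_compat; [apply Cmod_ge_0| |apply Hb|apply Rinv_le_contravar; lra].
  left; apply Rinv_0_lt_compat; lra.
Qed.

(* Moving the contour Re s = - delta to the right across 0, 1, ..., N picks up
   the terms of the Taylor series of [g]. *)
Lemma barnes_partial_sum (phi : C -> C) (delta C0 P B : R) (zeta : C) :
  0 < delta < 1 -> B < PI / 2 -> growth phi delta C0 P B -> Rabs (Im zeta) <= eta_of B ->
  forall e, 0 < e -> exists N, forall n, (N <= n)%nat ->
    Cmod (sum_n (fun m => (RtoC ((-1) ^ m) * hfun phi zeta m 0)%C) n - barnes phi delta zeta)%C <= e.
Proof.
intros Hd HB Hg Hz.
destruct (theta_of_range B HB) as [Ht Heta].
destruct (hfun_bound phi delta C0 P B zeta Hd HB Hg Hz) as (A & E & HA & HE & Hb).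
assert (Hexp : forall m, expdec (fun y => hfun phi zeta m (pt (- delta) y) / pt (- delta) y)%C
  (A * (E ^ m / INR (fact m)) / delta) (eta_of B)).
{ intros m. apply (hfun_over_expdec phi delta C0 P B); try assumption. intros y. apply Hb; lra. }
set (U := fun m => LI (fun y => hfun phi zeta m (pt (- delta) y) / pt (- delta) y)%C).
(* The residue at 0 in the strip number [m], its right edge being rewritten as the left edge of the
   next strip. *)
assert (HU : forall m, (U m + U (S m))%C = (- (2 * PI * hfun phi zeta m 0))%C).
{ intros m.
  pose proof (LI_residue (hfun phi zeta m) (- delta) (1 - delta) _ (eta_of B) ltac:(lra) Heta
    (fun z Hz => hfun_Cdiff phi delta C0 P B zeta m z Hd Hg Hz) (fun x y Hx => Hb m x y Hx)) as HR.
  fold (U m) in HR.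
  replace (LI (fun y => hfun phi zeta m (pt (1 - delta) y) / pt (1 - delta) y)%C) with (- U (S m))%C in HR.
  - rewrite <- HR. ring.
  - unfold U. replace (- LI (fun y => hfun phi zeta (S m) (pt (- delta) y) / pt (- delta) y))%C with
      (- (1) * LI (fun y => hfun phi zeta (S m) (pt (- delta) y) / pt (- delta) y))%C by ring.
    rewrite <- (LI_mult _ _ _ (- (1))%C (Hexp (S m))).
    apply LI_ext. intros y. rewrite pt_neg_shift, hfun_shift by (rewrite Re_pt; lra). ring. }
(* The sign is that of Gamma(1 - s) / s = - Gamma(- s). *)
assert (HU0 : U O = (- (2 * PI * barnes phi delta zeta))%C).
{ unfold barnes.
  assert (Hpi : RtoC PI <> 0) by (intros E0; apply RtoC_inj in E0; pose proof PI_RGT_0; lra).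
  replace (- (2 * PI * (/ (2 * PI) * LI (barnes_ker phi delta zeta))))%C with
    (- (1) * LI (barnes_ker phi delta zeta))%C by (field; exact Hpi).
  assert (Hker : forall y, (hfun phi zeta 0 (pt (- delta) y) / pt (- delta) y)%C = (- (1) * barnes_ker phi delta zeta y)%C).
  { intros y. unfold hfun, barnes_ker. simpl rise. simpl INR.
    replace (1 - pt (- delta) y)%C with (- pt (- delta) y + 1)%C by ring.
    rewrite GammaL_succ by (replace (Re (- pt (- delta) y)%C) with delta by (unfold pt, Re; simpl; ring); lra).
    rewrite !Cplus_0_r. field. apply pt_neg_nz; lra. }
  unfold U.
  replace (LI (barnes_ker phi delta zeta)) with
    (- (1) * LI (fun y => (hfun phi zeta 0 (pt (- delta) y) / pt (- delta) y)%C))%C.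
  - ring.
  - rewrite <- (LI_mult _ _ _ (- (1))%C (Hexp O)). apply LI_ext. intros y. rewrite Hker. ring. }
assert (HUb : forall m, Cmod (U m) <= 2 * (A / delta) / eta_of B * (E ^ m / INR (fact m))).
{ intros m. pose proof (INR_fact_lt_0 m).
  eapply Rle_trans; [apply (LI_Cmod_le _ _ _ (Hexp m))|]. right. field. repeat split; lra. }
(* The relations [HU] with alternating signs telescope; the remainder is the last integral
   [U (S n)], already bounded by a power over a factorial. *)
assert (Hsum : forall n, (2 * PI * (sum_n (fun m => (RtoC ((-1) ^ m) * hfun phi zeta m 0)%C) n
   - barnes phi delta zeta))%C = (RtoC ((-1) ^ n) * (- U (S n)))%C).
{ induction n as [|n IH].
  - rewrite sum_O. specialize (HU O). simpl pow.
    replace (2 * PI * (1 * hfun phi zeta 0 0 - barnes phi delta zeta))%C with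
      (- (- (2 * PI * hfun phi zeta 0 0)) + - (2 * PI * barnes phi delta zeta))%C by ring.
    rewrite <- HU, <- HU0. ring.
  - rewrite sum_Sn.
    match goal with |- context [plus ?u ?v] => change (plus u v) with (Cplus u v) end.
    match goal with |- context [Cplus (sum_n ?a n) ?v] => set (s := sum_n a n) in *; set (t := v) end.
    replace (2 * PI * (s + t - barnes phi delta zeta))%C with
      (2 * PI * (s - barnes phi delta zeta) + 2 * PI * t)%C by ring.
    unfold t.
    rewrite IH. specialize (HU (S n)).
    replace ((-1) ^ S n) with (- (-1) ^ n) by (simpl; ring). rewrite RtoC_opp.
    replace (2 * PI * (- RtoC ((-1) ^ n) * hfun phi zeta (S n) 0))%C with
      (RtoC ((-1) ^ n) * (- (2 * PI * hfun phi zeta (S n) 0)))%C by ring.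
    rewrite <- HU. ring. }
intros e He.
set (M := 2 * (A / delta) / eta_of B).
assert (HM : 0 <= M).
{ unfold M. apply Rdiv_le_0_compat; [|assumption]. apply Rmult_le_pos; [lra|]. apply Rdiv_le_0_compat; lra. }
destruct (pow_over_fact_small E (e / (M + 1)) HE) as [N HN]; [apply Rdiv_lt_0_compat; lra|].
exists N. intros n Hn.
set (D := (sum_n (fun m => (RtoC ((-1) ^ m) * hfun phi zeta m 0)%C) n - barnes phi delta zeta)%C) in *.
specialize (Hsum n). apply (f_equal Cmod) in Hsum. fold D in Hsum.
rewrite !Cmod_mult, Cmod_opp in Hsum.
rewrite (Cmod_R ((-1) ^ n)), pow_1_abs, Rmult_1_l, !Cmod_RtoC_nonneg in Hsum by (pose proof PI_RGT_0; lra).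
specialize (HUb (S n)). fold M in HUb. specialize (HN (S n) ltac:(lia)).
assert (M * (E ^ S n / INR (fact (S n))) <= e).
{ apply Rle_trans with ((M + 1) * (e / (M + 1))); [|right; field; lra].
  apply Rmult_le_compat; try lra. apply Rdiv_le_0_compat; [apply pow_le; lra|apply INR_fact_lt_0]. }
pose proof PI2_1. pose proof (Cmod_ge_0 D).
assert (1 * Cmod D <= 2 * PI * Cmod D) by (apply Rmult_le_compat_r; lra).
lra.
Qed.

(** * Holomorphy of the Mellin-Barnes integral in zeta and its equality with [g] *)

Definition barnes_coef (phi : C -> C) (delta y : R) : C :=
  (phi (pt (- delta) y) * GammaL (- pt (- delta) y))%C.

Lemma barnes_coef_bound (phi : C -> C) (delta C0 P B : R) :
  0 < delta < 1 -> B < PI / 2 -> growth phi delta C0 P B ->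
  exists K, 0 <= K /\ ccont (barnes_coef phi delta) /\
    forall y, Cmod (barnes_coef phi delta y) <= K * exp (- (2 * eta_of B) * Rabs y).
Proof.
intros Hd HB Hg. pose proof (growth_C0_pos phi delta C0 P B ltac:(lra) Hg) as HC0.
destruct (theta_of_range B HB) as [Ht Heta].
destruct (GammaL_decay delta (1 + delta) (theta_of B) ltac:(lra) Ht) as [K [HK HKb]].
exists (C0 * exp (P * - delta) * K). split; [|split].
- apply Rmult_le_pos; [apply Rmult_le_pos; [assumption|left; apply exp_pos]|lra].
- intros y. apply (Ccts_pt_v (fun s => phi s * GammaL (- s))%C). apply Cdiff_Ccts, Cdiff_mult.
  + apply (proj1 Hg). rewrite Re_pt; lra.
  + apply (Cdiff_comp (fun s => - s)%C GammaL); [apply Cdiff_opp, Cdiff_id|].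
    apply GammaL_Cdiff. replace (Re (- pt (- delta) y)%C) with delta by (unfold pt, Re; simpl; ring). lra.
- intros y. unfold barnes_coef. rewrite Cmod_mult.
  pose proof (proj2 Hg (pt (- delta) y)) as B1. rewrite Re_pt, Im_pt in B1. specialize (B1 ltac:(lra)).
  pose proof (HKb (- pt (- delta) y)%C) as B2.
  replace (Re (- pt (- delta) y)%C) with delta in B2 by (unfold pt, Re; simpl; ring).
  replace (Im (- pt (- delta) y)%C) with (- y) in B2 by (unfold pt, Im; simpl; ring).
  rewrite Rabs_Ropp in B2. specialize (B2 ltac:(lra)).
  apply Rle_trans with (C0 * exp (P * - delta + B * Rabs y) * (K * exp (- theta_of B * Rabs y))).
  + apply Rmult_le_compat; try apply Cmod_ge_0; assumption.
  + rewrite exp_plus.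
    replace (C0 * (exp (P * - delta) * exp (B * Rabs y)) * (K * exp (- theta_of B * Rabs y))) with
      (C0 * exp (P * - delta) * K * (exp (B * Rabs y) * exp (- theta_of B * Rabs y))) by ring.
    rewrite <- exp_plus. right. f_equal. f_equal. unfold eta_of. field.
Qed.

(** The factor exp(- delta Re zeta) records the size x^(- delta) of the integral, on which the
    boundary terms of the integration by parts depend. *)
Lemma barnes_ker_expdec (phi : C -> C) (delta C0 P B : R) :
  0 < delta < 1 -> B < PI / 2 -> growth phi delta C0 P B ->
  exists K, 0 <= K /\ forall zeta, Rabs (Im zeta) <= eta_of B ->
    expdec (barnes_ker phi delta zeta) (K * exp (- delta * Re zeta)) (eta_of B).
Proof.
intros Hd HB Hg. destruct (theta_of_range B HB) as [_ Heta].
destruct (barnes_coef_bound phi delta C0 P B Hd HB Hg) as (K & HK & Hc & Hb).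
exists K. split; [assumption|]. intros zeta Hz.
repeat split; [|assumption|].
- intros y. apply continuous_Cmult; [apply Hc|].
  apply continuous_Cexp, continuous_Cmult; [|apply continuous_const].
  apply continuous_pt; [apply continuous_const|apply continuous_id].
- intros y. unfold barnes_ker. fold (barnes_coef phi delta y).
  rewrite Cmod_mult, Cmod_Cexp, Re_Cmult, Re_pt, Im_pt.
  apply Rle_trans with (K * exp (- (2 * eta_of B) * Rabs y) * exp (- delta * Re zeta - y * Im zeta)).
  + apply Rmult_le_compat_r; [left; apply exp_pos|apply Hb].
  + rewrite !Rmult_assoc. apply Rmult_le_compat_l; [assumption|]. rewrite <- !exp_plus. apply exp_le.
    pose proof (Rabs_neg_mult_le y (Im zeta) (eta_of B) Hz). lra.
Qed.

Lemma barnes_Cder (phi : C -> C) (delta C0 P B : R) (zeta : C) :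
  0 < delta < 1 -> B < PI / 2 -> growth phi delta C0 P B -> Rabs (Im zeta) <= eta_of B ->
  Cder (barnes phi delta) zeta
    (/ (2 * PI) * LI (fun y => pt (- delta) y * barnes_ker phi delta zeta y))%C.
Proof.
intros Hd HB Hg Hz.
destruct (barnes_coef_bound phi delta C0 P B Hd HB Hg) as (_ & _ & Hc & _).
destruct (barnes_ker_expdec phi delta C0 P B Hd HB Hg) as (K & _ & Hb).
destruct (Cder_LI_exp (barnes_coef phi delta) (pt (- delta)) 1 (K * exp (- delta * Re zeta)) (eta_of B) zeta Hc)
  as [H _].
- intros y. apply continuous_pt; [apply continuous_const|apply continuous_id].
- lra.
- intros y. eapply Rle_trans; [apply Cmod_le_abs|]. rewrite Re_pt, Im_pt, Rabs_Ropp, Rabs_pos_eq; lra.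
- exact (Hb zeta Hz).
- pose proof (Cder_mult _ _ zeta _ _ (Cder_const (/ (2 * PI))%C zeta) H) as H1.
  unfold barnes, barnes_ker. fold (barnes_coef phi delta).
  match type of H1 with Cder _ _ ?l => match goal with |- Cder _ _ ?l' => replace l' with l; [exact H1|] end end.
  unfold barnes_coef. ring.
Qed.

Lemma Cexp_nat_mult (m : nat) (z : C) : Cexp (INR m * z)%C = (Cexp z ^ m)%C.
Proof.
induction m as [|m IH].
- simpl INR. rewrite Cmult_0_l, Cexp_0. reflexivity.
- rewrite S_INR, RtoC_plus.
  replace ((INR m + 1) * z)%C with (z + INR m * z)%C by ring. rewrite Cexp_plus, IH. reflexivity.
Qed.

Lemma series_term (z : C) (a : C) (m : nat) :
  scal (pow_n (K := C_Ring) (- Cexp z)%C m) (a : C_NormedModule) = (RtoC ((-1) ^ m) * (a * Cexp (INR m * z)))%C.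
Proof.
rewrite Cexp_nat_mult. change (scal (pow_n (K := C_Ring) (- Cexp z)%C m) (a : C_NormedModule)) with
  (pow_n (K := C_Ring) (- Cexp z)%C m * a)%C.
assert (E : pow_n (K := C_Ring) (- Cexp z)%C m = (RtoC ((-1) ^ m) * Cexp z ^ m)%C).
{ induction m as [|m IH]; simpl.
  - change one with (1 : C). ring.
  - rewrite IH. change mult with Cmult. rewrite RtoC_mult, RtoC_m1. ring. }
rewrite E. match goal with |- @eq _ ?u ?v => change (@eq C u v) end. ring.
Qed.

(** The Taylor partial sums at e^zeta are the sums of residues collected by the moving contour, so
    both values are limits of one sequence. *)
Lemma barnes_eq_near_0 (g phi : C -> C) (delta C0 P B : R) (zeta : C) :
  0 < delta < 1 -> B < PI / 2 -> growth phi delta C0 P B -> Rabs (Im zeta) <= eta_of B ->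
  (forall m : nat, phi (RtoC (INR m)) = gbar0 g m) ->
  is_pseries (K := C_AbsRing) (V := C_NormedModule)
    (fun m => (gbar0 g m / RtoC (INR (fact m)))%C) (- Cexp zeta)%C (g (Cexp zeta)) ->
  g (Cexp zeta) = barnes phi delta zeta.
Proof.
intros Hd HB Hg Hz Hm Hs.
apply C_eq_of_dist_le. intros e He.
destruct (barnes_partial_sum phi delta C0 P B zeta Hd HB Hg Hz (e / 2)) as [N HN]; [lra|].
assert (He4 : 0 < e / 4) by lra.
pose proof (proj1 (filterlim_locally (U := C_UniformSpace) _ (g (Cexp zeta))) Hs (mkposreal _ He4)) as [N' HN'].
specialize (HN (N + N')%nat ltac:(lia)). specialize (HN' (N + N')%nat ltac:(lia)).
apply C_ball_Cmod in HN'. simpl pos in HN'.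
rewrite (sum_n_ext _ (fun m => (RtoC ((-1) ^ m) * hfun phi zeta m 0)%C)) in HN'.
2:{ intros m. etransitivity; [apply series_term|]. rewrite hfun_0, Hm. unfold Cdiv.
    match goal with |- @eq _ ?u ?v => change (@eq C u v) end. ring. }
set (S := sum_n (fun m => (RtoC ((-1) ^ m) * hfun phi zeta m 0)%C) (N + N')) in *.
replace (g (Cexp zeta) - barnes phi delta zeta)%C with
  (- (S - g (Cexp zeta)) + (S - barnes phi delta zeta))%C by ring.
eapply Rle_trans; [apply Cmod_triangle|]. rewrite Cmod_opp. lra.
Qed.

Lemma Cmod_ball_C (l z : C) (e : R) : Cmod (z - l)%C < e -> ball (M := C_UniformSpace) l e z.
Proof. intros H. apply Cmod_Re_Im_lt in H. exact H. Qed.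

Lemma barnes_eq (g phi : C -> C) (delta C0 P B : R) :
  0 < delta < 1 -> B < PI / 2 -> growth phi delta C0 P B ->
  (forall m : nat, phi (RtoC (INR m)) = gbar0 g m) ->
  locally (T := C_UniformSpace) (RtoC 0)
    (fun z => is_pseries (K := C_AbsRing) (V := C_NormedModule)
                (fun m => (gbar0 g m / RtoC (INR (fact m)))%C) (- z)%C (g z)) ->
  (forall x : R, 0 < x -> locally (T := C_UniformSpace) (RtoC x)
    (fun w => ex_derive (K := C_AbsRing) (V := C_NormedModule) g w)) ->
  forall t : R, g (RtoC (exp t)) = barnes phi delta t.
Proof.
intros Hd HB Hg Hm [r Hr] Hreg t.
destruct (theta_of_range B HB) as [_ Heta].
(* The 1 subtracted leaves room for a disc of radius at most 1 around [t0] whose exponentials stay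
   in the disc of convergence. *)
set (t0 := Rmin t (ln r - 1)).
set (k := fun zeta => (g (Cexp zeta) - barnes phi delta zeta)%C).
assert (Him : forall (z : C) (x : R), Cmod (z - x)%C < eta_of B -> Rabs (Im z) <= eta_of B).
{ intros z x H. pose proof (Im_le_Cmod (z - x)%C) as H1.
  replace (Im (z - x)%C) with (Im z) in H1 by (unfold Im; simpl; ring). lra. }
assert (K0 : k t = 0).
{ apply (identity_half_line k t0 (Rmin 1 (eta_of B))).
  - apply Rmin_pos; lra.
  - intros x _. destruct (Hreg (exp x) (exp_pos x)) as [e He].
    destruct (Cder_continuous Cexp x _ (Cder_Cexp x) e (cond_pos e)) as [r1 [Hr1 Hc]].
    exists (Rmin r1 (eta_of B)). split; [now apply Rmin_pos|].
    intros z Hz. pose proof (Rmin_l r1 (eta_of B)); pose proof (Rmin_r r1 (eta_of B)).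
    apply Cdiff_minus.
    + apply (Cdiff_comp Cexp g); [eexists; apply Cder_Cexp|].
      apply ex_derive_Cdiff, He, Cmod_ball_C. rewrite <- Cexp_RtoC. apply Hc. lra.
    + eexists. apply (barnes_Cder phi delta C0 P B); try assumption. apply (Him z x); lra.
  - intros z Hz. unfold k.
    pose proof (Rmin_l 1 (eta_of B)); pose proof (Rmin_r 1 (eta_of B)).
    rewrite (barnes_eq_near_0 g phi delta C0 P B z); try assumption.
    + ring.
    + apply (Him z t0); lra.
    + apply Hr, Cmod_ball_C. replace (Cexp z - 0)%C with (Cexp z) by ring.
      rewrite Cmod_Cexp.
      assert (Hre : Re z < ln r).
      { pose proof (re_le_Cmod (z - t0)%C) as H1.
        replace (Re (z - t0)%C) with (Re z - t0) in H1 by (unfold Re; simpl; ring).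
        pose proof (Rle_abs (Re z - t0)). pose proof (Rmin_r t (ln r - 1)). fold t0 in H3. lra. }
      apply exp_increasing in Hre. rewrite exp_ln in Hre by apply cond_pos. exact Hre.
  - apply Rmin_l. }
unfold k in K0. rewrite Cexp_RtoC in K0. now apply Cminus_eq_0.
Qed.

(** * Bessel functions *)

Definition bessel_coef (k : nat) : R := (-1) ^ k / INR (fact k) ^ 2.

(** This is - J0' by the chain rule, J0 being the series F with coefficients [bessel_coef] at y = (x
    / 2)^2. *)
Definition bessel_J1 (x : R) : R := - (x / 2) * PSeries (PS_derive bessel_coef) ((x / 2) ^ 2).

Lemma bessel_J0_PSeries (x : R) : bessel_J0 x = PSeries bessel_coef ((x / 2) ^ 2).
Proof.
apply Series_ext. intros k. unfold bessel_coef. now rewrite pow_mult.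
Qed.

Lemma bessel_coef_succ (k : nat) : INR (S k) ^ 2 * bessel_coef (S k) = - bessel_coef k.
Proof.
unfold bessel_coef. change (fact (S k)) with (S k * fact k)%nat. rewrite mult_INR.
replace ((-1) ^ S k) with (- (-1) ^ k) by (simpl; ring). field.
split; [apply INR_fact_neq_0|apply not_0_INR; lia].
Qed.

Lemma bessel_coef_nz (k : nat) : bessel_coef k <> 0.
Proof.
apply Rmult_integral_contrapositive. split.
- apply pow_nonzero; lra.
- apply Rinv_neq_0_compat, pow_nonzero, INR_fact_neq_0.
Qed.

Lemma CV_radius_bessel : CV_radius bessel_coef = p_infty.
Proof.
apply CV_radius_infinite_DAlembert; [apply bessel_coef_nz|].
apply (is_lim_seq_le_le (fun _ => 0) _ (fun n => / INR (S n))).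
- intros n. split; [apply Rabs_pos|].
  pose proof (lt_0_INR (S n) ltac:(lia)) as Hn.
  pose proof (bessel_coef_succ n) as H.
  replace (bessel_coef (S n) / bessel_coef n) with (- / INR (S n) ^ 2).
  + rewrite Rabs_Ropp, Rabs_pos_eq by (left; apply Rinv_0_lt_compat, pow_lt; assumption).
    apply Rinv_le_contravar; [assumption|].
    assert (1 <= INR (S n)) by (rewrite S_INR; pose proof (pos_INR n); lra). nra.
  + replace (bessel_coef n) with (- (INR (S n) ^ 2 * bessel_coef (S n))) by lra.
    field. split; [apply bessel_coef_nz|lra].
- apply is_lim_seq_const.
- replace (Finite 0) with (Rbar_inv p_infty) by reflexivity.
  apply is_lim_seq_inv; [|discriminate].
  apply (is_lim_seq_incr_1 INR), is_lim_seq_INR.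
Qed.

(** Bessel's equation of order zero in the variable y = (x / 2)^2; on coefficients it is the
    recurrence [bessel_coef_succ]. *)
Lemma bessel_ode (y : R) :
  y * PSeries (PS_derive (PS_derive bessel_coef)) y + PSeries (PS_derive bessel_coef) y
  + PSeries bessel_coef y = 0.
Proof.
assert (H0 : Rbar_lt (Rabs y) (CV_radius bessel_coef)) by (rewrite CV_radius_bessel; exact I).
assert (H1 : Rbar_lt (Rabs y) (CV_radius (PS_derive bessel_coef))) by now rewrite CV_radius_derive.
assert (H2 : Rbar_lt (Rabs y) (CV_radius (PS_derive (PS_derive bessel_coef)))) by now rewrite !CV_radius_derive.
rewrite <- PSeries_incr_1.
rewrite <- PSeries_plus.
2:{ apply ex_pseries_incr_1. now apply CV_radius_inside. }
2:{ now apply CV_radius_inside. }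
rewrite <- PSeries_plus.
2:{ apply ex_pseries_plus; [apply ex_pseries_incr_1|]; now apply CV_radius_inside. }
2:{ now apply CV_radius_inside. }
rewrite (PSeries_ext _ (fun _ => 0)); [apply PSeries_const_0|].
intros n. unfold PS_plus, PS_incr_1, PS_derive.
pose proof (bessel_coef_succ n) as H.
destruct n as [|n]; cbv beta iota.
- change (0 + INR 1 * bessel_coef 1 + bessel_coef 0 = 0). simpl in *. lra.
- change (INR (S n) * (INR (S (S n)) * bessel_coef (S (S n))) + INR (S (S n)) * bessel_coef (S (S n)) + bessel_coef (S n) = 0).
  rewrite (S_INR (S n)) in *. set (v := INR (S n)) in *. nra.
Qed.

Lemma is_derive_bessel_PSeries (y : R) :
  is_derive (PSeries bessel_coef) y (PSeries (PS_derive bessel_coef) y).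
Proof. apply is_derive_PSeries. rewrite CV_radius_bessel. exact I. Qed.

Lemma is_derive_bessel_PSeries' (y : R) :
  is_derive (PSeries (PS_derive bessel_coef)) y (PSeries (PS_derive (PS_derive bessel_coef)) y).
Proof. apply is_derive_PSeries. rewrite CV_radius_derive, CV_radius_bessel. exact I. Qed.

Lemma is_derive_J0 (x : R) : is_derive bessel_J0 x (- bessel_J1 x).
Proof.
apply (is_derive_ext (fun x => PSeries bessel_coef ((x / 2) ^ 2))).
{ intros t. symmetry. apply bessel_J0_PSeries. }
assert (Hq : is_derive (fun x : R => (x / 2) ^ 2) x (x / 2)) by (auto_derive; [exact I|field]).
pose proof (is_derive_comp (K := R_AbsRing) (V := R_NormedModule) (PSeries bessel_coef) (fun x => (x / 2) ^ 2) x _ _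
  (is_derive_bessel_PSeries ((x / 2) ^ 2)) Hq) as H.
unfold scal in H; simpl in H; unfold mult in H; simpl in H.
unfold bessel_J1. simpl pow in *.
match type of H with is_derive _ _ ?l => match goal with |- is_derive _ _ ?l' => replace l' with l; [exact H|] end end.
ring.
Qed.

(** The familiar form is J1' = J0 - J1 / x; writing the last term through the series keeps the
    formula valid at 0. *)
Lemma is_derive_J1 (x : R) :
  is_derive bessel_J1 x (bessel_J0 x + PSeries (PS_derive bessel_coef) ((x / 2) ^ 2) / 2).
Proof.
assert (Hq : is_derive (fun x : R => (x / 2) ^ 2) x (x / 2)) by (auto_derive; [exact I|field]).
pose proof (is_derive_comp (K := R_AbsRing) (V := R_NormedModule) (PSeries (PS_derive bessel_coef)) (fun x => (x / 2) ^ 2) x _ _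
  (is_derive_bessel_PSeries' ((x / 2) ^ 2)) Hq) as H.
assert (Hl : is_derive (fun x : R => - (x / 2)) x (- (1 / 2))) by (auto_derive; [exact I|field]).
pose proof (is_derive_mult (K := R_AbsRing) _ _ x _ _ Hl H Rmult_comm) as H2.
pose proof (bessel_ode ((x / 2) ^ 2)) as Hode. rewrite bessel_J0_PSeries.
unfold bessel_J1.
match type of H2 with is_derive _ _ ?l => match goal with |- is_derive _ _ ?l' => replace l' with l; [exact H2|] end end.
unfold scal, plus, mult; simpl. unfold mult; simpl. simpl in Hode.
set (p0 := PSeries bessel_coef _) in *. set (p1 := PSeries (PS_derive bessel_coef) _) in *.
set (p2 := PSeries (PS_derive (PS_derive bessel_coef)) _) in *.
replace p0 with (- (x / 2 * (x / 2 * 1) * p2) - p1) by lra. field.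
Qed.

Lemma Derive_J0 (x : R) : Derive (fun x : R => bessel_J0 x) x = - bessel_J1 x.
Proof. apply is_derive_unique, is_derive_J0. Qed.

Lemma Derive_J1 (x : R) : Derive (fun x : R => bessel_J1 x) x =
  bessel_J0 x + PSeries (PS_derive bessel_coef) ((x / 2) ^ 2) / 2.
Proof. apply is_derive_unique, is_derive_J1. Qed.

Lemma J1_over_x (x : R) : x <> 0 -> PSeries (PS_derive bessel_coef) ((x / 2) ^ 2) / 2 = - (bessel_J1 x / x).
Proof. intros Hx. unfold bessel_J1. field. assumption. Qed.

Lemma continuous_J0 (x : R) : continuous bessel_J0 x.
Proof. apply (ex_derive_continuous_R). eexists; apply is_derive_J0. Qed.

Lemma continuous_J1 (x : R) : continuous bessel_J1 x.
Proof. apply (ex_derive_continuous_R). eexists; apply is_derive_J1. Qed.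

Lemma J0_0 : bessel_J0 0 = 1.
Proof.
rewrite bessel_J0_PSeries. replace ((0 / 2) ^ 2) with 0 by field. rewrite PSeries_0.
unfold bessel_coef. simpl. field.
Qed.

Lemma J1_0 : bessel_J1 0 = 0.
Proof. unfold bessel_J1. replace (0 / 2) with 0 by field. ring. Qed.

(** * Bounds for Bessel functions by monotone energies *)

Lemma derive_mean_value (f df : R -> R) (a b : R) : a <= b ->
  (forall x, a <= x <= b -> is_derive f x (df x)) ->
  exists c, a <= c <= b /\ f b - f a = df c * (b - a).
Proof.
intros Hab H.
destruct (MVT_gen f a b df) as [c [Hc E]]; rewrite ?Rmin_left, ?Rmax_right in * by assumption.
- intros x Hx; apply H; lra.
- intros x Hx. apply continuity_pt_filterlim.
  apply (ex_derive_continuous_R f x). eexists; now apply H.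
- now exists c.
Qed.

Lemma derive_nonpos_decr (f df : R -> R) (a b : R) : a <= b ->
  (forall x, a <= x <= b -> is_derive f x (df x)) -> (forall x, a <= x <= b -> df x <= 0) -> f b <= f a.
Proof.
intros Hab H Hn. destruct (derive_mean_value f df a b Hab H) as [c [Hc E]].
specialize (Hn c Hc). nra.
Qed.

(** The derivative of J0^2 + J1^2 is - 2 J1^2 / x, written without division through the series, and
    the value at 0 is 1. *)
Lemma bessel_sq_le_1 (x : R) : 0 <= x -> bessel_J0 x ^ 2 + bessel_J1 x ^ 2 <= 1.
Proof.
intros Hx.
assert (H : bessel_J0 x ^ 2 + bessel_J1 x ^ 2 <= bessel_J0 0 ^ 2 + bessel_J1 0 ^ 2).
{ apply (derive_nonpos_decr (fun x => bessel_J0 x ^ 2 + bessel_J1 x ^ 2)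
    (fun x => - (x / 2) * PSeries (PS_derive bessel_coef) ((x / 2) ^ 2) ^ 2) 0 x Hx).
  - intros t _. auto_derive.
    + split; [eexists; apply is_derive_J0|]. split; [eexists; apply is_derive_J1|exact I].
    + rewrite Derive_J0, Derive_J1.
      unfold bessel_J1. field.
  - intros t Ht. pose proof (pow2_ge_0 (PSeries (PS_derive bessel_coef) ((t / 2) ^ 2))). nra. }
rewrite J0_0, J1_0 in H. lra.
Qed.

(* The quantity shown to be decreasing is the energy
   [y'^2 + (1 + 1/(4x^2)) y^2] of [y = sqrt x * J0 x], which satisfies
   [y'' + (1 + 1/(4x^2)) y = 0]. *)
Lemma bessel_sq_decay (x : R) : 0 < x -> bessel_J0 x ^ 2 + bessel_J1 x ^ 2 <= 4 / x.
Proof.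
intros Hx.
destruct (Rle_or_lt x 1) as [Hx1|Hx1].
{ eapply Rle_trans; [apply bessel_sq_le_1; lra|].
  apply Rmult_le_reg_r with x; [assumption|]. replace (4 / x * x) with 4 by (field; lra). lra. }
assert (H : x * (bessel_J0 x ^ 2 + bessel_J1 x ^ 2) - bessel_J0 x * bessel_J1 x + bessel_J0 x ^ 2 / (2 * x)
  <= 1 * (bessel_J0 1 ^ 2 + bessel_J1 1 ^ 2) - bessel_J0 1 * bessel_J1 1 + bessel_J0 1 ^ 2 / (2 * 1)).
{ apply (derive_nonpos_decr (fun x => x * (bessel_J0 x ^ 2 + bessel_J1 x ^ 2) - bessel_J0 x * bessel_J1 x + bessel_J0 x ^ 2 / (2 * x))
    (fun x => - (bessel_J0 x ^ 2 / (2 * x ^ 2))) 1 x); [lra| |].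
  - intros t Ht. auto_derive.
    + repeat split; try lra; match goal with
        | |- context [bessel_J0] => eexists; apply is_derive_J0
        | |- context [bessel_J1] => eexists; apply is_derive_J1 end.
    + rewrite Derive_J0, Derive_J1.
      rewrite J1_over_x by lra. field. lra.
  - intros t Ht. assert (0 <= bessel_J0 t ^ 2 / (2 * t ^ 2)); [|lra].
    apply Rdiv_le_0_compat; [apply pow2_ge_0|]. apply Rmult_lt_0_compat; [lra|apply pow_lt; lra]. }
pose proof (bessel_sq_le_1 1 Rle_0_1) as B1.
set (a := bessel_J0 x) in *. set (b := bessel_J1 x) in *.
set (c := bessel_J0 1) in *. set (d := bessel_J1 1) in *.
assert (0 <= a ^ 2 / (2 * x)) by (apply Rdiv_le_0_compat; [apply pow2_ge_0|lra]).
assert (E1 : 1 * (c ^ 2 + d ^ 2) - c * d + c ^ 2 / (2 * 1) <= 2) by nra.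
(* For x > 1 the cross term takes at most half of x (a^2 + b^2), and the other half is bounded by
   the value of the energy at 1. *)
assert (E3 : a * b <= (a ^ 2 + b ^ 2) / 2) by (pose proof (pow2_ge_0 (a - b)); nra).
assert (E4 : 1 / 2 * (a ^ 2 + b ^ 2) <= x / 2 * (a ^ 2 + b ^ 2)).
{ apply Rmult_le_compat_r; [|lra]. pose proof (pow2_ge_0 a); pose proof (pow2_ge_0 b); lra. }
assert (E2 : (x / 2) * (a ^ 2 + b ^ 2) <= 2) by lra.
apply Rmult_le_reg_l with (x / 2); [lra|]. replace (x / 2 * (4 / x)) with 2 by (field; lra). exact E2.
Qed.

Lemma J0_le_1 (x : R) : 0 <= x -> Rabs (bessel_J0 x) <= 1.
Proof.
intros Hx. pose proof (bessel_sq_le_1 x Hx). rewrite <- (sqrt_pow2 1), <- sqrt_Rsqr_abs by lra.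
apply sqrt_le_1_alt. unfold Rsqr. pose proof (pow2_ge_0 (bessel_J1 x)). simpl in *. lra.
Qed.

Lemma J1_le_1 (x : R) : 0 <= x -> Rabs (bessel_J1 x) <= 1.
Proof.
intros Hx. pose proof (bessel_sq_le_1 x Hx). rewrite <- (sqrt_pow2 1), <- sqrt_Rsqr_abs by lra.
apply sqrt_le_1_alt. unfold Rsqr. pose proof (pow2_ge_0 (bessel_J0 x)). simpl in *. lra.
Qed.

Lemma J1_decay (y : R) : Rabs (bessel_J1 (exp y)) <= 2 * exp (- (y / 2)).
Proof.
pose proof (bessel_sq_decay (exp y) (exp_pos y)) as H.
rewrite <- sqrt_Rsqr_abs.
replace (2 * exp (- (y / 2))) with (sqrt ((2 * exp (- (y / 2))) ^ 2)).
- apply sqrt_le_1_alt. unfold Rsqr. pose proof (pow2_ge_0 (bessel_J0 (exp y))).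
  replace ((2 * exp (- (y / 2))) ^ 2) with (4 / exp y).
  + simpl in *; lra.
  + unfold Rdiv. rewrite <- exp_Ropp.
    replace (- y) with (- (y * / 2) + - (y * / 2)) by field. rewrite exp_plus. simpl. ring.
- apply sqrt_pow2. pose proof (exp_pos (- (y / 2))). lra.
Qed.

Lemma is_derive_xJ1 (x : R) : is_derive (fun x => x * bessel_J1 x) x (x * bessel_J0 x).
Proof.
auto_derive.
- eexists; apply is_derive_J1.
- rewrite Derive_J1. unfold bessel_J1. field.
Qed.

(** Integrate (x J1)' = x J0 with |J0| <= 1, which gives |x J1| <= x^2 / 2. *)
Lemma J1_le_half (x : R) : 0 < x -> Rabs (bessel_J1 x) <= x / 2.
Proof.
intros Hx.
assert (H1 : x * bessel_J1 x - x ^ 2 / 2 <= 0 * bessel_J1 0 - 0 ^ 2 / 2).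
{ apply (derive_nonpos_decr (fun x => x * bessel_J1 x - x ^ 2 / 2) (fun x => x * bessel_J0 x - x)); [lra| |].
  - intros t _. apply (is_derive_minus (K := R_AbsRing) (V := R_NormedModule)); [apply is_derive_xJ1|].
    auto_derive; [exact I|field].
  - intros t Ht. pose proof (J0_le_1 t ltac:(lra)) as H. apply Rabs_le_between in H. nra. }
assert (H2 : - (x * bessel_J1 x) - x ^ 2 / 2 <= - (0 * bessel_J1 0) - 0 ^ 2 / 2).
{ apply (derive_nonpos_decr (fun x => - (x * bessel_J1 x) - x ^ 2 / 2) (fun x => - (x * bessel_J0 x) - x)); [lra| |].
  - intros t _. apply (is_derive_minus (K := R_AbsRing) (V := R_NormedModule)).
    + apply (is_derive_opp (K := R_AbsRing) (V := R_NormedModule)), is_derive_xJ1.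
    + auto_derive; [exact I|field].
  - intros t Ht. pose proof (J0_le_1 t ltac:(lra)) as H. apply Rabs_le_between in H. nra. }
apply Rabs_le. split; apply Rmult_le_reg_l with x; try assumption; nra.
Qed.

(** * Hankel transform of a Gaussian *)

Lemma exp_neg_sq_le (t X : R) : 0 < t -> 1 <= X -> X * exp (- t * X ^ 2) <= 1 / (t * X).
Proof.
intros Ht HX. replace (- t * X ^ 2) with (- (t * X ^ 2)) by ring. rewrite exp_Ropp.
pose proof (exp_ineq1_le (t * X ^ 2)) as H.
assert (0 < t * X) by (apply Rmult_lt_0_compat; lra).
assert (H2 : 0 < t * X ^ 2) by (apply Rmult_lt_0_compat; [lra|apply pow_lt; lra]).
apply Rmult_le_reg_r with (exp (t * X ^ 2) * (t * X)).
{ apply Rmult_lt_0_compat; [apply exp_pos|assumption]. }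
replace (X * / exp (t * X ^ 2) * (exp (t * X ^ 2) * (t * X))) with (t * X ^ 2)
  by (field; apply Rgt_not_eq, exp_pos).
replace (1 / (t * X) * (exp (t * X ^ 2) * (t * X))) with (exp (t * X ^ 2)) by (field; lra).
lra.
Qed.

Lemma continuous_gauss {T : UniformSpace} (t : R) (u : T -> R) (p : T) : continuous u p ->
  continuous (fun p => exp (- t * u p ^ 2)) p.
Proof.
intros Hu. apply (continuous_Rexp (T := T) (fun p : T => - t * u p ^ 2)).
apply (continuous_Rmult (T := T) (fun _ : T => - t) (fun p : T => u p ^ 2)); [apply continuous_const|].
apply (continuous_ext (T := T) (fun p : T => u p * u p)); [intros; simpl; ring|]. now apply continuous_Rmult.
Qed.

(** Truncation at [X] keeps differentiation in [r] on a compact segment: the derivative is -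
    [gauss_J1], and integration by parts returns [gauss_J0] up to a boundary term, a first-order
    linear equation in [r]. *)
Definition gauss_J0 (t X r : R) : R := RInt (fun x => bessel_J0 (r * x) * (x * exp (- t * x ^ 2))) 0 X.

Definition gauss_J1 (t X r : R) : R := RInt (fun x => x ^ 2 * bessel_J1 (r * x) * exp (- t * x ^ 2)) 0 X.

Lemma continuous_pow2 {T : UniformSpace} (u : T -> R) (p : T) : continuous u p -> continuous (fun p => u p ^ 2) p.
Proof.
intros Hu. apply (continuous_ext (T := T) (fun p : T => u p * u p)); [intros; simpl; ring|]. now apply continuous_Rmult.
Qed.

Lemma continuous_gauss_J0_integrand (t r x : R) :
  continuous (fun x => bessel_J0 (r * x) * (x * exp (- t * x ^ 2))) x.
Proof.
apply continuous_Rmult; [|apply continuous_Rmult].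
- apply (continuous_comp (fun x => r * x) bessel_J0); [|apply continuous_J0].
  apply continuous_Rmult; [apply continuous_const|apply continuous_id].
- apply continuous_id.
- apply (continuous_gauss t (fun x : R => x)), continuous_id.
Qed.

Lemma continuous_gauss_J1_integrand (t r x : R) :
  continuous (fun x => x ^ 2 * bessel_J1 (r * x) * exp (- t * x ^ 2)) x.
Proof.
apply continuous_Rmult; [apply continuous_Rmult|].
- apply (continuous_pow2 (fun x : R => x)), continuous_id.
- apply (continuous_comp (fun x => r * x) bessel_J1); [|apply continuous_J1].
  apply continuous_Rmult; [apply continuous_const|apply continuous_id].
- apply (continuous_gauss t (fun x : R => x)), continuous_id.
Qed.

Lemma gauss_J1_by_parts (t X r : R) : 0 < t ->
  gauss_J1 t X r = r / (2 * t) * gauss_J0 t X r - X * bessel_J1 (r * X) * exp (- t * X ^ 2) / (2 * t).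
Proof.
intros Ht.
assert (H : is_RInt (fun x => r / (2 * t) * (bessel_J0 (r * x) * (x * exp (- t * x ^ 2)))
    - x ^ 2 * bessel_J1 (r * x) * exp (- t * x ^ 2)) 0 X
  (minus (X * bessel_J1 (r * X) * exp (- t * X ^ 2) / (2 * t)) (0 * bessel_J1 (r * 0) * exp (- t * 0 ^ 2) / (2 * t)))).
{ apply (is_RInt_derive (V := R_CompleteNormedModule) (fun x => x * bessel_J1 (r * x) * exp (- t * x ^ 2) / (2 * t))).
  - intros x _. auto_derive.
    + repeat split; try lra. eexists; apply is_derive_J1.
    + rewrite Derive_J1. unfold bessel_J1. simpl. field. lra.
  - intros x _. apply continuous_Rminus; [|apply continuous_gauss_J1_integrand].
    apply continuous_Rmult; [apply continuous_const|apply continuous_gauss_J0_integrand]. }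
apply (is_RInt_unique (V := R_CompleteNormedModule)) in H.
rewrite (RInt_minus (V := R_CompleteNormedModule) (fun x => r / (2 * t) * (bessel_J0 (r * x) * (x * exp (- t * x ^ 2))))) in H.
2:{ apply ex_RInt_cont. intros x. apply continuous_Rmult; [apply continuous_const|apply continuous_gauss_J0_integrand]. }
2:{ apply ex_RInt_cont, continuous_gauss_J1_integrand. }
rewrite (RInt_scal (V := R_CompleteNormedModule) (fun x => bessel_J0 (r * x) * (x * exp (- t * x ^ 2)))) in H.
2:{ apply ex_RInt_cont, continuous_gauss_J0_integrand. }
fold (gauss_J0 t X r) in H. fold (gauss_J1 t X r) in H.
unfold minus, plus, opp, scal in H; simpl in H. unfold mult in H; simpl in H. simpl.
lra.
Qed.

Lemma is_derive_gauss_J0 (t X r : R) : is_derive (gauss_J0 t X) r (- gauss_J1 t X r).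
Proof.
assert (HD : forall x r, is_derive (fun r : R => bessel_J0 (r * x) * (x * exp (- t * x ^ 2))) r
  (- (x ^ 2 * bessel_J1 (r * x) * exp (- t * x ^ 2)))).
{ intros x r'. auto_derive; [eexists; apply is_derive_J0|]. rewrite Derive_J0. simpl. ring. }
assert (E : forall x r, Derive (fun r : R => bessel_J0 (r * x) * (x * exp (- t * x ^ 2))) r =
  - (x ^ 2 * bessel_J1 (r * x) * exp (- t * x ^ 2))).
{ intros x r'. apply is_derive_unique, HD. }
replace (- gauss_J1 t X r) with
  (RInt (fun x => Derive (fun r : R => bessel_J0 (r * x) * (x * exp (- t * x ^ 2))) r) 0 X).
- apply (is_derive_RInt_param (fun r x => bessel_J0 (r * x) * (x * exp (- t * x ^ 2)))).
  + apply filter_forall. intros r' x _. eexists; apply HD.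
  + intros x _. apply (continuity_2d_pt_ext (fun r x => - (x ^ 2 * bessel_J1 (r * x) * exp (- t * x ^ 2)))).
    { intros; symmetry; apply E. }
    apply continuity_2d_pt_filterlim.
    apply (continuous_Ropp (fun p : R * R => (snd p) ^ 2 * bessel_J1 (fst p * snd p) * exp (- t * (snd p) ^ 2))).
    apply continuous_Rmult; [apply continuous_Rmult|].
    * apply (continuous_pow2 (fun p : R * R => snd p)), continuous_snd.
    * apply (continuous_comp (fun p : R * R => fst p * snd p) bessel_J1); [|apply continuous_J1].
      apply continuous_Rmult; [apply continuous_fst|apply continuous_snd].
    * apply (continuous_gauss t (fun p : R * R => snd p)), continuous_snd.
  + apply filter_forall. intros r'. apply ex_RInt_cont, continuous_gauss_J0_integrand.
- rewrite (RInt_ext _ (fun x => opp (x ^ 2 * bessel_J1 (r * x) * exp (- t * x ^ 2)))).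
  + apply (RInt_opp (V := R_CompleteNormedModule) (fun x => x ^ 2 * bessel_J1 (r * x) * exp (- t * x ^ 2))).
    apply ex_RInt_cont, continuous_gauss_J1_integrand.
  + intros x _. apply E.
Qed.

Lemma gauss_J0_at_0 (t X : R) : 0 < t -> gauss_J0 t X 0 = (1 - exp (- t * X ^ 2)) / (2 * t).
Proof.
intros Ht. unfold gauss_J0. apply (is_RInt_unique (V := R_CompleteNormedModule)).
replace ((1 - exp (- t * X ^ 2)) / (2 * t)) with
  (minus (- exp (- t * X ^ 2) / (2 * t)) (- exp (- t * 0 ^ 2) / (2 * t))).
- apply (is_RInt_derive (V := R_CompleteNormedModule) (fun x => - exp (- t * x ^ 2) / (2 * t))).
  + intros x _. rewrite Rmult_0_l, J0_0. auto_derive; [exact I|]. simpl. field. lra.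
  + intros x _. apply continuous_gauss_J0_integrand.
- replace (- t * 0 ^ 2) with 0 by ring. rewrite exp_0. unfold minus, plus, opp; simpl. field. lra.
Qed.

(** After multiplication by the integrating factor exp(r^2 / (4 t)) only the boundary term at [X]
    remains in the derivative, and it is small. The value at r = 0 is elementary. *)
Lemma gauss_J0_limit (t r X : R) : 0 < t -> 0 <= r -> 1 <= X ->
  Rabs (gauss_J0 t X r - exp (- r ^ 2 / (4 * t)) / (2 * t)) <= (1 + r * exp (r ^ 2 / (4 * t))) / (2 * t) * (1 / (t * X)).
Proof.
intros Ht Hr HX.
pose proof (exp_neg_sq_le t X Ht HX) as Hg. pose proof (exp_pos (- t * X ^ 2)) as Hpos.
assert (Hg1 : exp (- t * X ^ 2) <= 1 / (t * X)).
{ assert (1 * exp (- t * X ^ 2) <= X * exp (- t * X ^ 2)) by (apply Rmult_le_compat_r; lra). lra. }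
assert (HD : forall s, is_derive (fun s => gauss_J0 t X s * exp (s ^ 2 / (4 * t))) s
  (exp (s ^ 2 / (4 * t)) * (X * bessel_J1 (s * X) * exp (- t * X ^ 2) / (2 * t)))).
{ intros s.
  assert (He : is_derive (fun s => exp (s ^ 2 / (4 * t))) s (s / (2 * t) * exp (s ^ 2 / (4 * t)))).
  { auto_derive; [exact I|]. simpl. unfold Rdiv. field. lra. }
  pose proof (is_derive_mult (K := R_AbsRing) _ _ s _ _ (is_derive_gauss_J0 t X s) He Rmult_comm) as H.
  rewrite (gauss_J1_by_parts t X s Ht) in H.
  match type of H with is_derive _ _ ?l => match goal with |- is_derive _ _ ?l' => replace l' with l; [exact H|] end end.
  unfold plus, mult; simpl. field. lra. }
(* The unknown point [c] enters the error term only, where it is estimated by [r]. *)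
destruct (derive_mean_value _ _ 0 r Hr (fun s _ => HD s)) as [c [Hc E]].
rewrite gauss_J0_at_0 in E by assumption.
replace (0 ^ 2 / (4 * t)) with 0 in E by (field; lra). rewrite exp_0, Rmult_1_r, Rminus_0_r in E.
set (G := gauss_J0 t X r) in *.
assert (Hee : exp (r ^ 2 / (4 * t)) * exp (- r ^ 2 / (4 * t)) = 1).
{ rewrite <- exp_plus. replace (r ^ 2 / (4 * t) + - r ^ 2 / (4 * t)) with 0 by (field; lra). apply exp_0. }
assert (E2 : G - exp (- r ^ 2 / (4 * t)) / (2 * t) = exp (- r ^ 2 / (4 * t)) *
  (exp (c ^ 2 / (4 * t)) * (X * bessel_J1 (c * X) * exp (- t * X ^ 2) / (2 * t)) * r - exp (- t * X ^ 2) / (2 * t))).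
{ rewrite <- E.
  replace (exp (- r ^ 2 / (4 * t)) * (G * exp (r ^ 2 / (4 * t)) - (1 - exp (- t * X ^ 2)) / (2 * t)
     - exp (- t * X ^ 2) / (2 * t))) with (G * (exp (r ^ 2 / (4 * t)) * exp (- r ^ 2 / (4 * t)))
     - exp (- r ^ 2 / (4 * t)) / (2 * t)) by (field; lra).
  rewrite Hee. ring. }
rewrite E2, Rabs_mult.
assert (He1 : Rabs (exp (- r ^ 2 / (4 * t))) <= 1).
{ rewrite Rabs_pos_eq by (left; apply exp_pos). rewrite <- exp_0. apply exp_le.
  unfold Rdiv. rewrite Ropp_mult_distr_l_reverse.
  assert (0 <= r ^ 2 * / (4 * t)); [|lra].
  apply Rmult_le_pos; [apply pow2_ge_0|left; apply Rinv_0_lt_compat; lra]. }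
set (ec := exp (c ^ 2 / (4 * t))) in *. set (er := exp (r ^ 2 / (4 * t))) in *. set (gX := exp (- t * X ^ 2)) in *.
assert (Hec : 0 < ec <= er).
{ split; [apply exp_pos|]. apply exp_le. apply Rmult_le_compat_r; [left; apply Rinv_0_lt_compat; lra|].
  apply pow_incr. lra. }
assert (HJ : Rabs (bessel_J1 (c * X)) <= 1) by (apply J1_le_1, Rmult_le_pos; lra).
assert (Hit : 0 < / (2 * t)) by (apply Rinv_0_lt_compat; lra).
assert (B1 : Rabs (ec * (X * bessel_J1 (c * X) * gX / (2 * t)) * r) <= r * er * / (2 * t) * (1 / (t * X))).
{ replace (ec * (X * bessel_J1 (c * X) * gX / (2 * t)) * r) with (r * ec * / (2 * t) * (X * gX) * bessel_J1 (c * X))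
    by (unfold Rdiv; ring).
  rewrite Rabs_mult.
  assert (P1 : 0 <= r * ec * / (2 * t)) by (apply Rmult_le_pos; [apply Rmult_le_pos|]; lra).
  assert (P2 : 0 <= X * gX) by (apply Rmult_le_pos; lra).
  rewrite Rabs_pos_eq by (now apply Rmult_le_pos).
  rewrite <- (Rmult_1_r (r * er * / (2 * t) * (1 / (t * X)))).
  apply Rmult_le_compat; [now apply Rmult_le_pos|apply Rabs_pos| |assumption].
  apply Rmult_le_compat; try assumption.
  apply Rmult_le_compat_r; [lra|]. apply Rmult_le_compat_l; lra. }
assert (B2 : Rabs (gX / (2 * t)) <= / (2 * t) * (1 / (t * X))).
{ rewrite Rabs_pos_eq by (apply Rdiv_le_0_compat; lra). unfold Rdiv at 1. rewrite Rmult_comm.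
  apply Rmult_le_compat_l; lra. }
set (u := ec * (X * bessel_J1 (c * X) * gX / (2 * t)) * r) in *. set (v := gX / (2 * t)) in *.
assert (B3 : Rabs (u - v) <= Rabs u + Rabs v).
{ unfold Rminus. eapply Rle_trans; [apply Rabs_triang|]. rewrite Rabs_Ropp. lra. }
apply Rle_trans with (1 * Rabs (u - v)).
- apply Rmult_le_compat_r; [apply Rabs_pos|assumption].
- replace ((1 + r * er) / (2 * t) * (1 / (t * X))) with (/ (2 * t) * (1 / (t * X)) + r * er * / (2 * t) * (1 / (t * X)))
    by (unfold Rdiv; ring).
  lra.
Qed.

Lemma gauss_J1_limit (t r : R) : 0 < t -> 0 <= r ->
  exists M, 0 <= M /\ forall X, 1 <= X ->
    Rabs (gauss_J1 t X r - r / (4 * t ^ 2) * exp (- r ^ 2 / (4 * t))) <= M / X.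
Proof.
intros Ht Hr.
exists (r / (2 * t) * ((1 + r * exp (r ^ 2 / (4 * t))) / (2 * t) * / t) + / (2 * t) * / t).
assert (Hit : 0 < / (2 * t)) by (apply Rinv_0_lt_compat; lra).
assert (Hit' : 0 < / t) by (apply Rinv_0_lt_compat; lra).
assert (Hrt : 0 <= r / (2 * t)) by (apply Rmult_le_pos; lra).
split.
- apply Rplus_le_le_0_compat; [|apply Rmult_le_pos; lra].
  apply Rmult_le_pos; [assumption|]. apply Rmult_le_pos; [|lra].
  apply Rmult_le_pos; [|lra]. assert (0 <= r * exp (r ^ 2 / (4 * t))) by (apply Rmult_le_pos; [assumption|left; apply exp_pos]). lra.
- intros X HX. rewrite gauss_J1_by_parts by assumption.
  pose proof (gauss_J0_limit t r X Ht Hr HX) as H.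
  pose proof (exp_neg_sq_le t X Ht HX) as Hg. pose proof (exp_pos (- t * X ^ 2)) as Hpos.
  assert (HJ : Rabs (bessel_J1 (r * X)) <= 1) by (apply J1_le_1, Rmult_le_pos; lra).
  replace (r / (2 * t) * gauss_J0 t X r - X * bessel_J1 (r * X) * exp (- t * X ^ 2) / (2 * t) - r / (4 * t ^ 2) * exp (- r ^ 2 / (4 * t)))
    with (r / (2 * t) * (gauss_J0 t X r - exp (- r ^ 2 / (4 * t)) / (2 * t)) + - (/ (2 * t) * (X * exp (- t * X ^ 2)) * bessel_J1 (r * X)))
    by (field; lra).
  eapply Rle_trans; [apply Rabs_triang|].
  replace ((r / (2 * t) * ((1 + r * exp (r ^ 2 / (4 * t))) / (2 * t) * / t) + / (2 * t) * / t) / X) with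
    (r / (2 * t) * ((1 + r * exp (r ^ 2 / (4 * t))) / (2 * t) * (1 / (t * X))) + / (2 * t) * (1 / (t * X)))
    by (field; lra).
  apply Rplus_le_compat.
  + rewrite Rabs_mult, (Rabs_pos_eq (r / (2 * t))) by assumption. now apply Rmult_le_compat_l.
  + assert (P2 : 0 <= X * exp (- t * X ^ 2)) by (apply Rmult_le_pos; lra).
    rewrite Rabs_Ropp, Rabs_mult, Rabs_pos_eq by (apply Rmult_le_pos; lra).
    rewrite <- (Rmult_1_r (/ (2 * t) * (1 / (t * X)))).
    apply Rmult_le_compat; [apply Rmult_le_pos; lra|apply Rabs_pos| |assumption].
    apply Rmult_le_compat_l; lra.
Qed.

(** * The Weber integral *)

(* With x = e^y, [x J1(q x) / q] is a primitive of [x J0(q x)]. *)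
Definition bj1 (q y : R) : R := exp y * bessel_J1 (q * exp y) / q.

Lemma continuous_bj1_comp {T : UniformSpace} (q : R) (u : T -> R) (p : T) :
  continuous u p -> continuous (fun p => bj1 q (u p)) p.
Proof.
intros Hu. unfold bj1. unfold Rdiv.
pose proof (continuous_Rexp u p Hu) as He.
apply (continuous_Rmult (fun p => exp (u p) * bessel_J1 (q * exp (u p))) (fun _ => / q)); [|apply continuous_const].
apply continuous_Rmult; [exact He|].
apply (continuous_comp (fun p => q * exp (u p)) bessel_J1); [|apply continuous_J1].
apply (continuous_Rmult (fun _ => q)); [apply continuous_const|exact He].
Qed.

Lemma is_derive_bj1 (q y : R) : q <> 0 -> is_derive (bj1 q) y (exp (2 * y) * bessel_J0 (q * exp y)).
Proof.
intros Hq.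
assert (Hin : is_derive (fun y => q * exp y) y (q * exp y)) by (auto_derive; [exact I|ring]).
pose proof (is_derive_comp (K := R_AbsRing) (V := R_NormedModule) (fun x => x * bessel_J1 x) (fun y => q * exp y) y _ _
  (is_derive_xJ1 (q * exp y)) Hin) as H.
pose proof (is_derive_scal _ y (/ (q * q)) _ H) as H2.
apply (is_derive_ext (fun y => / (q * q) * (q * exp y * bessel_J1 (q * exp y)))).
{ intros t. change (/ (q * q) * (q * exp t * bessel_J1 (q * exp t)) = bj1 q t). unfold bj1. field. assumption. }
match type of H2 with is_derive _ _ ?l => match goal with |- is_derive _ _ ?l' => replace l' with l; [exact H2|] end end.
unfold scal, mult; simpl. unfold mult; simpl.
replace (2 * y) with (y + y) by ring. rewrite exp_plus. field. assumption.
Qed.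

Lemma bj1_le_sq (q y : R) : 0 < q -> Rabs (bj1 q y) <= exp (2 * y) / 2.
Proof.
intros Hq. unfold bj1, Rdiv. pose proof (exp_pos y).
assert (Hqe : 0 < q * exp y) by now apply Rmult_lt_0_compat.
pose proof (J1_le_half (q * exp y) Hqe) as HJ.
assert (Hiq : 0 < / q) by now apply Rinv_0_lt_compat.
rewrite !Rabs_mult, (Rabs_pos_eq (exp y)), (Rabs_pos_eq (/ q)) by lra.
replace (2 * y) with (y + y) by ring. rewrite exp_plus.
replace (exp y * exp y * / 2) with (exp y * (q * exp y / 2) * / q) by (field; lra).
apply Rmult_le_compat_r; [lra|]. apply Rmult_le_compat_l; lra.
Qed.

Lemma bj1_le_sqrt (q y : R) : 0 < q -> Rabs (bj1 q y) <= 2 / q * exp (- (ln q / 2)) * exp (y / 2).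
Proof.
intros Hq. unfold bj1, Rdiv. pose proof (exp_pos y).
assert (Hiq : 0 < / q) by now apply Rinv_0_lt_compat.
pose proof (J1_decay (ln q + y)) as HJ. rewrite exp_plus, exp_ln in HJ by assumption.
rewrite !Rabs_mult, (Rabs_pos_eq (exp y)), (Rabs_pos_eq (/ q)) by lra.
apply Rle_trans with (exp y * (2 * exp (- ((ln q + y) / 2))) * / q).
- apply Rmult_le_compat_r; [lra|]. apply Rmult_le_compat_l; lra.
- replace (exp y * (2 * exp (- ((ln q + y) / 2))) * / q) with (2 * / q * (exp y * exp (- ((ln q + y) / 2)))) by ring.
  replace (exp y * exp (- ((ln q + y) / 2))) with (exp (- (ln q / 2)) * exp (y / 2))
    by (rewrite <- !exp_plus; f_equal; field).
  right. unfold Rdiv. ring.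
Qed.

(** The window for [delta] acts here: [bj1] is of order e^(2 y) on the left and e^(y / 2) on the
    right, so the weight e^(- 2 delta y) gives decay at both ends exactly when 1/4 < delta < 1. *)
Lemma bj1_weighted (q delta : R) : 0 < q -> 1 / 4 < delta < 1 ->
  exists K eta, 0 <= K /\ 0 < eta < 3 /\ forall y, Rabs (bj1 q y) * exp (- 2 * delta * y) <= K * exp (- eta * Rabs y).
Proof.
intros Hq Hd. set (Cq := 2 / q * exp (- (ln q / 2))).
assert (HC : 0 <= Cq).
{ apply Rmult_le_pos; [apply Rdiv_le_0_compat; lra|left; apply exp_pos]. }
(* The rates of decay at the left and at the right end. *)
set (eta := Rmin (2 - 2 * delta) (2 * delta - 1 / 2)).
pose proof (Rmin_l (2 - 2 * delta) (2 * delta - 1 / 2)) as E1; pose proof (Rmin_r (2 - 2 * delta) (2 * delta - 1 / 2)) as E2.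
fold eta in E1, E2. assert (He : 0 < eta) by (apply Rmin_pos; lra).
exists (1 + Cq), eta. split; [lra|]. split; [lra|]. intros y.
destruct (Rle_or_lt y 0) as [Hy|Hy].
- rewrite (Rabs_left1 y) by assumption.
  apply Rle_trans with (exp (2 * y) / 2 * exp (- 2 * delta * y)).
  + apply Rmult_le_compat_r; [left; apply exp_pos|now apply bj1_le_sq].
  + apply Rle_trans with (1 * (exp (2 * y) * exp (- 2 * delta * y))).
    * pose proof (exp_pos (2 * y)). pose proof (exp_pos (- 2 * delta * y)).
      assert (0 <= exp (2 * y) * exp (- 2 * delta * y)) by (apply Rmult_le_pos; lra). lra.
    * rewrite <- exp_plus. apply Rmult_le_compat; try lra; [left; apply exp_pos|]. apply exp_le. nra.
- rewrite (Rabs_pos_eq y) by lra.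
  apply Rle_trans with (Cq * exp (y / 2) * exp (- 2 * delta * y)).
  + apply Rmult_le_compat_r; [left; apply exp_pos|now apply bj1_le_sqrt].
  + rewrite Rmult_assoc, <- exp_plus.
    apply Rmult_le_compat; try lra; [left; apply exp_pos|]. apply exp_le. nra.
Qed.

(** With x = e^y this is x^2 J1(q x) e^(- t x^2) / q against dx, the integrand of [gauss_J1] divided
    by [q]. *)
Definition gauss_ker (q t y : R) : R := bj1 q y * exp (2 * y) * exp (- t * exp (2 * y)).

Lemma continuous_gauss_ker (q t y : R) : continuous (gauss_ker q t) y.
Proof.
unfold gauss_ker.
assert (H2 : continuous (fun y => exp (2 * y)) y).
{ apply (continuous_Rexp (fun y : R => 2 * y)), (continuous_Rmult (fun _ : R => 2)); [apply continuous_const|apply continuous_id]. }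
apply continuous_Rmult; [apply continuous_Rmult; [|exact H2]|].
- apply (continuous_bj1_comp q (fun y : R => y)), continuous_id.
- apply (continuous_Rexp (fun y : R => - t * exp (2 * y))), (continuous_Rmult (fun _ : R => - t)); [apply continuous_const|exact H2].
Qed.

Lemma gauss_ker_expdec (q t : R) : 0 < q -> 0 < t -> exists K, expdec (fun y => RtoC (gauss_ker q t y)) K 1.
Proof.
intros Hq Ht. destruct (gker_bound 2 2 t ltac:(lra) Ht) as [K [HK HKb]].
exists K. repeat split; [|lra|].
- intros y. apply continuous_RtoC, continuous_gauss_ker.
- intros y. rewrite Cmod_R. unfold gauss_ker. rewrite !Rabs_mult.
  rewrite (Rabs_pos_eq (exp (2 * y))), (Rabs_pos_eq (exp (- t * exp (2 * y)))) by (left; apply exp_pos).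
  pose proof (bj1_le_sq q y Hq). pose proof (exp_pos (2 * y)).
  apply Rle_trans with (exp (2 * y) * exp (2 * y) * exp (- t * exp (2 * y))).
  + apply Rmult_le_compat_r; [left; apply exp_pos|]. apply Rmult_le_compat_r; lra.
  + rewrite <- !exp_plus. specialize (HKb 2 (2 * y) ltac:(lra)).
    eapply Rle_trans; [|eapply Rle_trans; [exact HKb|]].
    * right. f_equal. ring.
    * apply Rmult_le_compat_l; [lra|]. apply exp_le. rewrite Rabs_mult, (Rabs_pos_eq 2) by lra.
      pose proof (Rabs_pos y). lra.
Qed.

Lemma RInt_RtoC (u : R -> R) (a b : R) : (forall x, continuous u x) ->
  CInt (fun x => RtoC (u x)) a b = RtoC (RInt u a b).
Proof.
intros H. apply CInt_unique, is_RInt_pair; unfold Re, Im; simpl.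
- now apply (RInt_correct (V := R_CompleteNormedModule)), ex_RInt_cont.
- pose proof (is_RInt_const (V := R_NormedModule) a b 0) as H0.
  unfold scal in H0; simpl in H0; unfold mult in H0; simpl in H0. now rewrite Rmult_0_r in H0.
Qed.

Lemma gauss_ker_RInt (q t W : R) : 0 < q ->
  RInt (gauss_ker q t) (- W) W = (gauss_J1 t (exp W) q - gauss_J1 t (exp (- W)) q) / q.
Proof.
intros Hq.
set (G := fun x => x ^ 2 * bessel_J1 (q * x) * exp (- t * x ^ 2)).
assert (HG : forall x, continuous G x) by (intros; apply continuous_gauss_J1_integrand).
assert (E : RInt G (exp (- W)) (exp W) = gauss_J1 t (exp W) q - gauss_J1 t (exp (- W)) q).
{ pose proof (RInt_Chasles (V := R_CompleteNormedModule) G 0 (exp (- W)) (exp W)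
    (ex_RInt_cont G _ _ HG) (ex_RInt_cont G _ _ HG)) as H.
  unfold plus in H; simpl in H. unfold gauss_J1. fold G. lra. }
rewrite <- E.
apply (is_RInt_unique (V := R_CompleteNormedModule)).
pose proof (is_RInt_comp (V := R_CompleteNormedModule) G exp exp (- W) W
  (fun x _ => HG (exp x)) (fun x _ => is_derive_exp_real x)) as H.
apply (is_RInt_scal (V := R_NormedModule) _ _ _ (/ q)) in H.
unfold Rdiv. rewrite Rmult_comm. revert H. apply is_RInt_ext. intros y _.
unfold scal, gauss_ker, G, bj1; simpl. unfold mult; simpl.
replace (2 * y) with (y + y) by ring. rewrite exp_plus.
replace (exp y * (exp y * 1)) with (exp y * exp y) by ring. field. lra.
Qed.

(** Disposes of the piece from 0 to e^(- W) that an integral over [- W, W] in the logarithmic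
    variable leaves out. *)
Lemma gauss_J1_small (q t X : R) : 0 < q -> 0 < t -> 0 <= X <= 1 -> Rabs (gauss_J1 t X q) <= X.
Proof.
intros Hq Ht HX. unfold gauss_J1.
pose proof (norm_RInt_le_const (V := R_NormedModule) (fun x => x ^ 2 * bessel_J1 (q * x) * exp (- t * x ^ 2)) 0 X
  (RInt (fun x => x ^ 2 * bessel_J1 (q * x) * exp (- t * x ^ 2)) 0 X) 1 (proj1 HX)) as H.
unfold norm in H; simpl in H. unfold abs in H; simpl in H.
replace ((X - 0) * 1) with X in H by ring. apply H.
- intros x Hx. rewrite !Rabs_mult.
  assert (B1 : Rabs x <= 1) by (apply Rabs_le; lra).
  assert (B2 : Rabs (bessel_J1 (q * x)) <= 1) by (apply J1_le_1, Rmult_le_pos; lra).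
  assert (B3 : Rabs (exp (- t * (x * (x * 1)))) <= 1).
  { rewrite Rabs_pos_eq by (left; apply exp_pos).
    apply Rle_trans with (exp 0); [apply exp_le|rewrite exp_0; lra].
    assert (0 <= t * (x * (x * 1))) by (apply Rmult_le_pos; [lra|nra]). lra. }
  rewrite Rabs_R1, Rmult_1_r.
  pose proof (Rabs_pos x). pose proof (Rabs_pos (bessel_J1 (q * x))). pose proof (Rabs_pos (exp (- t * (x * (x * 1))))).
  assert (Hp : forall a b, 0 <= a <= 1 -> 0 <= b <= 1 -> 0 <= a * b <= 1) by (intros; nra).
  apply Hp; [apply Hp; [apply Hp|]|]; split; assumption.
- apply (RInt_correct (V := R_CompleteNormedModule)), ex_RInt_cont, continuous_gauss_J1_integrand.
Qed.

Lemma LI_gauss_ker (q t : R) : 0 < q -> 0 < t ->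
  LI (fun y => RtoC (gauss_ker q t y)) = RtoC (exp (- q ^ 2 / (4 * t)) / (4 * t ^ 2)).
Proof.
intros Hq Ht. destruct (gauss_ker_expdec q t Hq Ht) as [K HK].
destruct (gauss_J1_limit t q Ht ltac:(lra)) as [M [HM HMb]].
apply (LI_unique _ _ _ _ HK). intros e He.
destruct (exp_small ((M + 1) / q) 1 e Rlt_0_1 He) as [W0 [HW0 HW]].
exists W0. intros W HWW. specialize (HW W HWW). replace (- (1) * W) with (- W) in HW by ring.
rewrite RInt_RtoC by apply continuous_gauss_ker. rewrite gauss_ker_RInt by assumption.
rewrite <- RtoC_minus, Cmod_R.
assert (H1 : 1 <= exp W) by (rewrite <- exp_0; apply exp_le; lra).
assert (H2 : 0 <= exp (- W) <= 1).
{ split; [left; apply exp_pos|]. rewrite <- exp_0. apply exp_le. lra. }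
specialize (HMb (exp W) H1). pose proof (gauss_J1_small q t (exp (- W)) Hq Ht H2) as B2.
assert (EM : M / exp W = M * exp (- W)) by (unfold Rdiv; now rewrite exp_Ropp).
rewrite EM in HMb.
replace ((gauss_J1 t (exp W) q - gauss_J1 t (exp (- W)) q) / q - exp (- q ^ 2 / (4 * t)) / (4 * t ^ 2)) with
  (/ q * ((gauss_J1 t (exp W) q - q / (4 * t ^ 2) * exp (- q ^ 2 / (4 * t))) + - gauss_J1 t (exp (- W)) q))
  by (field; lra).
assert (Hiq : 0 < / q) by now apply Rinv_0_lt_compat.
rewrite Rabs_mult, (Rabs_pos_eq (/ q)) by lra.
eapply Rle_trans; [|exact HW].
replace ((M + 1) / q * exp (- W)) with (/ q * (M * exp (- W) + exp (- W))) by (unfold Rdiv; ring).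
apply Rmult_le_compat_l; [lra|]. eapply Rle_trans; [apply Rabs_triang|]. rewrite Rabs_Ropp. lra.
Qed.

(** A power of x = e^y is written as a superposition of the Gaussians exp(- e^v x^2): integration
    over [v] returns Gamma(1 - s) x^(2 s) times [bj1], integration over [y] the transform of a
    Gaussian with parameter e^v. *)
Definition weber_ker (q : R) (s : C) (y v : R) : C :=
  (RtoC (bj1 q y * exp (2 * y)) * Cexp ((1 - s) * v - RtoC (exp (v + 2 * y))))%C.

Lemma weber_ker_gker (q : R) (s : C) (y v : R) :
  weber_ker q s y v = (RtoC (bj1 q y) * Cexp (s * RtoC (2 * y)) * gker (1 - s) (v + 2 * y))%C.
Proof.
unfold weber_ker, gker. rewrite RtoC_mult, <- (Cexp_RtoC (2 * y)), <- !Cmult_assoc, <- !Cexp_plus.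
f_equal. f_equal. rewrite RtoC_plus. ring.
Qed.

Lemma weber_ker_expdec2 (q : R) (s : C) (delta : R) : 0 < q -> 1 / 4 < delta < 1 -> Re s = - delta ->
  exists K eta, expdec2 (weber_ker q s) K eta.
Proof.
intros Hq Hd Hs.
destruct (bj1_weighted q delta Hq Hd) as (K & eta & HK & Heta & Hb).
destruct (gker_bound (1 + delta) (1 + delta) 1 ltac:(lra) Rlt_0_1) as [K' [HK' Hb']].
(* The natural decay is in |y| and |v + 2 y|. Since |v| <= |v + 2 y| + 2 |y|, decay in |v| costs two
   thirds of the rate in |y|; [eta < 3] makes the rate in |v + 2 y| sufficient. *)
exists (K * K'), (eta / 3). repeat split; [|lra|].
- intros y v. unfold weber_ker.
  assert (H2 : continuous (fun p : R * R => 2 * fst p) (y, v)).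
  { apply (continuous_Rmult (fun _ : R * R => 2)); [apply continuous_const|apply continuous_fst]. }
  apply continuous_Cmult.
  + apply continuous_RtoC, continuous_Rmult.
    * apply (continuous_bj1_comp q (fun p : R * R => fst p)), continuous_fst.
    * apply (continuous_Rexp (fun p : R * R => 2 * fst p)), H2.
  + apply continuous_Cexp, continuous_Cminus.
    * apply continuous_Cmult; [apply continuous_const|apply continuous_RtoC, continuous_snd].
    * apply continuous_RtoC, (continuous_Rexp (fun p : R * R => snd p + 2 * fst p)).
      apply continuous_Rplus; [apply continuous_snd|exact H2].
- intros y v. rewrite weber_ker_gker, !Cmod_mult, Cmod_R, Cmod_Cexp, Cmod_gker, Re_one_minus, Hs.
  replace (Re (s * (2 * y)%R)%C) with (- 2 * delta * y) by (rewrite Re_Cmult, Hs; unfold Re, Im; simpl; ring).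
  specialize (Hb y). specialize (Hb' (1 + delta) (v + 2 * y) ltac:(lra)).
  replace ((1 + delta) * (v + 2 * y) - 1 * exp (v + 2 * y)) with ((1 - - delta) * (v + 2 * y) - exp (v + 2 * y)) in Hb' by ring.
  apply Rle_trans with (K * exp (- eta * Rabs y) * (K' * exp (- (1 + delta) * Rabs (v + 2 * y)))).
  + apply Rmult_le_compat; try assumption.
    * apply Rmult_le_pos; [apply Rabs_pos|left; apply exp_pos].
    * left; apply exp_pos.
  + replace (K * exp (- eta * Rabs y) * (K' * exp (- (1 + delta) * Rabs (v + 2 * y)))) with
      (K * K' * (exp (- eta * Rabs y) * exp (- (1 + delta) * Rabs (v + 2 * y)))) by ring.
    rewrite Rmult_assoc with (r1 := K * K'). apply Rmult_le_compat_l; [apply Rmult_le_pos; lra|].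
    rewrite <- !exp_plus. apply exp_le.
    pose proof (Rabs_triang (v + 2 * y) (- (2 * y))) as T.
    replace (v + 2 * y + - (2 * y)) with v in T by ring.
    rewrite Rabs_Ropp, Rabs_mult, (Rabs_pos_eq 2) in T by lra.
    pose proof (Rabs_pos y). pose proof (Rabs_pos (v + 2 * y)).
    assert (eta / 3 * Rabs v <= eta / 3 * (Rabs (v + 2 * y) + 2 * Rabs y)) by (apply Rmult_le_compat_l; lra).
    assert (eta / 3 * Rabs (v + 2 * y) <= (1 + delta) * Rabs (v + 2 * y)) by (apply Rmult_le_compat_r; lra).
    lra.
Qed.

Lemma weber_expdec (q : R) (s : C) (delta : R) : 0 < q -> 1 / 4 < delta < 1 -> Re s = - delta ->
  exists K eta, expdec (fun y => RtoC (bj1 q y) * Cexp (s * RtoC (2 * y)))%C K eta.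
Proof.
intros Hq Hd Hs. destruct (bj1_weighted q delta Hq Hd) as (K & eta & HK & Heta & Hb).
exists K, eta. repeat split; [|lra|].
- intros y. apply continuous_Cmult.
  + apply continuous_RtoC, (continuous_bj1_comp q (fun y : R => y)), continuous_id.
  + apply continuous_Cexp, continuous_Cmult; [apply continuous_const|]. apply continuous_RtoC.
    apply (continuous_Rmult (fun _ : R => 2)); [apply continuous_const|apply continuous_id].
- intros y. rewrite Cmod_mult, Cmod_R, Cmod_Cexp.
  replace (Re (s * (2 * y)%R)%C) with (- 2 * delta * y) by (rewrite Re_Cmult, Hs; unfold Re, Im; simpl; ring).
  apply Hb.
Qed.

(* Both sides are iterated integrals of [weber_ker]. *)
Lemma weber (q : R) (s : C) (delta : R) : 0 < q -> 1 / 4 < delta < 1 -> Re s = - delta ->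
  (GammaL (1 - s) * LI (fun y => RtoC (bj1 q y) * Cexp (s * RtoC (2 * y))))%C =
  (/ 4 * Cexp (- (1 + s) * ln (q ^ 2 / 4)) * GammaL (1 + s))%C.
Proof.
intros Hq Hd Hs.
destruct (weber_ker_expdec2 q s delta Hq Hd Hs) as (K & eta & HW).
destruct (weber_expdec q s delta Hq Hd Hs) as (K1 & eta1 & HE).
pose proof (LI_Fubini _ _ _ HW) as HF.
assert (Hs1 : 0 < Re (1 - s)%C) by (rewrite Re_one_minus; lra).
destruct (gker_expdec (1 - s)%C Hs1) as [K2 HK2].
assert (Hs2 : 0 < Re (1 + s)%C) by (unfold Re in *; simpl; lra).
destruct (gker_expdec (1 + s)%C Hs2) as [K3 HK3].
assert (EL : LI (fun y => LI (weber_ker q s y)) =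
  (GammaL (1 - s) * LI (fun y => RtoC (bj1 q y) * Cexp (s * RtoC (2 * y))))%C).
{ rewrite <- (LI_mult _ _ _ (GammaL (1 - s)) HE). apply LI_ext. intros y.
  rewrite (LI_ext (weber_ker q s y) (fun v => (RtoC (bj1 q y) * Cexp (s * RtoC (2 * y))) * gker (1 - s) (v + 2 * y))%C)
    by (intros; apply weber_ker_gker).
  rewrite (LI_mult _ _ _ (RtoC (bj1 q y) * Cexp (s * RtoC (2 * y)))%C (expdec_translate _ _ _ (2 * y) HK2)).
  rewrite (LI_translate (gker (1 - s)%C) K2 (Re (1 - s)%C) (2 * y) HK2).
  unfold GammaL. ring. }
set (Q := q ^ 2 / 4) in *.
assert (HQ : 0 < Q) by (apply Rdiv_lt_0_compat; [apply pow_lt; assumption|lra]).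
assert (ER : LI (fun v => LI (fun y => weber_ker q s y v)) =
  (/ 4 * Cexp (- (1 + s) * ln Q) * GammaL (1 + s))%C).
(* The Gaussian transform leaves exp(- (1 + s) v - Q e^(- v)) / 4, which in the variable u = - v +
   ln Q is Euler's integrand for Gamma(1 + s); hence the reflection and the translation below. *)
{ assert (Ev : forall v, LI (fun y => weber_ker q s y v) =
    (/ 4 * Cexp (- (1 + s) * ln Q) * gker (1 + s) (- v + ln Q))%C).
  { intros v.
    destruct (gauss_ker_expdec q (exp v) Hq (exp_pos v)) as [K4 HK4].
    rewrite (LI_ext _ (fun y => Cexp ((1 - s) * v) * RtoC (gauss_ker q (exp v) y))%C).
    - rewrite (LI_mult _ _ _ (Cexp ((1 - s) * v)) HK4), LI_gauss_ker by (try assumption; apply exp_pos).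
      replace (exp (- q ^ 2 / (4 * exp v)) / (4 * exp v ^ 2)) with (/ 4 * exp (- Q * exp (- v) - 2 * v)).
      + rewrite RtoC_mult, RtoC_inv by lra. rewrite <- (Cexp_RtoC (- Q * exp (- v) - 2 * v)).
        unfold gker.
        replace (Cexp ((1 - s) * v) * (/ 4 * Cexp (- Q * exp (- v) - 2 * v)%R))%C with
          (/ 4 * (Cexp ((1 - s) * v) * Cexp (RtoC (- Q * exp (- v) - 2 * v))))%C by ring.
        rewrite <- !Cmult_assoc, <- !Cexp_plus. f_equal. f_equal.
        rewrite exp_plus, (exp_ln Q HQ). unfold Rminus. repeat rewrite ?RtoC_plus, ?RtoC_opp, ?RtoC_mult. ring.
      + replace (- Q * exp (- v) - 2 * v) with (- Q * exp (- v) + - (v + v)) by ring.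
        rewrite exp_plus, (exp_Ropp v), (exp_Ropp (v + v)), exp_plus.
        replace (- q ^ 2 / (4 * exp v)) with (- Q * / exp v) by (unfold Q; field; apply Rgt_not_eq, exp_pos).
        field. apply Rgt_not_eq, exp_pos.
    - intros y. unfold weber_ker, gauss_ker.
      rewrite (RtoC_mult (bj1 q y * exp (2 * y))), <- (Cexp_RtoC (- exp v * exp (2 * y))).
      replace (Cexp ((1 - s) * v) * (RtoC (bj1 q y * exp (2 * y)) * Cexp (RtoC (- exp v * exp (2 * y)))))%C with
        (RtoC (bj1 q y * exp (2 * y)) * (Cexp ((1 - s) * v) * Cexp (RtoC (- exp v * exp (2 * y)))))%C by ring.
      rewrite <- Cexp_plus. f_equal. f_equal. rewrite exp_plus, !RtoC_mult, RtoC_opp. ring. }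
  rewrite (LI_ext _ _ Ev).
  pose proof (expdec_translate _ _ _ (ln Q) HK3) as HT.
  rewrite (LI_mult _ _ _ (/ 4 * Cexp (- (1 + s) * ln Q))%C (expdec_reflect _ _ _ HT)).
  rewrite (LI_reflect _ _ _ HT).
  rewrite (LI_translate (gker (1 + s)%C) K3 (Re (1 + s)%C) (ln Q) HK3). reflexivity. }
rewrite <- EL, <- ER. exact HF.
Qed.

(** * The Hankel transform *)

(** The double integrand left by the integration by parts; the factor [pt (- delta) w] is the s
    produced by differentiating e^(s zeta). *)
Definition hankel_ker (q : R) (phi : C -> C) (delta y w : R) : C :=
  (RtoC (bj1 q y) * (pt (- delta) w * barnes_ker phi delta (RtoC (2 * y)) w))%C.

Lemma Cmod_pt_neg_le (delta w : R) : 0 < delta < 1 -> Cmod (pt (- delta) w) <= 1 + Rabs w.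
Proof.
intros Hd. eapply Rle_trans; [apply Cmod_le_abs|].
rewrite Re_pt, Im_pt, Rabs_Ropp, Rabs_pos_eq; lra.
Qed.

Lemma hankel_ker_expdec2 (q : R) (phi : C -> C) (delta C0 P B : R) :
  0 < q -> 1 / 4 < delta < 1 -> B < PI / 2 -> growth phi delta C0 P B ->
  exists K eta, expdec2 (hankel_ker q phi delta) K eta.
Proof.
intros Hq Hd HB Hg.
destruct (theta_of_range B HB) as [_ HetaB].
destruct (barnes_coef_bound phi delta C0 P B ltac:(lra) HB Hg) as (K1 & HK1 & Hc & Hb).
destruct (bj1_weighted q delta Hq Hd) as (K2 & eta2 & HK2 & Heta2 & Hb2).
destruct (one_plus_le_exp (eta_of B) HetaB) as (M & HM & HMb).
set (eta := Rmin eta2 (eta_of B)).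
pose proof (Rmin_l eta2 (eta_of B)) as E1; pose proof (Rmin_r eta2 (eta_of B)) as E2. fold eta in E1, E2.
assert (Heta : 0 < eta) by (apply Rmin_pos; lra).
exists (K2 * (M * K1)), eta. repeat split; [|assumption|].
- intros y w. unfold hankel_ker, barnes_ker. fold (barnes_coef phi delta).
  assert (Hp : continuous (T := prod_UniformSpace R_UniformSpace R_UniformSpace) (U := C_UniformSpace)
    (fun p : R * R => pt (- delta) (snd p)) (y, w)).
  { apply continuous_pt; [apply continuous_const|apply continuous_snd]. }
  apply continuous_Cmult.
  + apply continuous_RtoC, (continuous_bj1_comp q (fun p : R * R => fst p)), continuous_fst.
  + apply continuous_Cmult; [exact Hp|]. apply continuous_Cmult.
    * apply (continuous_comp (fun p : R * R => snd p) (barnes_coef phi delta)); [apply continuous_snd|apply Hc].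
    * apply continuous_Cexp, continuous_Cmult; [exact Hp|]. apply continuous_RtoC.
      apply (continuous_Rmult (fun _ : R * R => 2)); [apply continuous_const|apply continuous_fst].
- intros y w. unfold hankel_ker, barnes_ker. fold (barnes_coef phi delta w).
  rewrite !Cmod_mult, Cmod_R, Cmod_Cexp, Re_Cmult, Re_pt, Im_pt.
  replace (- delta * Re (2 * y)%R - w * Im (2 * y)%R) with (- 2 * delta * y) by (unfold Re, Im; simpl; ring).
  replace (Rabs (bj1 q y) * (Cmod (pt (- delta) w) * (Cmod (barnes_coef phi delta w) * exp (- 2 * delta * y)))) with
    ((Rabs (bj1 q y) * exp (- 2 * delta * y)) * (Cmod (pt (- delta) w) * Cmod (barnes_coef phi delta w))) by ring.
  pose proof (Rabs_pos w) as Hw. pose proof (Rabs_pos y) as Hy.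
  replace (K2 * (M * K1) * exp (- eta * Rabs y) * exp (- eta * Rabs w)) with
    (K2 * exp (- eta * Rabs y) * (M * K1 * exp (- eta * Rabs w))) by ring.
  apply Rmult_le_compat.
  + apply Rmult_le_pos; [apply Rabs_pos|left; apply exp_pos].
  + apply Rmult_le_pos; apply Cmod_ge_0.
  + eapply Rle_trans; [apply Hb2|]. apply Rmult_le_compat_l; [assumption|]. apply exp_le.
    assert (eta * Rabs y <= eta2 * Rabs y) by (apply Rmult_le_compat_r; lra). lra.
  + apply Rle_trans with (M * exp (eta_of B * Rabs w) * (K1 * exp (- (2 * eta_of B) * Rabs w))).
    * apply Rmult_le_compat; try apply Cmod_ge_0; [|apply Hb].
      eapply Rle_trans; [apply Cmod_pt_neg_le; lra|now apply HMb].
    * replace (M * exp (eta_of B * Rabs w) * (K1 * exp (- (2 * eta_of B) * Rabs w))) with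
        (M * K1 * (exp (eta_of B * Rabs w) * exp (- (2 * eta_of B) * Rabs w))) by ring.
      apply Rmult_le_compat_l; [apply Rmult_le_pos; lra|]. rewrite <- exp_plus. apply exp_le.
      assert (eta * Rabs w <= eta_of B * Rabs w) by (apply Rmult_le_compat_r; lra). lra.
Qed.

Lemma pt_mult_barnes_expdec (phi : C -> C) (delta C0 P B : R) (x : R) :
  0 < delta < 1 -> B < PI / 2 -> growth phi delta C0 P B ->
  exists K eta, expdec (fun w => pt (- delta) w * barnes_ker phi delta (RtoC x) w)%C K eta.
Proof.
intros Hd HB Hg. destruct (theta_of_range B HB) as [_ Heta].
destruct (barnes_coef_bound phi delta C0 P B Hd HB Hg) as (_ & _ & Hc & _).
destruct (barnes_ker_expdec phi delta C0 P B Hd HB Hg) as (K & _ & Hb).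
specialize (Hb (RtoC x)). unfold Im in Hb; simpl in Hb. rewrite Rabs_R0 in Hb. specialize (Hb ltac:(lra)).
destruct (Cder_LI_exp (barnes_coef phi delta) (pt (- delta)) 1 (K * exp (- delta * Re x)) (eta_of B) (RtoC x) Hc)
  as [_ [K' HK']].
- intros y. apply continuous_pt; [apply continuous_const|apply continuous_id].
- lra.
- intros y. rewrite Rmult_1_l. now apply Cmod_pt_neg_le.
- exact Hb.
- exists K', (eta_of B / 2). exact HK'.
Qed.

Lemma is_derive_RtoC_mult (u : R -> R) (F : R -> C) (x du : R) (dF : C) :
  is_derive u x du -> is_derive_RC F x dF ->
  is_derive_RC (fun t => RtoC (u t) * F t)%C x
    (RtoC du * F x + RtoC (u x) * dF)%C.
Proof.
intros Hu HF.
pose proof (filterdiff_scal_fct (K := R_AbsRing) (U := R_NormedModule) (V := C_R_NormedModule) x u F _ _ Rmult_comm Hu HF) as H.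
apply (is_derive_ext (K := R_AbsRing) (V := C_R_NormedModule) (fun t => scal (u t) (F t))).
{ intros t. apply C_ext; simpl; unfold scal; simpl; unfold mult; simpl; unfold Re, Im; simpl; ring. }
apply (filterdiff_ext_lin _ _ _ H). intros t.
apply C_ext; simpl; unfold scal, plus; simpl; unfold mult; simpl; unfold Re, Im; simpl; ring.
Qed.

Lemma hankel_parts (q : R) (phi : C -> C) (delta C0 P B : R) (Y1 Y2 : R) :
  0 < q -> 1 / 4 < delta < 1 -> B < PI / 2 -> growth phi delta C0 P B -> Y1 <= Y2 ->
  CInt (fun y => RtoC (exp (2 * y) * bessel_J0 (q * exp y)) * barnes phi delta (RtoC (2 * y)))%C Y1 Y2 =
  (RtoC (bj1 q Y2) * barnes phi delta (RtoC (2 * Y2)) - RtoC (bj1 q Y1) * barnes phi delta (RtoC (2 * Y1))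
   - / PI * CInt (fun y => LI (hankel_ker q phi delta y)) Y1 Y2)%C.
Proof.
intros Hq Hd HB Hg HY.
destruct (theta_of_range B HB) as [_ HetaB].
assert (Hpi : RtoC PI <> 0) by (intros E0; apply RtoC_inj in E0; pose proof PI_RGT_0; lra).
destruct (hankel_ker_expdec2 q phi delta C0 P B Hq Hd HB Hg) as (K & eta & HH).
assert (HC : ccont (fun y => LI (hankel_ker q phi delta y))) by apply (expdec2_LI _ _ _ HH).
assert (HIm : forall y : R, Rabs (Im (RtoC y)) <= eta_of B).
{ intros y. unfold Im; simpl. rewrite Rabs_R0. lra. }
assert (Hder : forall y : R, Cder (barnes phi delta) (RtoC y) (/ (2 * PI) * LI (fun w => pt (- delta) w * barnes_ker phi delta y w))%C).
{ intros y. apply (barnes_Cder phi delta C0 P B); try assumption; [lra|apply HIm]. }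
assert (HLI : forall y, LI (hankel_ker q phi delta y) =
  (RtoC (bj1 q y) * LI (fun w => pt (- delta) w * barnes_ker phi delta (RtoC (2 * y)) w))%C).
{ intros y. destruct (pt_mult_barnes_expdec phi delta C0 P B (2 * y) ltac:(lra) HB Hg) as (K1 & eta1 & H1).
  exact (LI_mult _ _ _ (RtoC (bj1 q y)) H1). }
set (f := fun y => (RtoC (exp (2 * y) * bessel_J0 (q * exp y)) * barnes phi delta (RtoC (2 * y)))%C).
assert (Hf : ccont f).
{ intros y.
  assert (H2 : continuous (fun y : R => 2 * y) y).
  { apply (continuous_Rmult (fun _ : R => 2)); [apply continuous_const|apply continuous_id]. }
  apply continuous_Cmult.
  - apply continuous_RtoC, continuous_Rmult.
    + now apply (continuous_Rexp (fun y : R => 2 * y)).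
    + apply (continuous_comp (fun y => q * exp y) bessel_J0); [|apply continuous_J0].
      apply (continuous_Rmult (fun _ : R => q)); [apply continuous_const|].
      apply (continuous_Rexp (fun y : R => y)), continuous_id.
  - apply (Cdiff_comp_continuous (barnes phi delta) (fun y : R => RtoC (2 * y))); [now apply continuous_RtoC|].
    eexists; apply Hder. }
assert (HD : CInt (fun y => f y + / PI * LI (hankel_ker q phi delta y))%C Y1 Y2 =
  (RtoC (bj1 q Y2) * barnes phi delta (RtoC (2 * Y2)) - RtoC (bj1 q Y1) * barnes phi delta (RtoC (2 * Y1)))%C).
{ apply (CInt_derive (fun y => RtoC (bj1 q y) * barnes phi delta (RtoC (2 * y)))%C); [assumption| |].
  - intros y _.
    (* The argument is zeta = log x^2 = 2 y; its speed 2 turns the factor 1 / (2 pi) of [barnes]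
       into 1 / pi. *)
    pose proof (fun l => Cder_real_curve (barnes phi delta) 0 l 2 y) as H1.
    replace (0 + y * 2)%C with (RtoC (2 * y)) in H1 by (rewrite RtoC_mult; ring).
    specialize (H1 _ (Hder (2 * y))).
    replace (fun t : R => barnes phi delta (0 + t * 2)%C) with (fun t : R => barnes phi delta (RtoC (2 * t))) in H1.
    2:{ apply functional_extensionality; intros t. f_equal. rewrite RtoC_mult; ring. }
    pose proof (is_derive_RtoC_mult (bj1 q) _ y _ _ (is_derive_bj1 q y ltac:(lra)) H1) as H2.
    cbv beta in H2.
    match type of H2 with is_derive _ _ ?l => replace (f y + / PI * LI (hankel_ker q phi delta y))%C with l; [exact H2|] end.
    rewrite HLI. unfold f. field. exact Hpi.
  - intros y _. apply continuous_Cplus; [apply Hf|].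
    apply continuous_Cmult; [apply continuous_const|apply HC]. }
rewrite <- HD.
rewrite CInt_plus.
- rewrite CInt_mult by now apply ccont_integrable. unfold f. ring.
- now apply ccont_integrable.
- apply ccont_integrable. intros y. apply continuous_Cmult; [apply continuous_const|apply HC].
Qed.

Lemma hankel_boundary (q : R) (phi : C -> C) (delta C0 P B : R) :
  0 < q -> 1 / 4 < delta < 1 -> B < PI / 2 -> growth phi delta C0 P B ->
  exists K eta, 0 <= K /\ 0 < eta /\ forall y,
    Cmod (RtoC (bj1 q y) * barnes phi delta (RtoC (2 * y)))%C <= K * exp (- eta * Rabs y).
Proof.
intros Hq Hd HB Hg.
destruct (theta_of_range B HB) as [_ HetaB].
destruct (barnes_ker_expdec phi delta C0 P B ltac:(lra) HB Hg) as (K1 & HK1 & Hb).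
destruct (bj1_weighted q delta Hq Hd) as (K2 & eta2 & HK2 & Heta2 & Hb2).
assert (Hpi : 0 < 2 * PI) by (pose proof PI_RGT_0; lra).
set (M := / (2 * PI) * (2 * K1 / eta_of B)).
assert (HM : 0 <= M).
{ apply Rmult_le_pos; [left; now apply Rinv_0_lt_compat|]. apply Rdiv_le_0_compat; lra. }
exists (K2 * M), eta2. split; [now apply Rmult_le_pos|]. split; [lra|]. intros y.
assert (Hbar : Cmod (barnes phi delta (RtoC (2 * y))) <= M * exp (- 2 * delta * y)).
{ unfold barnes. rewrite Cmod_mult.
  replace (/ (2 * PI))%C with (RtoC (/ (2 * PI))) by (rewrite RtoC_inv, RtoC_mult by lra; reflexivity).
  rewrite Cmod_RtoC_nonneg by (left; now apply Rinv_0_lt_compat).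
  unfold M. rewrite Rmult_assoc. apply Rmult_le_compat_l; [left; now apply Rinv_0_lt_compat|].
  eapply Rle_trans; [apply (LI_Cmod_le _ _ _ (Hb (RtoC (2 * y)) ltac:(unfold Im; simpl; rewrite Rabs_R0; lra)))|].
  unfold Re; simpl. replace (- delta * (2 * y)) with (- 2 * delta * y) by ring. right. field. lra. }
rewrite Cmod_mult, Cmod_R.
apply Rle_trans with (Rabs (bj1 q y) * (M * exp (- 2 * delta * y))).
- apply Rmult_le_compat_l; [apply Rabs_pos|exact Hbar].
- replace (Rabs (bj1 q y) * (M * exp (- 2 * delta * y))) with (M * (Rabs (bj1 q y) * exp (- 2 * delta * y))) by ring.
  replace (K2 * M * exp (- eta2 * Rabs y)) with (M * (K2 * exp (- eta2 * Rabs y))) by ring.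
  apply Rmult_le_compat_l; [assumption|apply Hb2].
Qed.

(** The logarithmic variable never reaches x = 0, so the interval from 0 to e^(- W) is split off and
    estimated by boundedness; on the rest the boundary terms tend to 0. *)
Lemma is_hankel0_LI (f : R -> C) (g phi : C -> C) (q delta C0 P B : R) :
  0 < q -> 1 / 4 < delta < 1 -> B < PI / 2 -> growth phi delta C0 P B ->
  (forall x : R, 0 <= x -> f x = g (RtoC (x ^ 2))) ->
  (forall x : R, 0 <= x -> Cdiff g (RtoC x)) ->
  (forall t : R, g (RtoC (exp t)) = barnes phi delta (RtoC t)) ->
  is_hankel0 f q (- / PI * LI (fun y => LI (hankel_ker q phi delta y)))%C.
Proof.
intros Hq Hd HB Hg Hf Hgd Hgb.
destruct (hankel_boundary q phi delta C0 P B Hq Hd HB Hg) as (K1 & eta1 & HK1 & Heta1 & Hbd).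
destruct (hankel_ker_expdec2 q phi delta C0 P B Hq Hd HB Hg) as (K & eta & HH).
pose proof (expdec2_LI _ _ _ HH) as HL. set (K' := 2 * K / eta) in HL.
assert (Heta : 0 < eta) by apply HH.
(* [f] is prescribed for x >= 0 only, whereas this integrand is continuous on the whole line. *)
set (F0 := fun x : R => (RtoC (bessel_J0 (q * x)) * g (RtoC (x ^ 2)) * RtoC x)%C).
assert (HF0 : ccont F0).
{ intros x. apply continuous_Cmult; [apply continuous_Cmult|].
  - apply continuous_RtoC. apply (continuous_comp (fun x => q * x) bessel_J0); [|apply continuous_J0].
    apply (continuous_Rmult (fun _ : R => q)); [apply continuous_const|apply continuous_id].
  - apply (Cdiff_comp_continuous g (fun x : R => RtoC (x ^ 2))).
    + apply continuous_RtoC, (continuous_pow2 (fun x : R => x)), continuous_id.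
    + apply Hgd, pow2_ge_0.
  - apply continuous_RtoC, continuous_id. }
destruct (continuous_bounded F0 0 1 Rle_0_1 (fun x _ => HF0 x)) as [M HM].
assert (HM0 : 0 <= M) by (eapply Rle_trans; [apply Cmod_ge_0|apply (HM 0); lra]).
set (L := LI (fun y => LI (hankel_ker q phi delta y))) in *.
assert (Hsub : forall Y1 Y2, Y1 <= Y2 -> CInt F0 (exp Y1) (exp Y2) =
  CInt (fun y => RtoC (exp (2 * y) * bessel_J0 (q * exp y)) * barnes phi delta (RtoC (2 * y)))%C Y1 Y2).
{ intros Y1 Y2 HY.
  pose proof (is_RInt_comp (V := CV) F0 exp exp Y1 Y2
    (fun x _ => HF0 (exp x)) (fun x _ => is_derive_exp_real x)) as H.
  symmetry. apply CInt_unique. revert H. apply is_RInt_ext. intros y _.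
  unfold F0.
  replace (exp y ^ 2) with (exp (2 * y)) by (replace (2 * y) with (y + y) by ring; rewrite exp_plus; simpl; ring).
  rewrite Hgb. set (b := barnes phi delta (2 * y)%R).
  replace (2 * y) with (y + y) by ring. rewrite exp_plus.
  apply C_ext; simpl; unfold scal; simpl; unfold mult; simpl; unfold Re, Im; simpl; ring. }
assert (Hlim : forall e, 0 < e -> exists W0, forall b, exp W0 <= b -> Cmod (CInt F0 0 b - (- / PI * L))%C <= e).
{ intros e He.
  destruct (exp_small M 1 (e / 4) Rlt_0_1 ltac:(lra)) as [W1 [HW1 HW1']].
  destruct (exp_small (2 * K1) eta1 (e / 4) Heta1 ltac:(lra)) as [W2 [HW2 HW2']].
  destruct (exp_small (2 * (K' / eta)) eta (e / 4) Heta ltac:(lra)) as [W3 [HW3 HW3']].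
  set (W := Rmax W1 (Rmax W2 W3)).
  pose proof (Rmax_l W1 (Rmax W2 W3)) as R1. pose proof (Rmax_r W1 (Rmax W2 W3)) as R2.
  pose proof (Rmax_l W2 W3) as R3. pose proof (Rmax_r W2 W3) as R4. fold W in R1, R2.
  exists W. intros b Hb. pose proof (exp_pos W).
  assert (Hlnb : W <= ln b).
  { rewrite <- (ln_exp W). apply ln_le; [apply exp_pos|assumption]. }
  set (Y := ln b) in *. assert (EY : b = exp Y) by (unfold Y; rewrite exp_ln; lra).
  assert (Hm : 0 < exp (- W) <= 1).
  { split; [apply exp_pos|]. rewrite <- exp_0. apply exp_le. lra. }
  rewrite <- (CInt_Chasles F0 0 (exp (- W)) b) by now apply ccont_integrable.
  rewrite EY, Hsub, (hankel_parts q phi delta C0 P B) by (try assumption; lra).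
  set (J := CInt (fun y => LI (hankel_ker q phi delta y)) (- W) Y).
  pose proof (LI_spec _ _ _ (- W) Y HL ltac:(lra) ltac:(lra)) as S. fold J in S. fold L in S.
  pose proof (Hbd Y) as B1. pose proof (Hbd (- W)) as B2.
  rewrite Rabs_Ropp in B2. rewrite Rabs_pos_eq in B1, B2 by lra.
  set (b1 := (RtoC (bj1 q Y) * barnes phi delta (RtoC (2 * Y)))%C) in *.
  set (b2 := (RtoC (bj1 q (- W)) * barnes phi delta (RtoC (2 * - W)))%C) in *.
  set (I0 := CInt F0 0 (exp (- W))).
  assert (HI0 : Cmod I0 <= exp (- W) * M).
  { replace (exp (- W) * M) with ((exp (- W) - 0) * M) by ring.
    apply CInt_Cmod_le_const; [lra|now apply ccont_integrable|]. intros x Hx. apply HM. lra. }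
  replace (I0 + (b1 - b2 - / PI * J) - - / PI * L)%C with ((I0 + (b1 + - b2)) + - (/ PI * (J - L)))%C by ring.
  eapply Rle_trans; [apply Cmod_triangle|].
  eapply Rle_trans; [apply Rplus_le_compat_r, Cmod_triangle|].
  eapply Rle_trans; [apply Rplus_le_compat_r, Rplus_le_compat_l, Cmod_triangle|].
  rewrite !Cmod_opp, Cmod_mult.
  assert (Hpi : 1 < PI) by (pose proof PI2_1; lra).
  assert (Hpi' : Cmod (/ PI)%C <= 1).
  { rewrite <- RtoC_inv, Cmod_RtoC_nonneg by (try lra; left; apply Rinv_0_lt_compat; lra).
    rewrite <- Rinv_1. apply Rinv_le_contravar; lra. }
  assert (S2 : Cmod (/ PI)%C * Cmod (J - L)%C <= e / 4).
  { apply Rle_trans with (1 * Cmod (J - L)%C); [apply Rmult_le_compat_r; [apply Cmod_ge_0|assumption]|].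
    pose proof (HW3' W ltac:(lra)). pose proof (HW3' Y ltac:(lra)).
    replace (eta * - W) with (- eta * W) in S by ring. lra. }
  pose proof (HW1' W ltac:(lra)) as T1. replace (- (1) * W) with (- W) in T1 by ring.
  pose proof (HW2' W ltac:(lra)). pose proof (HW2' Y ltac:(lra)). lra. }
assert (Hint : forall b, 0 <= b -> is_RInt_C
  (fun x : R => (RtoC (bessel_J0 (q * x)) * f x * RtoC x)%C) 0 b (CInt F0 0 b)).
{ intros b Hb. apply (is_RInt_ext (V := C_R_NormedModule) F0).
  - rewrite Rmin_left, Rmax_right by assumption. intros x Hx. unfold F0. rewrite Hf by lra. reflexivity.
  - now apply CInt_correct, ccont_integrable. }
intros Pr [e HP].
destruct (Hlim (e / 2)) as [W0 HW0].
{ pose proof (cond_pos e); lra. }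
apply (Filter_prod _ _ _ (fun a => a = 0) (fun b => exp W0 < b)).
- reflexivity.
- exists (exp W0); tauto.
- intros a b Ha Hb. subst a. pose proof (exp_pos W0). exists (CInt F0 0 b); split.
  + apply Hint. lra.
  + apply HP, Cmod_ball_C. eapply Rle_lt_trans; [apply HW0; lra|]. pose proof (cond_pos e). lra.
Qed.

(** * The integrand on vertical lines and the final formula *)

Definition line_ker (q : R) (phi : C -> C) (s : C) : C :=
  (phi s * GammaL (s + 1) * rcpow (q ^ 2 / 4) (- s))%C.

Lemma line_ker_Cdiff (q : R) (phi : C -> C) (delta C0 P B : R) (s : C) : 0 < delta < 1 ->
  growth phi delta C0 P B -> - delta <= Re s -> Cdiff (line_ker q phi) s.
Proof.
intros Hd [Hg _] Hs. apply Cdiff_mult; [apply Cdiff_mult; [now apply Hg|]|].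
- apply (Cdiff_comp (fun s => s + 1)%C GammaL).
  + apply Cdiff_plus; [apply Cdiff_id|apply Cdiff_const].
  + apply GammaL_Cdiff. unfold Re in *; simpl; lra.
- apply Cdiff_Cexp, Cdiff_mult; [apply Cdiff_opp, Cdiff_id|apply Cdiff_const].
Qed.

Lemma line_ker_bound (q : R) (phi : C -> C) (delta C0 P B : R) : 0 < delta < 1 -> B < PI / 2 ->
  growth phi delta C0 P B -> exists K, forall x y, - delta <= x <= 0 ->
    Cmod (line_ker q phi (pt x y)) <= K * exp (- (2 * eta_of B) * Rabs y).
Proof.
intros Hd HB Hg. pose proof (growth_C0_pos phi delta C0 P B ltac:(lra) Hg) as HC0.
destruct (theta_of_range B HB) as [Ht Heta].
destruct (GammaL_decay (1 - delta) 1 (theta_of B) ltac:(lra) Ht) as [K [HK HKb]].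
set (l := ln (q ^ 2 / 4)).
exists (C0 * exp (Rabs P) * K * exp (Rabs l)). intros x y Hx.
assert (Hx1 : Rabs x <= 1) by (apply Rabs_le; lra).
unfold line_ker, rcpow. rewrite !Cmod_mult, Cmod_Cexp. fold l.
pose proof (proj2 Hg (pt x y)) as B1. rewrite Re_pt, Im_pt in B1. specialize (B1 ltac:(lra)).
pose proof (HKb (pt x y + 1)%C) as B2.
replace (Re (pt x y + 1)%C) with (x + 1) in B2 by (unfold pt, Re; simpl; ring).
replace (Im (pt x y + 1)%C) with y in B2 by (unfold pt, Im; simpl; ring).
specialize (B2 ltac:(lra)).
replace (Re (- pt x y * l)%C) with (- x * l) by (unfold pt, Re, Im; simpl; ring).
assert (B3 : exp (- x * l) <= exp (Rabs l)).
{ apply exp_le, Rabs_mult_le_1. now rewrite Rabs_Ropp. }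
assert (B4 : C0 * exp (P * x + B * Rabs y) <= C0 * (exp (Rabs P) * exp (B * Rabs y))).
{ apply Rmult_le_compat_l; [assumption|]. rewrite <- exp_plus. apply exp_le.
  pose proof (Rabs_mult_le_1 x P Hx1). lra. }
apply Rle_trans with (C0 * (exp (Rabs P) * exp (B * Rabs y)) * (K * exp (- theta_of B * Rabs y)) * exp (Rabs l)).
- apply Rmult_le_compat; [apply Rmult_le_pos; apply Cmod_ge_0|left; apply exp_pos| |assumption].
  apply Rmult_le_compat; try apply Cmod_ge_0; [lra|assumption].
- replace (C0 * (exp (Rabs P) * exp (B * Rabs y)) * (K * exp (- theta_of B * Rabs y)) * exp (Rabs l)) with
    (C0 * exp (Rabs P) * K * exp (Rabs l) * (exp (B * Rabs y) * exp (- theta_of B * Rabs y))) by ring.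
  rewrite <- exp_plus. right. f_equal. f_equal. unfold eta_of. field.
Qed.

(** After Fubini the inner integral over [y] is Weber's; the factor s Gamma(- s) in front of it is -
    Gamma(1 - s), exactly the one that Weber's formula evaluates. *)
Lemma LI_hankel_ker (q : R) (phi : C -> C) (delta C0 P B : R) :
  0 < q -> 1 / 4 < delta < 1 -> B < PI / 2 -> growth phi delta C0 P B ->
  LI (fun y => LI (hankel_ker q phi delta y)) =
  (- / RtoC (q ^ 2) * LI (fun w => line_ker q phi (pt (- delta) w)))%C.
Proof.
intros Hq Hd HB Hg.
destruct (theta_of_range B HB) as [_ Heta].
destruct (hankel_ker_expdec2 q phi delta C0 P B Hq Hd HB Hg) as (K & eta & HH).
rewrite (LI_Fubini _ _ _ HH).
destruct (line_ker_bound q phi delta C0 P B ltac:(lra) HB Hg) as [K1 HK1].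
assert (Hexp : expdec (fun w => line_ker q phi (pt (- delta) w)) K1 (2 * eta_of B)).
{ apply vert_expdec; [lra| |].
  - intros w. apply Cdiff_Ccts, (line_ker_Cdiff q phi delta C0 P B); try assumption; [lra|]. rewrite Re_pt. lra.
  - intros w. apply HK1. lra. }
rewrite <- (LI_mult _ _ _ (- / RtoC (q ^ 2))%C Hexp).
apply LI_ext. intros w.
set (s := pt (- delta) w). assert (Hs : Re s = - delta) by apply Re_pt.
destruct (weber_expdec q s delta Hq Hd Hs) as (K2 & eta2 & HE).
rewrite (LI_ext _ (fun y => (s * (phi s * GammaL (- s))) * (RtoC (bj1 q y) * Cexp (s * RtoC (2 * y))))%C).
2:{ intros y. unfold hankel_ker, barnes_ker. fold s. ring. }
rewrite (LI_mult _ _ _ (s * (phi s * GammaL (- s)))%C HE).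
pose proof (weber q s delta Hq Hd Hs) as HWb.
replace (1 - s)%C with (- s + 1)%C in HWb by ring.
rewrite GammaL_succ in HWb by (unfold Re in *; simpl; lra).
set (X := LI (fun y => RtoC (bj1 q y) * Cexp (s * RtoC (2 * y)))%C) in *.
replace (s * (phi s * GammaL (- s)) * X)%C with (- phi s * (- s * GammaL (- s) * X))%C by ring.
rewrite HWb. unfold line_ker, rcpow.
set (Q := q ^ 2 / 4).
assert (HQ : 0 < Q) by (apply Rdiv_lt_0_compat; [apply pow_lt; assumption|lra]).
replace (- (1 + s) * ln Q)%C with (- s * ln Q - ln Q)%C by ring.
rewrite Cexp_minus, Cexp_RtoC, exp_ln by assumption.
replace (1 + s)%C with (s + 1)%C by ring.
(* The factor 1/4 of Weber's formula and the extra power Q^(-1) combine to 1 / q^2. *)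
replace (RtoC (q ^ 2)) with (4 * Q)%C by (unfold Q; rewrite RtoC_div by lra; field).
field. intros E0; apply RtoC_inj in E0; lra.
Qed.

Theorem theorem1 :
  forall (q : R) (g : C -> C) (f : R -> C)
    (D : C -> Prop) (d delta : R) (gbar : C -> C) (C0 P B alpha : R),
    0 < q ->
    (forall x : R, 0 <= x -> f x = g (RtoC (x ^ 2))) ->
    (* (1) *)
    is_domain D ->
    (forall x : R, 0 <= x -> D (RtoC x)) ->
    regular_on D g ->
    locally (T := C_UniformSpace) (RtoC 0)
      (fun z => is_pseries (K := C_AbsRing) (V := C_NormedModule)
                  (fun m => (gbar0 g m / RtoC (INR (fact m)))%C) (- z)%C (g z)) ->
    (* (2) *)
    1 / 4 < d ->
    (exists K : R, Rbar_locally p_infty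
       (fun x : R => Cmod (g (RtoC x)) <= K * Rpower x (- d))) ->
    (* (3) *)
    1 / 4 < delta < 1 ->
    regular_on (half_plane delta) gbar ->
    (forall m : nat, gbar (RtoC (INR m)) = gbar0 g m) ->
    B < PI / 2 ->
    (forall s : C, half_plane delta s ->
       Cmod (gbar s) < C0 * exp (P * Re s + B * Rabs (Im s))) ->
    (* the line Re s = alpha lies in the half-plane on which gbar is given *)
    -1 < alpha < 0 -> - delta <= alpha ->
    exists I : C,
      is_vertical_int alpha
        (fun s => (gbar s * CGamma (s + RtoC 1) * rcpow (q ^ 2 / 4) (- s))%C) I /\
      is_hankel0 f q (RtoC 1 / (RtoC PI * Ci * RtoC (q ^ 2)) * I)%C.
Proof.
intros q g f D d delta gbar C0 P B alpha Hq Hf _ HD Hg Hser _ _ Hdelta Hgbar Hint HB Hgrowth Halpha Hda.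
assert (Hgr : growth gbar delta C0 P B).
{ split.
  - intros s Hs. apply ex_derive_Cdiff. exact (locally_singleton _ _ (Hgbar s Hs)).
  - intros s Hs. left. now apply Hgrowth. }
destruct (theta_of_range B HB) as [_ Heta].
assert (Hgd : forall x : R, 0 <= x -> Cdiff g (RtoC x)).
{ intros x Hx. apply ex_derive_Cdiff. exact (locally_singleton _ _ (Hg _ (HD x Hx))). }
assert (Hbar : forall t : R, g (RtoC (exp t)) = barnes gbar delta (RtoC t)).
{ apply (barnes_eq g gbar delta C0 P B); try assumption; [lra|].
  intros x Hx. apply Hg, HD. lra. }
pose proof (is_hankel0_LI f g gbar q delta C0 P B Hq Hdelta HB Hgr Hf Hgd Hbar) as HH.
rewrite (LI_hankel_ker q gbar delta C0 P B Hq Hdelta HB Hgr) in HH.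
destruct (line_ker_bound q gbar delta C0 P B ltac:(lra) HB Hgr) as [K HK].
assert (Hd' : forall s, - delta <= Re s -> Cdiff (line_ker q gbar) s).
{ intros s Hs. apply (line_ker_Cdiff q gbar delta C0 P B); try assumption. lra. }
(* Between the two lines Re s > -1, so Gamma(s + 1) is regular there and no residue arises. *)
assert (Hshift : LI (fun w => line_ker q gbar (pt alpha w)) = LI (fun w => line_ker q gbar (pt (- delta) w))).
{ apply (LI_shift _ _ _ K (2 * eta_of B)); [lra|lra| |].
  - intros z Hz. apply Hd'. lra.
  - intros x y Hx. apply HK. lra. }
assert (Hexp : expdec (fun w => line_ker q gbar (pt alpha w)) K (2 * eta_of B)).
{ apply vert_expdec; [lra| |].
  - intros w. apply Cdiff_Ccts, Hd'. rewrite Re_pt. lra.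
  - intros w. apply HK. lra. }
(* The factor i is that of ds = i dw on the upward line. *)
exists (Ci * LI (fun w => line_ker q gbar (pt alpha w)))%C. split.
- unfold is_vertical_int. rewrite <- (LI_mult _ _ _ Ci Hexp).
  replace (fun w : R => _) with (fun w => Ci * line_ker q gbar (pt alpha w))%C.
  + apply (LI_is_RInt_gen _ _ _ (expdec_mult_const _ _ _ Ci Hexp)).
  + apply functional_extensionality. intros w. unfold line_ker.
    change (RtoC alpha + Ci * RtoC w)%C with (pt alpha w).
    rewrite CGamma_GammaL; [ring|].
    replace (Re (pt alpha w + 1)%C) with (alpha + 1) by (unfold pt, Re; simpl; ring). lra.
- rewrite Hshift.
  (* The constants agree: (- 1 / pi) (- 1 / q^2) = i / (pi i q^2). *)
  match type of HH with is_hankel0 _ _ ?A => match goal with |- is_hankel0 _ _ ?A' => replace A' with A; [exact HH|] end end.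
  assert (Hpi : RtoC PI <> 0) by (intros E0; apply RtoC_inj in E0; pose proof PI_RGT_0; lra).
  assert (Hq2 : RtoC (q ^ 2) <> 0).
  { intros E0; apply RtoC_inj in E0. pose proof (pow_lt q 2 Hq). lra. }
  assert (HCi : Ci <> 0) by (intros E0; apply (f_equal Im) in E0; simpl in E0; lra).
  field. repeat split; assumption.
Qed.
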